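(* Let $\varphi:\mathbb{R}^d\to\mathbb{R}$ be a measurable even pair potential that is superstable and regular, let $H$ be the associated pair energy, and let $\nu\in\mathcal{P}_\theta$ be a tempered (translation-invariant) Gibbs measure with respect to $H$. Assume that $\nu$ satisfies (MLSI--b) with some constant $c_\nu>0$, i.e. $$\mathrm{Ent}_\nu[F]\le c_\nu\,\nu\Big[\int_{\mathbb{R}^d}b(x,\cdot)\,(D_xF)\,(D_x\log F)\,dx\Big]$$ for all bounded local functions $F:\Omega\to(0,\infty)$. Then $\mathscr{I}(\mu\,|\,\nu)>0$ for all $\mu\in\mathcal{P}_\theta\setminus\{\nu\}$. In particular, there is no other tempered, translation-invariant Gibbs measure with respect to $H$.
   Context: $\Omega$ is the set of simple locally finite counting measures (point configurations) on $\mathbb{R}^d$, each identified with its support. $\mathcal{F}$ is the $\sigma$-algebra on $\Omega$ generated by the counting variables $N_\Lambda(\omega)=\#(\omega\cap\Lambda)$, for $\Lambda\Subset\mathbb{R}^d$, meaning $\Lambda\subseteq\mathbb{R}^d$ bounded and Borel. For $\Lambda\subseteq\mathbb{R}^d$, $\eta_\Lambda=\eta\cap\Lambda$, and $\eta_\Lambda\omega_{\Lambda^c}$ is the union of $\eta_\Lambda$ and $\omega_{\Lambda^c}$. $\mathcal{F}_\Lambda$ is the sub-$\sigma$-algebra generated by $N_\Delta$, $\Delta\Subset\mathbb{R}^d$, $\Delta\subseteq\Lambda$, and $\mu_\Lambda$ is the restriction of a probability measure $\mu$ to $\mathcal{F}_\Lambda$. Translations act by $\theta_x\omega=\sum_i\delta_{x_i-x}$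 for $\omega=\sum_i\delta_{x_i}$, and $\mathcal{P}_\theta$ is the set of probability measures on $(\Omega,\mathcal{F})$ invariant under all $\theta_x$, $x\in\mathbb{R}^d$. A measurable function $F:\Omega\to\mathbb{R}$ is local if there is $\Lambda\Subset\mathbb{R}^d$ with $F(\eta)=F(\eta_\Lambda)$ for all $\eta$. $\nu[F]$ denotes the expectation of $F$ under $\nu$. Discrete gradient: $(D_xF)(\eta)=F(\eta+\delta_x)-F(\eta)$, defined for $x\notin\eta$ (for given $\eta$ this excludes only a Lebesgue-null set of $x$). Entropy: with $\Phi(x)=x\log x$ ($\Phi(0)=0$), $\mathrm{Ent}_\nu[F]=\nu[\Phi(F)]-\Phi(\nu[F])$. Relative entropy: $I(P\,|\,Q)=Q[\Phi(f)]$ if the density $f=dP/dQ$ exists, and $I(P\,|\,Q)=\infty$ otherwise. With $\Lambda_n=[-n,n]^d$ and $|\cdot|$ Lebesgue measure, the specific relative entropy is $\mathscr{I}(\mu\,|\,\nu)=\liminf_{n\to\infty}\frac{1}{|\Lambda_n|}I(\mu_{\Lambda_n}\,|\,\nu_{\Lambda_n})$, which is the limit whenever the limit exists. Pair energy: $H(\omega)=\sum_{\{x,y\}\subseteq\omega,\,x\ne y}\varphi(x-y)$ for finite point configurations $\omega$. The potential $\varphi$ is superstable if there are constants $A>0$ and $B\ge0$ such that $H(\omega)\ge\sum_{i\in\mathbb{Z}^d}\big[A\,N_{i+[0,1)^d}(\omega)^2-B\,N_{i+[0,1)^d}(\omega)\big]$ for all finite $\omega$. It is regular if there is a decreasing function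 $\psi:\mathbb{R}_+\to\mathbb{R}_+$ with $\int_0^\infty\psi(r)r^{d-1}\,dr<\infty$ such that $\varphi(x)\ge-\psi(|x|)$ for all $x\in\mathbb{R}^d$ and, for some $r(\varphi)<\infty$, $\varphi(x)\le\psi(|x|)$ for all $x$ with $|x|\ge r(\varphi)$. Tempered configurations: $\Omega^*=\bigcup_{t>0}\big\{\omega\in\Omega:\sum_{i\in\Lambda_n\cap\mathbb{Z}^d}N_{i+[-1,1]^d}(\omega)^2\le t|\Lambda_n|\text{ for all }n\in\mathbb{N}\big\}$. A probability measure $\nu$ is tempered if $\nu(\Omega^* )=1$. Gibbs measures: for $\Lambda\Subset\mathbb{R}^d$ and tempered $\eta$, the conditional energy is $H_\Lambda(\eta)=\lim_{n\to\infty}(H(\eta_{\Lambda_n})-H(\eta_{\Lambda_n\setminus\Lambda}))$. Let $\pi$ be the Poisson point process of intensity one on $\mathbb{R}^d$. For tempered $\omega$ let $G_{\Lambda,\omega}$ be the probability measure with $$\int f(\eta)\,G_{\Lambda,\omega}(d\eta)=Z_{\Lambda,\omega}^{-1}\int f(\eta_\Lambda\omega_{\Lambda^c})\,e^{-H_\Lambda(\eta_\Lambda\omega_{\Lambda^c})}\,\pi(d\eta),$$ where $Z_{\Lambda,\omega}$ is the normalization constant. A tempered (translation-invariant) Gibbs measure is a tempered $\nu\in\mathcal{P}_\theta$ satisfying $\int f\,d\nu=\int\big[\int f(\eta)\,G_{\Lambda,\omega}(d\eta)\big]\nu(d\omega)$ for every measurable $f\ge0$ and every $\Lambda\Subset\mathbb{R}^d$.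 Birth rate: $b(x,\eta)=e^{-h(x,\eta)}$ with $h(x,\eta)=\lim_{n\to\infty}\big(H(\eta_{\Lambda_n}+\delta_x)-H(\eta_{\Lambda_n})\big)$. *)

(* Defs.v *)
From HB Require Import structures.
From mathcomp Require Import all_boot all_order all_algebra.
From mathcomp Require Import finmap.
From mathcomp Require Import all_classical all_reals all_analysis.
From mathcomp Require Import measurable_realfun.

Set Implicit Arguments.
Unset Strict Implicit.
Unset Printing Implicit Defensive.

Import Order.TTheory GRing.Theory Num.Theory.
Import numFieldNormedType.Exports.

Local Open Scope classical_set_scope.
Local Open Scope ring_scope.

Definition borel_display (R : realType) (d : nat) : measure_display :=
  sigma_display (@open 'rV[R]_d).

Section borel_rV.
Variables (R : realType) (d : nat).

HB.instance Definition _ := @isMeasurable.Build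
  (borel_display R d) 'rV[R]_d <<s @open 'rV[R]_d >>
  (@sigma_algebra0 _ setT _) (@sigma_algebraC _ _)
  (@sigma_algebra_bigcup _ setT _).

Lemma measurable_coord (j : 'I_d) :
  measurable_fun [set: 'rV[R]_d] (fun x : 'rV[R]_d => x ord0 j).
Proof.
apply: (measurability _ (RGenOpens.measurableE R)) => _ [_ [a [b ->] <-]].
rewrite setTI; apply: sub_sigma_algebra.
move: (@interval_open R (BRight a) (BLeft b) isT isT).
by apply: (continuousP _).1 => // x; exact: coord_continuous.
Qed.

Let rat_cube (p : 'rV[rat]_d * nat) : set 'rV[R]_d :=
  [set x | forall j, `|x ord0 j - ratr (p.1 ord0 j)| < p.2.+1%:R^-1].

Let open_bigcup_rat_cube (U : set 'rV[R]_d) : open U ->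
  U = \bigcup_p (if `[< rat_cube p `<=` U >] then rat_cube p else set0).
Proof.
move=> oU; apply/seteqP; split=> [x Ux|x [p _]]; last first.
  by case: asboolP => // pU /pU.
have /nbhs_ballP[e /= e0 eU] : nbhs x U by rewrite nbhsE; exists U.
pose n := Num.truncn (2 / e).
have ne : n.+1%:R^-1 + n.+1%:R^-1 < e.
  suff ne2 : n.+1%:R^-1 < e / 2 by rewrite [ltRHS]splitr ltrD.
  rewrite -[ltRHS]invrK ltf_pV2 ?posrE ?invr_gt0 ?divr_gt0//.
  by rewrite invf_div truncnS_gt.
have /choice[q qP] (j : 'I_d) : exists q : rat, `|x ord0 j - ratr q| < n.+1%:R^-1.
  have /rat_in_itvoo[q] : x ord0 j - n.+1%:R^-1 < x ord0 j + n.+1%:R^-1.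
    by rewrite ltrBlDr -addrA ltrDl addr_gt0// invr_gt0.
  rewrite in_itv/= => /andP[q1 q2]; exists q.
  by rewrite distrC ltr_distl q1 q2.
exists (\row_j q j, n) => //; rewrite ifT; last first.
  apply/asboolP => y /= yq; apply: eU; split=> // i j; rewrite ord1.
  rewrite /ball/= (le_lt_trans _ ne)// (le_trans (ler_distD (ratr (q j)) _ _))//.
  by rewrite lerD// ltW// 1?distrC; have := yq j; rewrite mxE.
by move=> j /=; rewrite mxE.
Qed.

Lemma measurable_fun_rVP d' (T : measurableType d') (f : T -> 'rV[R]_d) :
  measurable_fun [set: T] f <->
  forall j, measurable_fun [set: T] (fun x => f x ord0 j).
Proof.
split=> [mf j|mf]; first exact: (measurableT_comp (measurable_coord j) mf).
apply: (@measurability _ _ _ _ _ _ (@open 'rV[R]_d)) => // _ [U oU <-].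
rewrite setTI (open_bigcup_rat_cube oU) preimage_bigcup.
apply: countable_bigcupT_measurable; first exact: countableP.
move=> p; case: ifPn => _; last by rewrite preimage_set0.
have -> : f @^-1` rat_cube p = \bigcap_(j in [set: 'I_d])
    ((fun x => f x ord0 j) @^-1` ball (ratr (p.1 ord0 j) : R) p.2.+1%:R^-1).
  apply/seteqP; split=> [x xp j _|x xp j] /=; first by rewrite /ball/= distrC; exact: xp.
  by have := xp j I; rewrite /ball/= distrC.
apply: fin_bigcap_measurable => // j _; rewrite -[X in measurable X]setTI.
by apply: mf => //; apply: open_measurable; exact: ball_open.
Qed.

End borel_rV.

Section lebesgue_rV.
Variable R : realType.

Definition cons_rV (d : nat) (p : measurableTypeR R * 'rV[R]_d) : 'rV[R]_d.+1 :=
  \row_j oapp (p.2 ord0) p.1 (unlift ord0 j).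

Definition uncons_rV (d : nat) (x : 'rV[R]_d.+1) : measurableTypeR R * 'rV[R]_d :=
  (x ord0 ord0, \row_j x ord0 (lift ord0 j)).

Lemma cons_rVK d : cancel (@cons_rV d) (@uncons_rV d).
Proof.
move=> [a x]; rewrite /uncons_rV /cons_rV mxE unlift_none /=; congr pair.
by apply/rowP => j; rewrite !mxE liftK.
Qed.

Lemma uncons_rVK d : cancel (@uncons_rV d) (@cons_rV d).
Proof.
move=> x; apply/rowP => j; rewrite mxE.
by case: unliftP => [k|] -> //=; rewrite mxE.
Qed.

Lemma measurable_cons_rV d : measurable_fun setT (@cons_rV d).
Proof.
apply/measurable_fun_rVP => j; rewrite /cons_rV.
case: (unliftP ord0 j) => [k|] ->.
- rewrite (_ : (fun _ => _) = (fun x : 'rV[R]_d => x ord0 k) \o snd); last first.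
    by apply/funext => p /=; rewrite mxE liftK.
  exact: (measurableT_comp (@measurable_coord R d k) measurable_snd).
- rewrite (_ : (fun _ => _) = fst); first exact: measurable_fst.
  by apply/funext => p /=; rewrite mxE unlift_none.
Qed.

Lemma measurable_uncons_rV d : measurable_fun setT (@uncons_rV d).
Proof.
apply: measurable_fun_pair; first exact: measurable_coord.
apply/measurable_fun_rVP => j; rewrite (_ : (fun _ => _) =
  (fun x : 'rV[R]_d.+1 => x ord0 (lift ord0 j))); first exact: measurable_coord.
by apply/funext => x; rewrite mxE.
Qed.

Section lebesgue_cons.
Variables (d : nat) (m : {sigma_finite_measure set 'rV[R]_d -> \bar R}).

Definition lebesgue_cons : set 'rV[R]_d.+1 -> \bar R :=
  pushforward (@lebesgue_measure R \x m)%E (@cons_rV d).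

Let lebesgue_cons0 : lebesgue_cons set0 = 0%E.
Proof. by rewrite /lebesgue_cons /pushforward preimage_set0 measure0. Qed.

Let lebesgue_cons_ge0 A : (0 <= lebesgue_cons A)%E.
Proof. by rewrite /lebesgue_cons /pushforward; exact: measure_ge0. Qed.

Let lebesgue_cons_sigma_additive : semi_sigma_additive lebesgue_cons.
Proof.
pose mu := measure_function_pushforward__canonical__measure_function_Measure
  (@lebesgue_measure R \x m)%E (@measurable_cons_rV d).
exact: (@measure_semi_sigma_additive _ _ _ mu).
Qed.

HB.instance Definition _ := isMeasure.Build _ _ _ lebesgue_cons
  lebesgue_cons0 lebesgue_cons_ge0 lebesgue_cons_sigma_additive.

Let lebesgue_cons_sigma_finite : sigma_finite setT lebesgue_cons.
Proof.
have /sigma_finiteP[F [FT ndF Foo]] := sigma_finiteT (@lebesgue_measure R).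
have /sigma_finiteP[G [GT ndG Goo]] := sigma_finiteT m.
exists (fun n => @uncons_rV d @^-1` (F n `*` G n)).
  rewrite -preimage_bigcup (_ : \bigcup_n _ = setT) ?preimage_setT//.
  apply/seteqP; split=> // -[x y] _.
  have [n _ Fnx] : (\bigcup_n F n) x by rewrite -FT.
  have [k _ Gky] : (\bigcup_n G n) y by rewrite -GT.
  exists (maxn n k) => //; split=> /=.
    by move: x Fnx; exact/subsetPset/ndF/leq_maxl.
  by move: y Gky; exact/subsetPset/ndG/leq_maxr.
move=> k; have [mF Fk] := Foo k; have [mG Gk] := Goo k; split.
  rewrite -[X in measurable X]setTI; apply: measurable_uncons_rV => //.
  exact: measurableX.
rewrite /lebesgue_cons /pushforward -comp_preimage.
rewrite (_ : _ \o _ = id) ?preimage_id; last first.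
  by apply/funext => p /=; rewrite cons_rVK.
by rewrite product_measure1E// lte_mul_pinfty// ge0_fin_numE.
Qed.

HB.instance Definition _ := Measure_isSigmaFinite.Build _ _ _ lebesgue_cons
  lebesgue_cons_sigma_finite.

End lebesgue_cons.

Fixpoint lebesgue_rV (d : nat) : {sigma_finite_measure set 'rV[R]_d -> \bar R} :=
  match d with
  | 0 => dirac (0 : 'rV[R]_0)
  | d'.+1 => lebesgue_cons (lebesgue_rV d')
  end.

Lemma lebesgue_rV_box d (a b : 'I_d -> R) : (forall j, a j <= b j) ->
  lebesgue_rV d [set x | forall j, x ord0 j \in `[a j, b j]] =
  (\prod_j (b j - a j))%:E.
Proof.
elim: d a b => [|d IHd] a b ab.
  rewrite big_ord0 /= diracE.
  by rewrite mem_set//= => -[].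
rewrite big_ord_recl EFinM -(IHd (a \o lift ord0) (b \o lift ord0))/=; last first.
  by move=> j /=.
have -> : (b ord0 - a ord0)%:E = lebesgue_measure `[a ord0, b ord0]%classic.
  rewrite lebesgue_measure_itv/= lte_fin; case: ltP => // ba.
  by rewrite (_ : b ord0 = a ord0) ?subrr//; apply/eqP; rewrite eq_le ba ab.
rewrite -product_measure1E//; last first.
  rewrite [X in measurable X](_ : _ = \bigcap_(j in [set: 'I_d])
      ((fun x : 'rV[R]_d => x ord0 j) @^-1`
        `[a (lift ord0 j), b (lift ord0 j)]%classic)); last first.
    by apply/seteqP; split=> [x xab j _|x xab j]; [exact: xab|exact: xab j I].
  apply: fin_bigcap_measurable => // j _; rewrite -[X in measurable X]setTI.
  exact: measurable_coord.
rewrite /lebesgue_cons /pushforward; congr product_measure1.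
apply/seteqP; split=> [[u x]/= xab|[u x]/= [uab xab] j].
  split=> [|j]; first by have := xab ord0; rewrite mxE unlift_none.
  by have := xab (lift ord0 j); rewrite mxE liftK.
case: (unliftP ord0 j) => [k|] ->; rewrite mxE ?liftK ?unlift_none//=.
Qed.

End lebesgue_rV.

Section configurations.
Variables (R : realType) (d : nat).
Implicit Types (Lambda A : set 'rV[R]_d) (x : 'rV[R]_d).

Definition bounded_borel Lambda : Prop := measurable Lambda /\ bounded_set Lambda.

Definition locally_finite A : Prop :=
  forall B : set 'rV[R]_d, bounded_set B -> finite_set (A `&` B).

(* A simple locally finite counting measure, identified with its points. *)
Record config := Config {
  points :> set 'rV[R]_d;
  config_locally_finite : locally_finite points }.

Lemma config_eqP (eta omega : config) : points eta = points omega -> eta = omega.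
Proof.
move: eta omega => [A Af] [B Bf] /= AB; subst B.
by congr Config; exact: Prop_irrelevance.
Qed.

Lemma locally_finite0 : locally_finite set0.
Proof. by move=> B _; rewrite set0I; exact: finite_set0. Qed.

Lemma locally_finite_subset A B :
  A `<=` B -> locally_finite B -> locally_finite A.
Proof.
by move=> AB Bf C Cb; apply: sub_finite_set (Bf C Cb); exact: setSI.
Qed.

Lemma locally_finiteU A B :
  locally_finite A -> locally_finite B -> locally_finite (A `|` B).
Proof.
by move=> Af Bf C Cb; rewrite setIUl finite_setU; split; [exact: Af|exact: Bf].
Qed.

Lemma locally_finite1 x : locally_finite [set x].
Proof. by move=> B _; apply: sub_finite_set (finite_set1 x); exact: subIsetl. Qed.

Lemma locally_finite_translate A x :
  locally_finite A -> locally_finite [set y - x | y in A].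
Proof.
move=> Af B Bb; have /Af fAB : bounded_set [set y + x | y in B].
  have [M [_ BM]] := Bb; exists (M + `|x|); split=> [|N MN _ [y By <-]].
    exact: num_real.
  rewrite /= (le_trans (ler_normD _ _))// -lerBrDr; apply: BM By.
  by rewrite ltrBrDr.
apply: sub_finite_set (finite_image (fun y => y - x) fAB).
by move=> _ [[y Ay <-] By]; exists y => //; split=> //; exists (y - x) => //; rewrite subrK.
Qed.

Definition config_restrict (eta : config) Lambda : config :=
  Config (locally_finite_subset (@subIsetl _ eta Lambda)
    (config_locally_finite eta)).

Definition config_union (eta omega : config) : config :=
  Config (locally_finiteU (config_locally_finite eta) (config_locally_finite omega)).

Definition config_add (eta : config) x : config :=
  Config (locally_finiteU (config_locally_finite eta) (locally_finite1 x)).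

Definition translate x (omega : config) : config :=
  Config (locally_finite_translate x (config_locally_finite omega)).

Definition card_of A : nat := #|` fset_set A|.

Definition num_points Lambda (omega : config) : nat := card_of (omega `&` Lambda).

HB.instance Definition _ := gen_eqMixin config.
HB.instance Definition _ := gen_choiceMixin config.
HB.instance Definition _ := isPointed.Build config (Config locally_finite0).

Definition count_events Lambda : set (set config) :=
  [set E | exists Delta, [/\ bounded_borel Delta, Delta `<=` Lambda &
    exists B : set nat, E = num_points Delta @^-1` B]].

Definition config_display : measure_display := sigma_display (count_events setT).

HB.instance Definition _ := @isMeasurable.Build config_display config
  <<s count_events setT >> (@sigma_algebra0 _ setT _) (@sigma_algebraC _ _)
  (@sigma_algebra_bigcup _ setT _).

(* The same configurations, equipped with the sub-sigma-algebra F_Lambda. *)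
Definition local_config Lambda := g_sigma_algebraType (count_events Lambda).

Lemma measurable_local_config Lambda (E : set config) :
  measurable (E : set (local_config Lambda)) -> measurable E.
Proof.
suff : <<s count_events Lambda >> `<=` <<s count_events setT >> by exact.
apply: smallest_sub; first exact: smallest_sigma_algebra.
move=> F [Delta [Db _ [B FE]]]; apply: sub_sigma_algebra.
by exists Delta; split=> //; exists B.
Qed.

Section restriction.
Variables (Lambda : set 'rV[R]_d) (mu : probability config R).

Definition restriction : set (local_config Lambda) -> \bar R := mu.

Let restriction0 : restriction set0 = 0%E.
Proof. exact: (measure0 mu). Qed.

Let restriction_ge0 E : (0 <= restriction E)%E.
Proof. exact: (measure_ge0 mu). Qed.

Let restriction_sigma_additive : semi_sigma_additive restriction.
Proof.
move=> F mF tF mUF; apply: (@measure_semi_sigma_additive _ _ _ mu) => //.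
- by move=> n; apply: (@measurable_local_config Lambda); exact: mF.
- by apply: (@measurable_local_config Lambda); exact: mUF.
Qed.

HB.instance Definition _ := isMeasure.Build _ _ _ restriction
  restriction0 restriction_ge0 restriction_sigma_additive.

Let restriction_setT : restriction setT = 1%E.
Proof. exact: (@probability_setT _ _ _ mu). Qed.

HB.instance Definition _ :=
  Measure_isProbability.Build _ _ _ restriction restriction_setT.

End restriction.
End configurations.

Arguments restriction {R d} Lambda mu _.

(* Equality of the underlying set functions would also compare their values on
   non-measurable sets, which are arbitrary. *)
Definition same_law d (T : measurableType d) (R : realType)
    (P Q : probability T R) : Prop :=
  forall E, measurable E -> P E = Q E.

(* x log x, extended by 0 at 0 since ln 0 = 0. *)
Definition xlnx (R : realType) (x : R) : R := x * ln x.

Section entropy.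
Context d (T : measurableType d) (R : realType).

Definition entropy (nu : probability T R) (F : T -> R) : R :=
  \int[nu]_w xlnx (F w) - xlnx (\int[nu]_w F w).

Definition is_density (P Q : probability T R) (f : T -> R) : Prop :=
  [/\ measurable_fun setT f, forall w, 0 <= f w &
      forall E, measurable E -> P E = (\int[Q]_(w in E) (f w)%:E)%E].

(* Two densities agree Q-almost everywhere, so the choice is immaterial. *)
Definition relative_entropy (P Q : probability T R) : \bar R :=
  match pselect (exists f, is_density P Q f) with
  | left dens => (\int[Q]_w (xlnx (projT1 (cid dens) w))%:E)%E
  | right _ => +oo%E
  end.

End entropy.

Section gibbs.
Variables (R : realType) (d : nat).
Implicit Types (phi : 'rV[R]_d -> R) (mu nu pi : probability (config R d) R).
Implicit Types (Lambda A : set 'rV[R]_d) (x : 'rV[R]_d).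
Implicit Types (eta omega : config R d) (i : 'rV[int]_d) (n : nat).

Definition cube n : set 'rV[R]_d :=
  [set x | forall j, - n%:R <= x ord0 j <= n%:R].

Definition volume A : R := fine (lebesgue_rV R d A).

Definition specific_relative_entropy mu nu : \bar R :=
  limn_einf (fun n => ((volume (cube n))^-1%:E *
    relative_entropy (restriction (cube n) mu) (restriction (cube n) nu))%E).

Definition translation_invariant mu : Prop :=
  forall x E, measurable E -> mu (translate x @^-1` E) = mu E.

(* Unit-intensity Poisson process: the counts in disjoint bounded Borel sets are
   independent Poisson variables. The mass function is written out because
   poisson_pmf is not that of the Dirac mass at 0 when the rate is 0, i.e. for
   null sets. *)
Definition poisson_process pi : Prop :=
  forall (k : nat) (A : 'I_k -> set 'rV[R]_d) (m : 'I_k -> nat),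
    (forall l, bounded_borel (A l)) -> trivIset [set: 'I_k] A ->
    pi [set eta | forall l, num_points (A l) eta = m l] =
    (\prod_l (volume (A l) ^+ m l / (m l)`!%:R * expR (- volume (A l))))%:E.

(* For even phi, half the sum over ordered pairs is the sum over unordered ones.
   The energy is meaningful for finite A only. *)
Definition energy phi A : R :=
  2^-1 * \sum_(x \in A) \sum_(y \in A `\ x) phi (x - y).

Definition cell i : set 'rV[R]_d :=
  [set x | forall j, (i ord0 j)%:~R <= x ord0 j < (i ord0 j)%:~R + 1].

(* The sum over Z^d has finite support. *)
Definition superstable phi : Prop :=
  exists A B : R, [/\ 0 < A, 0 <= B &
    forall X : set 'rV[R]_d, finite_set X ->
      \sum_(i \in [set: 'rV[int]_d])
        (A * (card_of (X `&` cell i))%:R ^+ 2 - B * (card_of (X `&` cell i))%:R)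
      <= energy phi X].

(* Euclidean norm; the library norm on row vectors is the sup norm. *)
Definition enorm x : R := Num.sqrt (\sum_j x ord0 j ^+ 2).

Definition regular phi : Prop :=
  exists psi : R -> R,
    [/\ forall r, 0 <= r -> 0 <= psi r,
        forall r s, 0 <= r -> r <= s -> psi s <= psi r,
        (\int[lebesgue_measure]_(r in `[0%R, +oo[) (psi r * r ^+ d.-1)%:E < +oo)%E,
        forall x, - psi (enorm x) <= phi x &
        exists r0, forall x, r0 <= enorm x -> phi x <= psi (enorm x)].

Definition wide_cell i : set 'rV[R]_d :=
  [set x | forall j, (i ord0 j)%:~R - 1 <= x ord0 j <= (i ord0 j)%:~R + 1].

(* n = 0 is excluded: |Lambda_0| = 0. *)
Definition tempered_configs : set (config R d) :=
  [set omega | exists2 t : R, 0 < t & forall n, (0 < n)%N ->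
    \sum_(i \in [set i : 'rV[int]_d | forall j, `|i ord0 j| <= n%:Z])
      ((num_points (wide_cell i) omega)%:R ^+ 2 : R) <= t * volume (cube n)].

Definition tempered nu : Prop := nu tempered_configs = 1%E.

(* The limits here and in birth_energy exist for tempered eta, and are default
   values otherwise. *)
Definition conditional_energy phi Lambda eta : R :=
  limn (fun n => energy phi (eta `&` cube n) -
                 energy phi (eta `&` (cube n `\` Lambda))).

Definition paste Lambda eta omega : config R d :=
  config_union (config_restrict eta Lambda) (config_restrict omega (~` Lambda)).

Definition gibbs_integral phi pi Lambda omega (f : config R d -> R) : \bar R :=
  (\int[pi]_eta (f (paste Lambda eta omega) *
     expR (- conditional_energy phi Lambda (paste Lambda eta omega)))%:E)%E.

Definition partition_function phi pi Lambda omega : R :=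
  fine (gibbs_integral phi pi Lambda omega (cst 1)).

(* G_{Lambda, omega} is given by its action on nonnegative functions f. *)
Definition gibbs_expectation phi pi Lambda omega (f : config R d -> R) : \bar R :=
  ((partition_function phi pi Lambda omega)^-1%:E *
   gibbs_integral phi pi Lambda omega f)%E.

Definition dlr phi pi nu : Prop :=
  forall Lambda, bounded_borel Lambda ->
  forall f : config R d -> R, measurable_fun setT f -> (forall omega, 0 <= f omega) ->
    (\int[nu]_omega (f omega)%:E =
     \int[nu]_omega gibbs_expectation phi pi Lambda omega f)%E.

Definition tempered_gibbs phi pi nu : Prop :=
  [/\ tempered nu, translation_invariant nu & dlr phi pi nu].

Definition birth_energy phi x eta : R :=
  limn (fun n => energy phi ((eta `&` cube n) `|` [set x]) -
                 energy phi (eta `&` cube n)).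

Definition birth_rate phi x eta : R := expR (- birth_energy phi x eta).

(* 0 when x is already a point of eta, a Lebesgue-null set of x. *)
Definition gradient x (F : config R d -> R) eta : R :=
  F (config_add eta x) - F eta.

Definition is_local (F : config R d -> R) : Prop :=
  measurable_fun setT F /\ exists2 Lambda, bounded_borel Lambda &
    forall eta, F eta = F (config_restrict eta Lambda).

Definition mlsi_birth phi nu (c : R) : Prop :=
  forall F : config R d -> R, is_local F ->
    (exists M, forall eta, F eta <= M) -> (forall eta, 0 < F eta) ->
    ((entropy nu F)%:E <= c%:E * \int[nu]_eta \int[lebesgue_rV R d]_x
       (birth_rate phi x eta * gradient x F eta *
        gradient x (fun w => ln (F w)) eta)%:E)%E.

End gibbs.

(* Main.v *)
From HB Require Import structures.
From mathcomp Require Import all_boot all_order all_algebra.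
From mathcomp Require Import finmap.
From mathcomp Require Import all_classical all_reals all_analysis.
From mathcomp Require Import measurable_realfun.
From mathcomp Require Import zify ring lra.
Require Import Defs.

(** The proof compares how often a local event occurs under the two laws. Cells
are the unit cubes i + [0,1)^d, N_i is the number of points in cell i, and B_n
is the half-open cube [-n,n)^d ([hcube n]).

If mu and nu differ, they differ on an event E that prescribes the numbers of
points in finitely many windows, and passing to the complement one may assume
nu(E) < mu(E) ([exists_separating_event]). Let F_n count the lattice translates
of E that take place inside B_n ([box_count]). By translation invariance its
means under nu and mu are nu(E) and mu(E) times a volume of order n^d. Both
assertions then follow from Gaussian concentration of F_n under nu at volume
scale: ln nu[exp(l F_n)] <= l nu[F_n] + C l^2 (2n)^d for all small l > 0
([box_count_concentration]).

Concentration is a Herbst argument for the logarithmic Sobolev inequality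
applied to exp(l F_n). Adding a point changes F_n by at most a constant, and not
at all outside B_n, so the right-hand side of the inequality is at most a
multiple of l^2 nu[int_(B_n) b(x,.) exp(l F_n(. + x)) dx]. The Georgii-Nguyen-
Zessin formula ([gnz_le], obtained from the DLR equations and the Mecke formula
of the Poisson process) turns this into l^2 nu[N_(B_n) exp(l F_n)]. The unbounded
factor N_(B_n) is removed by the duality between entropy and exponential moments
([entropy_duality], [points_tilted_le]). The exponential moments of N_(B_n) come
from the same logarithmic Sobolev inequality, applied to truncated counts: with
a negative exponent it shows that the intensity is finite ([capped_mean_le]),
with a positive one that nu[exp(s N_(B_n))] is at most exponential in the volume
([capped_exp_le]).

For the first assertion, the Donsker-Varadhan inequality with the test function
l F_n ([relative_entropy_ge]) bounds the relative entropy in the cube from below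
by l (mu[F_n] - nu[F_n]) - C l^2 (2n)^d, which is of order n^d for small l.

For the second assertion, let mu be another tempered Gibbs measure. Resample the
configuration in the larger cube B_(n+m). When the interaction across the shell
B_(n+m) minus B_n is at most t, the conditional law of the points in B_n has,
up to a factor exp(O(t + shell)), a density that is a function of these points
times a function of the points outside B_(n+m). Partition functions cancel when
an event A in B_n is compared with the sure event, and mu(A and small
interaction) is at most exp(O(t + shell)) nu(A) ([gibbs_comparison]). For
tempered invariant laws the interaction is o(n^d) with high probability
([decoupled_mass]), because psi is summable over the lattice and the second
moments of the N_i are bounded on the invariant events of [moderate]
configurations. Now let A be the event that F_n
exceeds the middle between its two means: by concentration nu(A) is
exponentially small in n^d, whereas mu(A) stays away from 0
([gibbs_not_separated]).

The limits that define the birth rate and the conditional energy exist on the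
configurations of [summable_configs], which have full measure under every
tempered invariant law ([summable_configs_full]). The Gibbs kernel enters only
through inequalities between integrals of nonnegative functions; those hold for
the supremum over simple functions below the integrand whether or not the
integrand is measurable ([ge0_le_integral_off_null]). *)

Set Implicit Arguments.
Unset Strict Implicit.
Unset Printing Implicit Defensive.

Import Order.TTheory GRing.Theory Num.Theory.
Import numFieldNormedType.Exports.

Local Open Scope classical_set_scope.
Local Open Scope ring_scope.

(** * Integrals of arbitrary nonnegative functions *)

Section lower_integral.
Context d (T : measurableType d) (R : realType).
Variable mu : {measure set T -> \bar R}.
Local Open Scope ereal_scope.
Import HBNNSimple.

(** The integral of a nonnegative function, measurable or not, is the supremum
of the integrals of the simple functions below it. Setting such a simple function
to 0 on N keeps its integral and puts it below g. The Gibbs expectation, as a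
function of the boundary condition, is only ever integrated in this sense. *)
Lemma ge0_le_integral_off_null (N : set T) (f g : T -> \bar R) :
  measurable N -> mu N = 0 -> (forall x, 0 <= f x) -> (forall x, 0 <= g x) ->
  (forall x, ~ N x -> f x <= g x) -> \int[mu]_x f x <= \int[mu]_x g x.
Proof.
move=> mN N0 f0 g0 fg; rewrite ge0_integralTE//.
apply: ge_ereal_sup => _ [h /= hf <-].
rewrite -integralT_nnsfun.
have -> : \int[mu]_x (h x)%:E = \int[mu]_x (proj_nnsfun h (measurableC mN) x)%:E.
  apply: ge0_ae_eq_integral => //.
  - by apply/measurable_EFinP.
  - by apply/measurable_EFinP.
  - by move=> x _; rewrite lee_fin.
  - by move=> x _; rewrite lee_fin.
  exists N; split=> // x /=; apply: contra_notP => Nx _.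
  by rewrite /proj_nnsfun/= mindicE mem_set// mulr1.
rewrite integralT_nnsfun [leRHS]ge0_integralTE//.
apply: ereal_sup_ubound; exists (proj_nnsfun h (measurableC mN)) => //= x.
rewrite mindicE; have [Nx|Nx] := pselect (N x).
  by rewrite memNset ?mulr0//= => /(_ Nx).
by rewrite mem_set// mulr1; exact: le_trans (hf x) (fg x Nx).
Qed.

Lemma ge0_le_integral_lower (f g : T -> \bar R) :
  (forall x, 0 <= f x) -> (forall x, f x <= g x) ->
  \int[mu]_x f x <= \int[mu]_x g x.
Proof.
move=> f0 fg; apply: (@ge0_le_integral_off_null set0) => // x.
exact: le_trans (f0 x) (fg x).
Qed.

(** A simple function below f, multiplied by k, is a simple function below k f;
the reverse inequality is this one for the inverse of k. *)
Lemma ge0_integralZ_lower_le (f : T -> \bar R) (k : R) : (0 <= k)%R ->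
  (forall x, 0 <= f x) -> k%:E * \int[mu]_x f x <= \int[mu]_x (k%:E * f x).
Proof.
move=> k0 f0; rewrite [X in _ * X]ge0_integralTE//.
have [->|kpos] := eqVneq k 0%R; first by rewrite mul0e integral_ge0// => x _; rewrite mul0e.
have kgt0 : (0 < k)%R by rewrite lt_neqAle eq_sym kpos.
rewrite -ereal_supZl//; last first.
  by apply/set0P; exists (sintegral mu nnsfun0), nnsfun0.
apply: ge_ereal_sup => _ [_ [h /= hf <-] <-].
rewrite -integralT_nnsfun -ge0_integralZl//; last 2 first.
- by apply/measurable_EFinP.
- by move=> x _; rewrite lee_fin.
apply: ge0_le_integral_lower => x.
  by rewrite mule_ge0 ?lee_fin//.
by rewrite lee_wpmul2l ?lee_fin.
Qed.

Lemma ge0_integralZ_lower (f : T -> \bar R) (k : R) : (0 <= k)%R ->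
  (forall x, 0 <= f x) -> \int[mu]_x (k%:E * f x) = k%:E * \int[mu]_x f x.
Proof.
move=> k0 f0; apply/eqP; rewrite eq_le ge0_integralZ_lower_le// andbT.
have [->|kn0] := eqVneq k 0%R.
  by rewrite mul0e integral0_eq// => x _; rewrite mul0e.
have kf0 x : 0 <= k%:E * f x by rewrite mule_ge0.
have ki0 : (0 <= k^-1)%R by rewrite invr_ge0.
have := ge0_integralZ_lower_le ki0 kf0.
have -> : \int[mu]_x ((k^-1)%:E * (k%:E * f x)) = \int[mu]_x f x.
  by apply: eq_integral => x _; rewrite muleA -EFinM mulVf// mul1e.
move=> /(@lee_wpmul2l _ k%:E) -/(_ k0).
by rewrite muleA -EFinM divff// mul1e.
Qed.

(** The integral of g may be +oo here, as it is in the lower bound for relative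
entropies. *)
Lemma le_integral_of_integrable (f g : T -> \bar R) :
  mu.-integrable setT f -> measurable_fun setT g -> (forall x, f x <= g x) ->
  \int[mu]_x f x <= \int[mu]_x g x.
Proof.
move=> fi mg fg; rewrite integralE [leRHS]integralE.
apply: leeB; apply: ge0_le_integral_lower => // x.
- by apply: (@funepos_le _ _ setT) => [y _|]; [exact: fg|rewrite in_setT].
- by apply: (@funeneg_le _ _ setT) => [y _|]; [exact: fg|rewrite in_setT].
Qed.

End lower_integral.

(** * Entropy bounds and exponential moments *)

Section bounded_expectation.
Context d (T : measurableType d) (R : realType).
Variable P : probability T R.
Implicit Types f g F G X : T -> R.

Definition bounded_measurable f :=
  measurable_fun setT f /\ exists M : R, forall w, `|f w| <= M.

Lemma bounded_measurable_cst r : bounded_measurable (fun=> r).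
Proof. by split; [exact: measurable_cst|exists `|r|]. Qed.

Lemma bounded_measurableD f g : bounded_measurable f -> bounded_measurable g ->
  bounded_measurable (fun w => f w + g w).
Proof.
move=> [mf [M fM]] [mg [N gN]]; split; first exact: measurable_funD.
by exists (M + N) => w; rewrite (le_trans (ler_normD _ _))// lerD.
Qed.

Lemma bounded_measurableM f g : bounded_measurable f -> bounded_measurable g ->
  bounded_measurable (fun w => f w * g w).
Proof.
move=> [mf [M fM]] [mg [N gN]]; split; first exact: measurable_funM.
by exists (M * N) => w; rewrite normrM ler_pM.
Qed.

Lemma bounded_measurableZ (k : R) f : bounded_measurable f ->
  bounded_measurable (fun w => k * f w).
Proof. exact: bounded_measurableM (bounded_measurable_cst k). Qed.

Lemma bounded_measurable_expR f : bounded_measurable f ->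
  bounded_measurable (fun w => expR (f w)).
Proof.
move=> [mf [M fM]]; split; first by apply: measurableT_comp => //; exact: measurable_expR.
exists (expR M) => w; rewrite ger0_norm ?expR_ge0// ler_expR.
by rewrite (le_trans (ler_norm _)).
Qed.

Lemma bounded_measurable_integrable f : bounded_measurable f ->
  P.-integrable setT (EFin \o f).
Proof.
move=> [mf [M fM]]; apply: measurable_bounded_integrable => //.
  by rewrite [X in (X < _)%E](_ : _ = 1%E) ?ltry//; exact: probability_setT.
exists M; split; first exact: num_real.
by move=> N MN w _ /=; rewrite (le_trans (fM w))// ltW.
Qed.

Let bmi := bounded_measurable_integrable.

Lemma expectation_EFin f : bounded_measurable f ->
  (\int[P]_w (f w)%:E)%E = (\int[P]_w f w)%:E.
Proof.
by move=> bf; rewrite /Rintegral fineK//; apply: integrable_fin_num => //; exact: bmi.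
Qed.

Lemma expectation_cst r : \int[P]_w r = r.
Proof. rewrite Rintegral_cst// [X in fine X](_ : _ = 1%E) ?mulr1//.
exact: probability_setT. Qed.

Lemma expectationD f g : bounded_measurable f -> bounded_measurable g ->
  \int[P]_w (f w + g w) = \int[P]_w f w + \int[P]_w g w.
Proof. by move=> bf bg; rewrite RintegralD//; exact: bmi. Qed.

Lemma expectationZ (k : R) f : bounded_measurable f ->
  \int[P]_w (k * f w) = k * \int[P]_w f w.
Proof. by move=> bf; rewrite RintegralZl//; exact: bmi. Qed.

Lemma le_expectation f g : bounded_measurable f -> bounded_measurable g ->
  (forall w, f w <= g w) -> \int[P]_w f w <= \int[P]_w g w.
Proof. by move=> bf bg fg; apply: le_Rintegral => //; exact: bmi. Qed.

Lemma expectation_expR_gt0 f : bounded_measurable f -> 0 < \int[P]_w expR (f w).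
Proof.
move=> bf; have [mf [M fM]] := bf.
apply: lt_le_trans (expR_gt0 (- M)) _; rewrite -[leLHS](expectation_cst).
apply: le_expectation => [||w]; first exact: bounded_measurable_cst.
  exact: bounded_measurable_expR.
by rewrite ler_expR lerNl (le_trans _ (fM w))// -normrN ler_norm.
Qed.

Lemma entropy_expR G : bounded_measurable G ->
  entropy P (fun w => expR (G w)) = \int[P]_w (G w * expR (G w)) -
    (\int[P]_w expR (G w)) * ln (\int[P]_w expR (G w)).
Proof.
move=> bG; rewrite /entropy /xlnx; congr (_ - _).
by apply: eq_Rintegral => w _; rewrite expRK mulrC.
Qed.

(** The tangent line of the exponential at m, applied to G / 2 = G - m + (m - G / 2)
with m half the tilted mean of G, bounds the moment at G / 2 from below. This is
a discrete form of the derivative of the log-moment, and replaces differentiation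
under the integral in the Herbst argument. *)
Lemma ln_expectation_half G : bounded_measurable G ->
  ln (\int[P]_w expR (G w)) <= ln (\int[P]_w expR (G w / 2)) +
    2^-1 * (\int[P]_w (G w * expR (G w)) / \int[P]_w expR (G w)).
Proof.
move=> bG; set A := \int[P]_w expR (G w); set B := \int[P]_w (G w * _).
have bG2 : bounded_measurable (fun w => G w / 2).
  by under [X in bounded_measurable X]eq_fun do rewrite mulrC; exact: bounded_measurableZ.
have A0 : 0 < A := expectation_expR_gt0 bG.
have bE := bounded_measurable_expR bG.
have bGE : bounded_measurable (fun w => G w * expR (G w)) by exact: bounded_measurableM.
set m := 2^-1 * (B / A).
(* A = (1 + m) A - B / 2 by the choice of m, which is linear in the integrand. *)
have h : expR (- m) * A <= \int[P]_w expR (G w / 2).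
  have -> : A = (1 + m) * A - 2^-1 * B.
    by rewrite /m; field; rewrite gt_eqF.
  have -> : expR (- m) * ((1 + m) * A - 2^-1 * B) =
    \int[P]_w (expR (- m) * ((1 + m) * expR (G w) + - 2^-1 * (G w * expR (G w)))).
    rewrite expectationZ; last by apply: bounded_measurableD; exact: bounded_measurableZ.
    rewrite expectationD; [|exact: bounded_measurableZ..].
    by rewrite !expectationZ// mulNr.
  apply: le_expectation.
  - apply: bounded_measurableZ; apply: bounded_measurableD; exact: bounded_measurableZ.
  - exact: bounded_measurable_expR.
  move=> w; have -> : G w / 2 = G w + - m + (m - G w / 2) by lra.
  rewrite expRD expRD.
  have -> : expR (- m) * ((1 + m) * expR (G w) + - 2^-1 * (G w * expR (G w))) =
     expR (G w) * expR (- m) * (1 + (m - G w / 2)) by field.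
  by rewrite ler_pM2l ?mulr_gt0 ?expR_gt0// expR_ge1Dx.
rewrite -lerBlDr -(expRK (_ - _)) ler_ln ?posrE ?expR_gt0 ?expectation_expR_gt0//.
rewrite addrC expRD lnK ?posrE//.
Qed.

(** exp(y) <= 1 / (1 - y) for y < 1, the tangent line at 0 used for -y. *)
Lemma expR_le_quad (y : R) : y <= 2^-1 -> expR y <= 1 + y + 2 * y ^+ 2.
Proof.
move=> y2; have y1 : 0 < 1 - y by lra.
have h : expR y <= (1 - y)^-1.
  rewrite -[expR y]invrK -expRN lef_pV2 ?posrE ?expR_gt0//.
  exact: expR_ge1Dx.
apply: le_trans h _; rewrite -[leLHS]div1r ler_pdivrMr//.
have : 0 <= y ^+ 2 * (1 - 2 * y) by rewrite mulr_ge0 ?sqr_ge0//; lra.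
by rewrite !expr2; nra.
Qed.

(** Second order expansion of the log-moment at 0. It supplies the terminal
value after many halvings of the parameter. *)
Lemma ln_expectation_small F (M s : R) : measurable_fun setT F ->
  (forall w, `|F w| <= M) -> `|s| * M <= 2^-1 ->
  ln (\int[P]_w expR (s * F w)) <= s * \int[P]_w F w + 2 * s ^+ 2 * M ^+ 2.
Proof.
move=> mF FM sM.
have bF : bounded_measurable F by split=> //; exists M.
have bsF := bounded_measurableZ s bF.
have h : \int[P]_w expR (s * F w) <=
    \int[P]_w ((1 + 2 * s ^+ 2 * M ^+ 2) + s * F w).
  apply: le_expectation; first exact: bounded_measurable_expR.
- exact: (bounded_measurableD (bounded_measurable_cst _)).
- move=> w; have sF : `|s * F w| <= `|s| * M by rewrite normrM ler_pM.
  apply: le_trans (expR_le_quad _) _.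
    by rewrite (le_trans (ler_norm _))// (le_trans sF).
  rewrite addrAC lerD2r lerD2l -mulrA ler_pM2l// -exprMn.
  have -> : (s * M) ^+ 2 = (`|s| * M) ^+ 2 by rewrite !exprMn real_normK ?num_real.
  by rewrite -[leLHS]real_normK ?num_real// lerXn2r ?nnegrE// (le_trans _ sF).
rewrite expectationD// in h; last exact: bounded_measurable_cst.
rewrite expectation_cst expectationZ// in h.
set Z := \int[P]_w expR _ in h *.
have Z0 : 0 < Z := expectation_expR_gt0 bsF.
have : ln Z <= Z - 1 by rewrite -[X in ln X](subrKC 1) le_ln1Dx; lra.
lra.
Qed.

End bounded_expectation.

(** With a(s) = ln E[exp(s F)], the entropy bound and [ln_expectation_half] give
a(s) / s <= a(s/2) / (s/2) + K s. The errors K l 2^-n sum to 2 K l, and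
a(s) / s tends to E[F] as s -> 0. *)
Section herbst.
Variable R : realType.

Let halve_le (x y p q : R) : x <= y + 2^-1 * p -> p <= x + q -> x <= 2 * y + q.
Proof. lra. Qed.

Let small_step (x y e k q : R) : 0 <= q -> x <= y + e -> x + (k - q) <= y + k + e.
Proof. lra. Qed.

(** Shape of the conclusions of both Herbst arguments: the error after n halvings
is geometric in n, and the expansion at 0 is available once the parameter is
small enough. *)
Lemma le_of_le_geometric (x y C D : R) :
  (forall n : nat, C * 2^-1 ^+ n <= 2^-1 -> x <= y + D * 2^-1 ^+ n) -> x <= y.
Proof.
move=> h.
have lim0 k : k * 2^-1 ^+ n @[n --> \oo] --> (0 : R).
  rewrite -[X in _ --> X](mulr0 k); apply: cvgM; first exact: cvg_cst.
  by apply: cvg_expr; rewrite ger0_norm//; lra.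
apply: (@ler_cvg_to nat \oo _ R (fun=> x) (fun n : nat => y + D * 2^-1 ^+ n)).
- exact: cvg_cst.
- rewrite -[X in _ --> X]addr0; apply: cvgD; [exact: cvg_cst|exact: lim0].
- near=> n; apply: h; near: n.
  by apply: (cvgr_le _ (lim0 C)); rewrite invr_gt0.
Unshelve. all: by end_near. Qed.

Context d (T : measurableType d).
Variable P : probability T R.

Lemma herbst (F : T -> R) (K l0 : R) : bounded_measurable F -> 0 <= K ->
  (forall l : R, 0 < l <= l0 -> entropy P (fun w => expR (l * F w)) <=
     K * l ^+ 2 * \int[P]_w expR (l * F w)) ->
  forall l : R, 0 < l <= l0 ->
  ln (\int[P]_w expR (l * F w)) <= l * \int[P]_w F w + 2 * K * l ^+ 2.
Proof.
move=> bF K0 hent l /andP[lgt0 ll0]; have [mF [M0 FM0]] := bF.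
pose a (s : R) : R := ln (\int[P]_w expR (s * F w)).
have step (s : R) : 0 < s <= l0 -> a s <= 2 * a (s / 2) + K * s ^+ 2.
  move=> /[dup] sl /andP[s0 _]; have bsF := bounded_measurableZ s bF.
  have A0 := expectation_expR_gt0 P bsF.
  have := ln_expectation_half P bsF; have := hent _ sl; rewrite entropy_expR//.
  have -> : (fun w => expR (s * F w / 2)) = (fun w => expR (s / 2 * F w)).
    by apply/funext => w; rewrite mulrAC.
  rewrite -/(a s) -/(a (s / 2)); set A := \int[P]_w expR _ in A0 *.
  set B := \int[P]_w (_ * _) => h1 h2.
  have : B / A <= a s + K * s ^+ 2.
    by rewrite ler_pdivrMr// mulrDl -lerBlDl mulrC.
  exact: halve_le h2.
have iter n : a l / l <= a (l * 2^-1 ^+ n) / (l * 2^-1 ^+ n) + 2 * K * l * (1 - 2^-1 ^+ n).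
  elim: n => [|n IHn]; first by rewrite !expr0 !mulr1 subrr mulr0 addr0.
  apply: le_trans IHn _; set s := l * 2^-1 ^+ n.
  have p0 : 0 < 2^-1 ^+ n :> R by rewrite exprn_gt0.
  have s0 : 0 < s by rewrite mulr_gt0.
  have p1 : 2^-1 ^+ n <= 1 :> R by rewrite exprn_ile1//; lra.
  have /step : 0 < s <= l0 by rewrite s0/= (le_trans _ ll0)// ger_pMr.
  have -> : l * 2^-1 ^+ n.+1 = s / 2 by rewrite exprSr mulrA.
  have -> : 2 * K * l * (1 - 2^-1 ^+ n.+1) = 2 * K * l * (1 - 2^-1 ^+ n) + K * s.
    by rewrite exprSr /s; field.
  move=> h; rewrite addrCA [leLHS]addrC lerD2l.
  rewrite ler_pdivrMr// mulrDl; apply: le_trans h _.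
  rewrite expr2 mulrA lerD2r; set q := a (s / 2).
  by rewrite le_eqVlt; apply/orP; left; apply/eqP; field; rewrite gt_eqF.
pose M := `|M0| + 1.
have M1 : 0 < M by rewrite ltr_wpDl.
have FM w : `|F w| <= M by rewrite (le_trans (FM0 w))// (le_trans (ler_norm _))// lerDl.
suff : a l / l <= \int[P]_w F w + 2 * K * l.
  rewrite ler_pdivrMr// -/(a l) => /le_trans; apply.
  by rewrite le_eqVlt; apply/orP; left; apply/eqP; ring.
apply: (@le_of_le_geometric _ _ (l * M) (2 * l * M ^+ 2)) => n.
set p := 2^-1 ^+ n => lMp.
have p0 : 0 < p by rewrite exprn_gt0.
have p1 : p <= 1 by rewrite exprn_ile1//; lra.
have lp0 : 0 < l * p by rewrite mulr_gt0.
have := @ln_expectation_small _ _ _ P F M (l * p) mF FM.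
rewrite gtr0_norm// mulrAC => /(_ lMp); rewrite -/(a _) => small.
have := iter n; rewrite -/p => it; apply: (le_trans it).
have {small}: a (l * p) / (l * p) <= \int[P]_w F w + 2 * l * M ^+ 2 * p.
  rewrite ler_pdivrMr//; apply: le_trans small _.
  rewrite le_eqVlt; apply/orP; left; apply/eqP; ring.
have : 0 <= 2 * K * l * p by rewrite !mulr_ge0// ltW.
rewrite mulrBr mulr1; exact: small_step.
Qed.

(** The variant for an entropy bound that is linear in X exp(t X), as for the
number of points. Now a(s) = ln E[exp(s X)] satisfies
a(s) (1 - 4 c s) <= 2 a(s/2) (1 - 4 c s/2), and the iterates of the right-hand
side converge to s E[X]. Negative s is allowed, whence the normalised parameter
t / s. *)
Lemma herbst_linear (X : T -> R) (c s : R) : bounded_measurable X -> 0 <= c ->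
  s != 0 -> 4 * c * s < 1 ->
  (forall t, 0 <= t / s <= 1 -> entropy P (fun w => expR (t * X w)) <=
     2 * c * t ^+ 2 * \int[P]_w (X w * expR (t * X w))) ->
  ln (\int[P]_w expR (s * X w)) * (1 - 4 * c * s) <= s * \int[P]_w X w.
Proof.
move=> bX c0 s0 cs1 hent; have [mX [M0 XM0]] := bX.
pose a (t : R) : R := ln (\int[P]_w expR (t * X w)).
have cu1 (u : R) : 0 <= u <= 1 -> 4 * c * (s * u) < 1.
  move=> /andP[u0 u1]; have [s0'|s0'] := leP 0 s.
    by apply: le_lt_trans cs1; rewrite mulrA ler_piMr// !mulr_ge0.
  apply: le_lt_trans ltr01; rewrite mulr_ge0_le0 ?mulr_ge0//.
  by rewrite mulr_le0_ge0// ltW.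
have step (u : R) : 0 < u <= 1 ->
    a (s * u) * (1 - 4 * c * (s * u)) <=
    2 * (a (s * (u / 2)) * (1 - 4 * c * (s * (u / 2)))).
  move=> /andP[u0 u1]; set t := s * u.
  have c1 : 4 * c * t < 1 by apply: cu1; rewrite ltW.
  have btX := bounded_measurableZ t bX.
  have A0 := expectation_expR_gt0 P btX.
  have tu : 0 <= t / s <= 1 by rewrite /t mulrAC divff// mul1r ltW.
  have := ln_expectation_half P btX; have := hent _ tu; rewrite entropy_expR//.
  have -> : (fun w => expR (t * X w / 2)) = (fun w => expR (s * (u / 2) * X w)).
    by apply/funext => w; congr expR; rewrite /t; ring.
  have -> : (fun w => t * X w * expR (t * X w)) = (fun w => t * (X w * expR (t * X w))).
    by apply/funext => w; rewrite mulrA.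
  rewrite expectationZ; last by apply: bounded_measurableM => //; exact: bounded_measurable_expR.
  rewrite -/(a t) -/(a (s * (u / 2))); set A := \int[P]_w expR _ in A0 *.
  set B := \int[P]_w (_ * _) => h1 h2.
  have [p [pA h3]] : exists p, p = B / A /\ t * p - a t <= 2 * c * t ^+ 2 * p.
    exists (B / A); split=> //.
    rewrite mulrA -[a t](mulfK (lt0r_neq0 A0)) -mulrBl [leRHS]mulrA.
    by rewrite ler_pM2r ?invr_gt0// [a t * A]mulrC.
  rewrite -mulrA -pA in h2.
  have -> : 4 * c * (s * (u / 2)) = 2 * c * t by rewrite /t; field.
  set b := a (s * (u / 2)) in h2 *.
  have q0 : 0 < 1 - 2 * c * t by lra.
  move: h2; rewrite -(ler_pM2l q0) => h2.
  have : (1 - 2 * c * t) * (t * p) <= a t by lra.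
  lra.
have iter n : a s * (1 - 4 * c * s) <=
    2 ^+ n * (a (s * 2^-1 ^+ n) * (1 - 4 * c * (s * 2^-1 ^+ n))).
  elim: n => [|n IHn]; first by rewrite !expr0 !mulr1 mul1r.
  apply: le_trans IHn _; rewrite [in leRHS](exprSr 2) -[leRHS]mulrA ler_pM2l ?exprn_gt0//.
  by rewrite exprSr; apply: step; rewrite exprn_gt0//= exprn_ile1//; lra.
pose M := `|M0| + 1.
have M1 : 0 < M by rewrite ltr_wpDl.
have XM w : `|X w| <= M by rewrite (le_trans (XM0 w))// (le_trans (ler_norm _))// lerDl.
set EX := \int[P]_w X w.
pose b := 4 * c * s; pose g := 2 * s ^+ 2 * M ^+ 2.
apply: (@le_of_le_geometric _ _ (`|s| * M) (g + `|b * (s * EX)| + `|b * g|)) => n.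
set p := 2^-1 ^+ n => sMp.
have p0 : 0 < p by rewrite exprn_gt0.
have p1 : p <= 1 by rewrite exprn_ile1//; lra.
have := @ln_expectation_small _ _ _ P X M (s * p) mX XM.
rewrite normrM (gtr0_norm p0) mulrAC => /(_ sMp); rewrite -/(a _) -/EX => small.
apply: le_trans (iter n) _; rewrite -/p.
have pp : 2 ^+ n * p = 1 by rewrite /p -exprMn divff ?expr1n.
have q0 : 0 < 1 - 4 * c * (s * p) by rewrite subr_gt0; apply: cu1; rewrite ltW.
have : 2 ^+ n * (a (s * p) * (1 - 4 * c * (s * p))) <= (s * EX + g * p) * (1 - b * p).
  have bp : 4 * c * (s * p) = b * p by rewrite /b; ring.
  rewrite bp.
  rewrite mulrA ler_wpM2r//.
    by rewrite -bp ltW.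
  rewrite mulrC -ler_pdivlMr ?exprn_gt0//.
  have -> : (2 ^+ n)^-1 = p by rewrite /p exprVn.
  apply: le_trans small _; rewrite le_eqVlt; apply/orP; left; apply/eqP.
  by rewrite /g; ring.
move/le_trans; apply.
have h1 : - (b * (s * EX)) <= `|b * (s * EX)| by rewrite -normrN ler_norm.
have h2 : - (b * g) <= `|b * g| by rewrite -normrN ler_norm.
have h3 : - (b * g) * p ^+ 2 <= `|b * g| * p.
  apply: (@le_trans _ _ (`|b * g| * p ^+ 2)); first by rewrite ler_pM2r ?exprn_gt0.
  by rewrite ler_wpM2l// expr2 ger_pMr.
have h4 : - (b * (s * EX)) * p <= `|b * (s * EX)| * p by rewrite ler_pM2r.
rewrite expr2 in h3; lra.
Qed.

End herbst.

(** * Finite sums, bounded windows and counts *)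

Section finite_sums.
Variables (R : realType) (I : choiceType).
Implicit Types (A B P : set I) (F G : I -> R).

Lemma ler_fsumr P F G : finite_set P -> (forall i, P i -> F i <= G i) ->
  \sum_(i \in P) F i <= \sum_(i \in P) G i.
Proof.
move=> fP FG; rewrite !fsbig_finite//= big_seq [leRHS]big_seq.
by apply: ler_sum => i; rewrite in_fset_set// inE; exact: FG.
Qed.

Lemma ler_fsumr_subset A B F : finite_set B -> A `<=` B ->
  (forall i, B i -> 0 <= F i) -> \sum_(i \in A) F i <= \sum_(i \in B) F i.
Proof.
move=> fB AB F0; rewrite [leRHS](fsbigID A)//= (setIidr AB) lerDl.
by apply: fsumr_ge0 => i [Bi _]; exact: F0.
Qed.

Lemma card_of_sum A : finite_set A -> (#|` fset_set A|)%:R = \sum_(i \in A) (1 : R).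
Proof.
move=> fA; rewrite fsbig_finite//= big_const_seq/= count_predT.
by rewrite iter_addr_0.
Qed.

Lemma card_fset_setU A B : finite_set A -> finite_set B -> A `&` B = set0 ->
  #|` fset_set (A `|` B)| = (#|` fset_set A| + #|` fset_set B|)%N.
Proof.
move=> fA fB AB; rewrite fset_setU// cardfsU -fset_setI// AB fset_set0 cardfs0.
by rewrite subn0.
Qed.

Lemma card_fset_set_le A B : finite_set B -> A `<=` B ->
  (#|` fset_set A| <= #|` fset_set B|)%N.
Proof.
move=> fB AB; apply: fsubset_leq_card; rewrite -fset_set_sub//.
exact: sub_finite_set AB fB.
Qed.

End finite_sums.

Lemma measurable_natr d (T : measurableType d) (R : realType) (g : T -> nat) :
  measurable_fun setT g -> measurable_fun setT (fun t => (g t)%:R : R).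
Proof.
move=> mg.
have mR : measurable_fun setT (fun n : nat => n%:R : R) by [].
exact: (measurableT_comp mR mg).
Qed.

Section counts.
Variables (R : realType) (d : nat).
Implicit Types (eta omega : config R d) (A B C : set 'rV[R]_d).

Lemma finite_points eta C : bounded_set C -> finite_set (points eta `&` C).
Proof. exact: config_locally_finite. Qed.

Lemma measurable_num_points C : bounded_borel C ->
  measurable_fun [set: config R d] (num_points C).
Proof.
move=> bC _ B _; rewrite setTI; apply: sub_sigma_algebra.
by exists C; split=> //; exists B.
Qed.

End counts.

Section bounded_sets.
Variables (R : realType) (V : normedModType R).
Implicit Types A B : set V.

Lemma bounded_setP A : bounded_set A <-> exists M : R, forall x, A x -> `|x| <= M.
Proof.
split=> [[M [_ AM]]|[M AM]].
  by exists (M + 1) => x Ax; apply: AM Ax; rewrite ltrDl.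
exists M; split; first exact: num_real.
by move=> N MN x Ax /=; rewrite (le_trans (AM _ Ax))// ltW.
Qed.

Lemma bounded_set_subset A B : A `<=` B -> bounded_set B -> bounded_set A.
Proof.
by move=> AB /bounded_setP[M BM]; apply/bounded_setP; exists M => x /AB; exact: BM.
Qed.

Lemma bounded_setU A B : bounded_set A -> bounded_set B -> bounded_set (A `|` B).
Proof.
move=> /bounded_setP[M AM] /bounded_setP[N BN]; apply/bounded_setP.
by exists (Num.max M N) => x [/AM|/BN] xM; rewrite le_max xM ?orbT.
Qed.

End bounded_sets.

Section bounded_borel.
Variables (R : realType) (d : nat).
Implicit Types (eta omega : config R d) (A B C : set 'rV[R]_d).

Lemma bounded_borelI A B : measurable A -> bounded_borel B -> bounded_borel (A `&` B).
Proof.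
move=> mA [mB bB]; split; first exact: measurableI.
by apply: bounded_set_subset bB; exact: subIsetr.
Qed.

Lemma bounded_borelD A B : bounded_borel A -> measurable B -> bounded_borel (A `\` B).
Proof.
move=> [mA bA] mB; split; first exact: measurableD.
by apply: bounded_set_subset bA; exact: subDsetl.
Qed.

Lemma bounded_borel0 : @bounded_borel R d set0.
Proof. by split=> //; apply/bounded_setP; exists 0. Qed.

Lemma num_points_sum eta A : bounded_set A ->
  (num_points A eta)%:R = \sum_(x \in points eta `&` A) (1 : R).
Proof. by move=> bA; apply: card_of_sum; exact: finite_points. Qed.

Lemma num_pointsU eta A B : bounded_set A -> bounded_set B -> A `&` B = set0 ->
  num_points (A `|` B) eta = (num_points A eta + num_points B eta)%N.
Proof.
move=> bA bB AB; rewrite /num_points /card_of setIUr card_fset_setU//.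
- exact: finite_points.
- exact: finite_points.
- by rewrite setIACA setIid AB setI0.
Qed.

Lemma num_points_le eta A B : bounded_set B -> A `<=` B ->
  (num_points A eta <= num_points B eta)%N.
Proof.
move=> bB AB; apply: card_fset_set_le; first exact: finite_points.
exact: setIS.
Qed.

Lemma num_points_eq0 eta A : bounded_set A ->
  num_points A eta = 0%N -> points eta `&` A = set0.
Proof.
move=> bA /cardfs0_eq h; apply: fset_set_set0 h; exact: finite_points.
Qed.

End bounded_borel.

(** * Measurable functions of configurations *)

(** Sums over the points of a configuration in a bounded window are integrals
against a counting kernel. On the event that the window contains exactly m points
this kernel is finite, so that the measurability of integrals against finite
kernels applies; these events exhaust the space. *)
Section counting_kernel.
Variables (R : realType) (d : nat).
Implicit Types (eta omega : config R d) (A B : set 'rV[R]_d).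

Definition points_measure (C : set 'rV[R]_d) eta : {measure set 'rV[R]_d -> \bar R} :=
  msum (fun i => dirac (nth 0 (fset_set (points eta `&` C)) i)) (num_points C eta).

Lemma integral_points_measure C eta (f : 'rV[R]_d -> \bar R) : bounded_set C ->
  (forall x, 0 <= f x)%E -> measurable_fun setT f ->
  (\int[points_measure C eta]_x f x = \sum_(x \in points eta `&` C) f x)%E.
Proof.
move=> bC f0 mf; rewrite /points_measure ge0_integral_measure_sum//.
rewrite fsbig_finite/=; last exact: finite_points.
rewrite (big_nth 0) big_mkord; apply: eq_bigr => i _.
by rewrite integral_dirac// diracT mul1e.
Qed.

Lemma points_measureE C eta A : bounded_borel C -> measurable A ->
  points_measure C eta A = (num_points (A `&` C) eta)%:R%:E.
Proof.
move=> [mC bC] mA.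
rewrite /points_measure /msum/= num_points_sum; last first.
  by apply: bounded_set_subset bC; exact: subIsetr.
rewrite setIA setIAC fsbig_mkcondr -fsumEFin; last exact: finite_points.
rewrite fsbig_finite/=; last exact: finite_points.
rewrite (big_nth 0) big_mkord; apply: eq_bigr => i _.
transitivity ((nth 0 (fset_set (points eta `&` C)) i \in A)%:R%:E : \bar R); first exact: diracE.
by case: (_ \in A).
Qed.

Context d' (T : measurableType d').
Variables (kappa : T -> config R d) (C : set 'rV[R]_d).
Hypotheses (mkappa : measurable_fun setT kappa) (bC : bounded_borel C).

Section truncated.
Variable m : nat.

Definition truncated_points_measure (t : T) : {measure set 'rV[R]_d -> \bar R} :=
  if num_points C (kappa t) == m then points_measure C (kappa t) else mzero.

Let measurable_truncated U : measurable U ->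
  measurable_fun [set: T] (truncated_points_measure ^~ U).
Proof.
move=> mU; rewrite (_ : (fun _ => _) = (fun t =>
  if num_points C (kappa t) == m then (num_points (U `&` C) (kappa t))%:R%:E else 0%E)).
  apply: measurable_fun_ifT.
  - apply: measurable_fun_eqn => //.
    exact: measurableT_comp (measurable_num_points bC) mkappa.
  - apply/measurable_EFinP/measurable_natr.
    exact: (measurableT_comp (measurable_num_points (bounded_borelI mU bC)) mkappa).
  - exact: measurable_cst.
by apply/funext => t; rewrite /truncated_points_measure; case: ifP => // _; rewrite points_measureE.
Qed.

HB.instance Definition _ := isKernel.Build _ _ _ _ _ truncated_points_measure
  measurable_truncated.

Let truncated_uub : measure_fam_uub truncated_points_measure.
Proof.
exists m.+1%:R => t; rewrite /truncated_points_measure; case: ifP => [/eqP tm|_].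
  by rewrite points_measureE// setTI tm lte_fin ltr_nat.
by rewrite /= lte_fin.
Qed.

HB.instance Definition _ := Kernel_isFinite.Build _ _ _ _ _ truncated_points_measure
  truncated_uub.

End truncated.

Lemma emeasurable_sum_points (f : T * 'rV[R]_d -> \bar R) :
  (forall z, 0 <= f z)%E -> measurable_fun setT f ->
  measurable_fun setT (fun t => \sum_(x \in points (kappa t) `&` C) f (t, x))%E.
Proof.
move=> f0 mf.
pose E m := [set t | num_points C (kappa t) = m].
have mE m : measurable (E m).
  rewrite -[E m]setTI.
  exact: (measurableT_comp (measurable_num_points bC) mkappa) measurableT [set m] I.
have -> : [set: T] = \bigcup_m E m by apply/seteqP; split=> // t _; exists (num_points C (kappa t)).
apply/measurable_fun_bigcup => // m.
apply: (@eq_measurable_fun _ _ _ _ _ (fun t => \int[truncated_points_measure m t]_x f (t, x))%E).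
  move=> t /set_mem Etm; rewrite /truncated_points_measure Etm eqxx integral_points_measure//.
    by case: bC.
  exact: measurableT_comp.
apply: (@measurable_funS _ _ _ _ setT) => //.
exact: (@measurable_fun_integral_finite_kernel _ _ _ _ _ f (truncated_points_measure m) f0 mf).
Qed.

Lemma measurable_sum_points (f : T * 'rV[R]_d -> R) : measurable_fun setT f ->
  measurable_fun setT (fun t => \sum_(x \in points (kappa t) `&` C) f (t, x)).
Proof.
move=> mf.
have mp (g : T * 'rV[R]_d -> R) : (forall z, 0 <= g z) -> measurable_fun setT g ->
    measurable_fun setT (fun t => \sum_(x \in points (kappa t) `&` C) g (t, x)).
  move=> g0 mg; apply/measurable_EFinP.
  rewrite (_ : _ \o _ = fun t => \sum_(x \in points (kappa t) `&` C) (g (t, x))%:E)%E.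
    by apply: (@emeasurable_sum_points (EFin \o g)) => [z|]; [rewrite lee_fin|exact/measurable_EFinP].
  by apply/funext => t /=; rewrite fsumEFin//; apply: finite_points; case: bC.
rewrite (_ : (fun _ => _) = (fun t => \sum_(x \in points (kappa t) `&` C) (f^\+ (t, x)) -
   \sum_(x \in points (kappa t) `&` C) (f^\- (t, x)))).
  apply: measurable_funB.
    by apply: mp => [z|]; [exact: funrpos_ge0|exact: measurable_funrpos].
  by apply: mp => [z|]; [exact: funrneg_ge0|exact: measurable_funrneg].
apply/funext => t; have fin : finite_set (points (kappa t) `&` C).
  by apply: finite_points; case: bC.
rewrite !fsbig_finite//= -sumrB; apply: eq_bigr => x _.
by rewrite -[in LHS](funrposBneg f).
Qed.

End counting_kernel.

Section space.
Variables (R : realType) (d : nat).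
Implicit Types (A B C : set 'rV[R]_d) (x y : 'rV[R]_d).

Lemma measurable_cube n : measurable (@cube R d n).
Proof.
rewrite (_ : @cube R d n = \bigcap_(j in [set: 'I_d])
    ((fun x : 'rV[R]_d => x ord0 j) @^-1` `[- n%:R, n%:R]%classic)).
  apply: fin_bigcap_measurable => // j _; rewrite -[X in measurable X]setTI.
  exact: measurable_coord.
apply/seteqP; split=> [x xn j _|x xn j] /=; first by rewrite in_itv/=; exact: xn.
by have := xn j I; rewrite /= in_itv.
Qed.

Lemma coord_norm_le x j : `|x ord0 j| <= `|x|.
Proof. rewrite [leRHS]/Num.norm/= mx_normrE.
exact: (le_bigmax _ (fun ij : 'I_1 * 'I_d => `|x ij.1 ij.2|) (ord0, j)). Qed.

Lemma norm_leP x (M : R) : 0 <= M -> (forall j, `|x ord0 j| <= M) -> `|x| <= M.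
Proof.
move=> M0 xM; rewrite /Num.norm/= mx_normrE; apply/bigmax_leP; split=> //.
by move=> [i j] _ /=; rewrite ord1; exact: xM.
Qed.

Lemma bounded_cube n : bounded_set (@cube R d n).
Proof.
apply/bounded_setP; exists n%:R => x xn; apply: norm_leP => // j.
by rewrite ler_norml; exact: xn.
Qed.

Lemma bounded_borel_cube n : bounded_borel (@cube R d n).
Proof. by split; [exact: measurable_cube|exact: bounded_cube]. Qed.

Lemma subset_cube m n : (m <= n)%N -> @cube R d m `<=` @cube R d n.
Proof.
move=> mn x xm j; have /andP[h1 h2] := xm j.
by rewrite (le_trans _ h1) ?(le_trans h2)// ?lerN2 ler_nat.
Qed.

Lemma bounded_subset_cube A : bounded_set A -> exists n, A `<=` @cube R d n.
Proof.
move=> /bounded_setP[M AM]; exists (Num.truncn `|M|).+1 => x Ax j.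
rewrite -ler_norml (le_trans (coord_norm_le x j))// (le_trans (AM _ Ax))//.
by rewrite (le_trans (ler_norm M))// ltW// truncnS_gt.
Qed.

Lemma mem_some_cube x : exists n, @cube R d n x.
Proof.
have [|n xn] := @bounded_subset_cube [set x]; last by exists n; exact: xn.
by apply/bounded_setP; exists `|x| => _ ->.
Qed.

Context d' (T : measurableType d').

Lemma measurable_rVB (f g : T -> 'rV[R]_d) : measurable_fun setT f ->
  measurable_fun setT g -> measurable_fun setT (fun t => f t - g t).
Proof.
move=> /measurable_fun_rVP mf /measurable_fun_rVP mg; apply/measurable_fun_rVP => j.
rewrite (_ : (fun _ => _) = (fun t => f t ord0 j - g t ord0 j)).
  exact: measurable_funB.
by apply/funext => t; rewrite !mxE.
Qed.

Lemma measurable_rV_eq (f g : T -> 'rV[R]_d) : measurable_fun setT f ->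
  measurable_fun setT g -> measurable [set t | f t = g t].
Proof.
move=> /measurable_fun_rVP mf /measurable_fun_rVP mg.
rewrite (_ : [set _ | _] = \bigcap_(j in [set: 'I_d]) [set t | f t ord0 j == g t ord0 j]).
  apply: fin_bigcap_measurable => // j _; rewrite -[X in measurable X]setTI.
  exact: (measurable_fun_eqr (mf j) (mg j)) measurableT [set true] I.
apply/seteqP; split=> [t fg j _|t fg] /=; first by rewrite fg.
by apply/rowP => j; apply/eqP; exact: fg.
Qed.

End space.

Lemma measurable_nat_mem d (T : measurableType d) (E : set T) : measurable E ->
  measurable_fun setT (fun t => nat_of_bool (t \in E)).
Proof.
move=> mE; have mb : measurable_fun setT (fun t => t \in E).
  apply: (measurable_fun_bool true); rewrite setTI (_ : _ @^-1` _ = E)//.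
  by apply/seteqP; split=> t /=; [move/set_mem|move/mem_set].
have mn : measurable_fun setT nat_of_bool by [].
exact: (measurableT_comp mn mb).
Qed.

Section config_maps.
Variables (R : realType) (d : nat).
Implicit Types (eta omega : config R d) (A B C : set 'rV[R]_d) (x y : 'rV[R]_d).

Lemma measurable_to_config d' (T : measurableType d') (kappa : T -> config R d) :
  (forall A, bounded_borel A -> measurable_fun setT (fun t => num_points A (kappa t))) ->
  measurable_fun setT kappa.
Proof.
move=> mk; apply: (@measurability _ _ _ _ _ _ (@count_events R d setT)) => //.
move=> _ [_ [A [bA _ [B ->]]] <-]; rewrite setTI.
by rewrite -[X in measurable X]setTI; exact: mk.
Qed.

Lemma num_points_restrict A B eta :
  num_points A (config_restrict eta B) = num_points (B `&` A) eta.
Proof. by rewrite /num_points /= setIA. Qed.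

Lemma measurable_restrict B : measurable B ->
  measurable_fun setT (fun eta => config_restrict eta B).
Proof.
move=> mB; apply: measurable_to_config => A bA.
rewrite (_ : (fun _ => _) = num_points (B `&` A)).
  by apply: measurable_num_points; exact: bounded_borelI.
by apply/funext => eta; rewrite num_points_restrict.
Qed.

Lemma paste_in B eta omega : points (paste B eta omega) `&` B = points eta `&` B.
Proof.
apply/seteqP; split=> [x [[[]|[? ?]] //]|x []] //.
by split=> //; left.
Qed.

Lemma paste_out B eta omega A : A `&` B = set0 ->
  points (paste B eta omega) `&` A = points omega `&` A.
Proof.
move=> AB; have nB x : A x -> ~ B x by move=> Ax Bx; have : (A `&` B) x by []; rewrite AB.
apply/seteqP; split=> [x [[[_ Bx]|[]//] Ax]|x [ox Ax]]; first by have := nB _ Ax.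
by split=> //; right; split=> //; exact: nB.
Qed.

Lemma num_points_paste B eta omega A : bounded_set A ->
  num_points A (paste B eta omega) =
  (num_points (A `&` B) eta + num_points (A `\` B) omega)%N.
Proof.
move=> bA.
have AB : A = (A `&` B) `|` (A `\` B) by rewrite setUIDK.
rewrite {1}AB num_pointsU; last 3 first.
- by apply: bounded_set_subset bA; exact: subIsetl.
- by apply: bounded_set_subset bA; exact: subDsetl.
- by apply/seteqP; split=> // x [[_ ?] []].
congr (_ + _)%N; rewrite /num_points; last first.
  by rewrite paste_out//; apply/seteqP; split=> // x [[]].
by rewrite setIA setIAC paste_in -setIA (setIC B A).
Qed.

Lemma measurable_paste B omega : measurable B ->
  measurable_fun setT (fun eta => paste B eta omega).
Proof.
move=> mB; apply: measurable_to_config => A [mA bA].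
rewrite (_ : (fun _ => _) = (fun eta => (num_points (A `&` B) eta +
    num_points (A `\` B) omega)%N)).
  apply: measurable_fun_addn => //; apply: measurable_num_points.
  by split; [exact: measurableI|apply: bounded_set_subset bA; exact: subIsetl].
by apply/funext => eta; rewrite num_points_paste.
Qed.

Lemma num_points_translate A x omega : bounded_set A ->
  num_points A (translate x omega) = num_points ((fun y => y - x) @^-1` A) omega.
Proof.
move=> bA; apply/eqP; rewrite -(eqr_nat R) num_points_sum//.
have -> : points (translate x omega) `&` A =
    [set y - x | y in points omega `&` ((fun y => y - x) @^-1` A)].
  apply/seteqP; split=> [_ [[y oy <-] Ayx]|_ [y [oy Ayx] <-]]; first by exists y.
  by split=> //; exists y.
rewrite fsbig_image; last by move=> y z _ _ /addIr.
rewrite num_points_sum//; move/bounded_setP: bA => [M AM]; apply/bounded_setP.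
exists (M + `|x|) => y /= /AM; rewrite -lerBlDr; apply: le_trans.
exact: lerB_dist.
Qed.

Lemma bounded_borel_shift A x : bounded_borel A -> bounded_borel ((fun y => y - x) @^-1` A).
Proof.
move=> [mA bA]; split.
  rewrite -[X in measurable X]setTI; apply: (measurable_rVB (f := id)) => //.
move/bounded_setP: bA => [M AM]; apply/bounded_setP.
exists (M + `|x|) => y /= /AM; rewrite -lerBlDr; apply: le_trans.
exact: lerB_dist.
Qed.

Lemma measurable_translate x : measurable_fun setT (@translate R d x).
Proof.
apply: measurable_to_config => A bA.
rewrite (_ : (fun _ => _) = num_points ((fun y => y - x) @^-1` A)).
  by apply: measurable_num_points; exact: bounded_borel_shift.
by apply/funext => omega; rewrite num_points_translate//; case: bA.
Qed.

(** x is a point of eta iff the sum over the points y of eta of 1_(y = x) is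
positive. *)
Lemma measurable_mem_config :
  measurable [set z : config R d * 'rV[R]_d | points z.1 z.2].
Proof.
rewrite (_ : [set _ | _] = \bigcup_n [set z | (points z.1 `&` @cube R d n) z.2]); last first.
  apply/seteqP; split=> [z zz|z [n _ []]] //=.
  by have [n zn] := mem_some_cube z.2; exists n.
apply: bigcupT_measurable => n.
pose f (z : (config R d * 'rV[R]_d) * 'rV[R]_d) : R := (z.2 == z.1.2)%:R.
have mf : measurable_fun setT f.
  rewrite (_ : f = \1_[set z | z.2 = z.1.2]).
    apply/measurable_indicP; apply: measurable_rV_eq; first exact: measurable_snd.
    exact: (measurableT_comp measurable_snd measurable_fst).
  apply/funext => z; rewrite indicE /f; congr (_%:R).
    by have [e|/eqP e] := eqVneq z.2 z.1.2; [rewrite mem_set|rewrite memNset].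
have mS := measurable_sum_points measurable_fst (bounded_borel_cube R d n) mf.
rewrite (_ : [set _ | _] = (fun z => \sum_(x \in points z.1 `&` @cube R d n) f (z, x)) @^-1` `]0, +oo[%classic).
  by rewrite -[X in measurable X]setTI; exact: mS.
apply/seteqP; split=> [z zz|z] /=; rewrite in_itv/= andbT; last first.
  move=> /(@fsumr_gt0 _ _ [::])[x xz]; rewrite /f/=.
  by case: eqVneq => [<- _|_]; [case: xz|rewrite ltxx].
rewrite (fsbigD1 z.2)//=; last by apply: finite_points; exact: bounded_cube.
rewrite /f eqxx ltr_pwDl//; apply: fsumr_ge0 => y _; exact: ler0n.
Qed.

Lemma num_points_add A x eta : bounded_set A ->
  num_points A (config_add eta x) =
  (num_points A eta + (x \in A) * (x \notin points eta))%N.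
Proof.
move=> bA; have [ex|ex] := pselect (points eta x).
  rewrite (mem_set ex) muln0 addn0; congr num_points; apply: config_eqP => /=.
  by apply/seteqP; split=> [y [|->]|y ?] //; left.
rewrite (memNset ex)/= muln1; have [Ax|Ax] := pselect (A x).
  rewrite (mem_set Ax) /num_points /card_of /= setIUl card_fset_setU//.
  - congr (_ + _)%N; rewrite (_ : [set x] `&` A = [set x]) ?fset_set1 ?cardfs1//.
    by apply/seteqP; split=> [y []|y ->].
  - exact: finite_points.
  - by apply: finite_setIl.
  - by apply/seteqP; split=> // y [[ey _] [/= yx _]]; apply: ex; rewrite -yx.
rewrite (memNset Ax) addn0 /num_points /=; congr card_of.
by apply/seteqP; split=> [y [[ey|/= ->]//] Ay|y [ey Ay]]; split=> //; left.
Qed.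

Lemma measurable_config_add :
  measurable_fun setT (fun z : config R d * 'rV[R]_d => config_add z.1 z.2).
Proof.
apply: measurable_to_config => A bA.
rewrite (_ : (fun _ => _) = fun z => (num_points A z.1 +
   nat_of_bool (z \in [set z | A z.2] `&` ~` [set z : config R d * 'rV[R]_d | points z.1 z.2]))%N).
  apply: measurable_fun_addn.
    exact: (measurableT_comp (measurable_num_points bA) measurable_fst).
  apply: (measurable_nat_mem); apply: measurableI; last first.
    by apply: measurableC; exact: measurable_mem_config.
  by rewrite -[X in measurable X]setTI; apply: measurable_snd => //; case: bA.
apply/funext => -[eta x]; rewrite num_points_add/=; last by case: bA.
by congr (_ + _)%N; rewrite in_setI in_setC -mulnb.
Qed.

Lemma measurable_config_add2 x : measurable_fun setT (fun eta : config R d => config_add eta x).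
Proof. exact: (measurable_fun_pair1 x measurable_config_add). Qed.

End config_maps.

(** * Measures with a density *)

Section density_measure.
Context d (T : measurableType d) (R : realType) (mu : {measure set T -> \bar R}).
Local Open Scope ereal_scope.

Variable k : T -> R.

Definition density_measure (mk : measurable_fun setT k)
  (k0 : forall x, (0 <= k x)%R) (A : set T) := \int[mu]_(x in A) (k x)%:E.

Hypotheses (mk : measurable_fun setT k) (k0 : forall x, (0 <= k x)%R).
Local Notation m := (density_measure mk k0).

Let density0 : m set0 = 0.
Proof. exact: integral_set0. Qed.

Let density_ge0 A : 0 <= m A.
Proof. by apply: integral_ge0 => x _; rewrite lee_fin. Qed.

Let density_additive : semi_sigma_additive m.
Proof.
apply: semi_sigma_additive_nng_induced; first exact/measurable_EFinP.
by move=> x; rewrite lee_fin.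
Qed.

HB.instance Definition _ := isMeasure.Build _ _ _ m density0 density_ge0 density_additive.

Import HBNNSimple.

Let integral_density_nnsfun (h : {nnsfun T >-> R}) :
  \int[m]_x (h x)%:E = \int[mu]_x ((k x)%:E * (h x)%:E).
Proof.
rewrite integralT_nnsfun sintegralE.
transitivity (\int[mu]_x (\sum_(r \in range h) (k x)%:E * (r * \1_(h @^-1` [set r]) x)%:E)).
  rewrite ge0_integral_fsum//; last 2 first.
  - move=> r; apply: emeasurable_funM; apply/measurable_EFinP => //.
    exact: measurableT_comp.
  - by move=> r x _; apply: mule_ge0; [rewrite lee_fin|rewrite EFinM nnfun_muleindic_ge0].
  apply: eq_fsbigr => _ /set_mem[t _ <-].
  under eq_integral do rewrite EFinM muleCA.
  rewrite ge0_integralZl//; last 3 first.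
  - by apply: emeasurable_funM; exact/measurable_EFinP.
  - by move=> x _; rewrite mule_ge0 ?lee_fin.
  - by rewrite lee_fin.
  congr (_ * _); transitivity (\int[mu]_(x in h @^-1` [set h t]) (k x)%:E); first by [].
  rewrite [LHS]integral_mkcond.
  apply: eq_integral => x _; rewrite patchE indicE.
  by case: ifPn => _; rewrite ?mule1 ?mule0.
apply: eq_integral => x _; rewrite fimfunE -fsumEFin// ge0_mule_fsumr//.
by move=> r; rewrite EFinM nnfun_muleindic_ge0.
Qed.

(** True by definition for indicators; simple functions and monotone limits
follow. *)
Lemma ge0_integral_density (w : T -> \bar R) : measurable_fun setT w ->
  (forall x, 0 <= w x) -> \int[m]_x w x = \int[mu]_x ((k x)%:E * w x).
Proof.
move=> mw w0; pose w_ := nnsfun_approx measurableT mw.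
transitivity (lim (\int[m]_x (w_ n x)%:E @[n --> \oo])).
  rewrite -monotone_convergence//=.
  - apply: eq_integral => x _; apply/esym/cvg_lim; first by [].
    exact: cvg_nnsfun_approx.
  - by move=> n; exact/measurable_EFinP.
  - by move=> n x _; rewrite lee_fin.
  - by move=> x _ a b ab; rewrite lee_fin; exact/lefP/nd_nnsfun_approx.
transitivity (lim (\int[mu]_x ((k x)%:E * (w_ n x)%:E) @[n --> \oo])).
  by apply: congr_lim; apply/funext => n; exact: integral_density_nnsfun.
rewrite -monotone_convergence//=.
- apply: eq_integral => x _; apply/cvg_lim => //=.
  by apply: cvgeZl => //; exact: cvg_nnsfun_approx.
- by move=> n; apply: emeasurable_funM; exact/measurable_EFinP.
- by move=> n x _; rewrite mule_ge0// lee_fin.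
- move=> x _ a b ab; rewrite lee_wpmul2l ?lee_fin//; exact/lefP/nd_nnsfun_approx.
Qed.

End density_measure.

(** * Measures on configurations are determined by counts *)

Section count_families.
Variables (R : realType) (d : nat).
Implicit Types (A B C : set 'rV[R]_d).

Definition count_event (J : finType) (a : J -> set 'rV[R]_d) (v : J -> nat) : set (config R d) :=
  [set eta | forall i, num_points (a i) eta = v i].

Definition count_system : set (set (config R d)) :=
  [set E | exists (J : finType) (a : J -> set 'rV[R]_d) (v : J -> nat),
     (forall i, bounded_borel (a i)) /\ E = count_event a v].

Lemma measurable_count_event (J : finType) (a : J -> set 'rV[R]_d) v :
  (forall i, bounded_borel (a i)) -> measurable (count_event a v).
Proof.
move=> ba; rewrite (_ : count_event a v =
    \bigcap_(i in [set: J]) (num_points (a i) @^-1` [set v i])).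
  apply: fin_bigcap_measurable => // i _; rewrite -[X in measurable X]setTI.
  exact: (measurable_num_points (ba i)).
by apply/seteqP; split=> [eta h i _|eta h i]; [exact: h|exact: h i I].
Qed.

Lemma bounded_set_bigsetU (J : finType) (b : J -> set 'rV[R]_d) (r : seq J) :
  (forall j, bounded_set (b j)) -> bounded_set (\big[setU/set0]_(j <- r) b j).
Proof.
move=> bb; elim: r => [|j r IHr]; last by rewrite big_cons; exact: bounded_setU.
by rewrite big_nil; case: (@bounded_borel0 R d).
Qed.

Lemma num_points_bigsetU (J : finType) (b : J -> set 'rV[R]_d) (r : seq J) eta :
  (forall j, bounded_set (b j)) -> trivIset setT b -> uniq r ->
  num_points (\big[setU/set0]_(j <- r) b j) eta = (\sum_(j <- r) num_points (b j) eta)%N.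
Proof.
move=> bb tb; elim: r => [_|j r IHr /= /andP[jr ur]].
  by rewrite !big_nil /num_points /card_of setI0 fset_set0 cardfs0.
rewrite !big_cons num_pointsU ?IHr//; first exact: bounded_set_bigsetU.
apply/seteqP; split=> // x [bjx]; rewrite -bigcup_seq => -[k /= kr bkx].
have jk : j = k by apply: (tb j k) => //; exists x.
by rewrite jk kr in jr.
Qed.

Lemma count_systemI : setI_closed count_system.
Proof.
move=> _ _ [I1 [a [v [ba ->]]]] [I2 [b [w [bb ->]]]].
exists (I1 + I2)%type, (fun k => match k with inl i => a i | inr j => b j end),
  (fun k => match k with inl i => v i | inr j => w j end); split; first by case.
apply/seteqP; split=> [eta [h1 h2] [i|j] //|eta h].
by split=> [i|j]; [exact: (h (inl i))|exact: (h (inr j))].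
Qed.

Lemma count_systemT : count_system setT.
Proof.
exists void, (fun i : void => match i with end), (fun i : void => match i with end); split; first by case.
by apply/seteqP; split=> // eta _ [].
Qed.

Lemma measurable_count_system : @measurable _ (config R d) = <<s count_system >>.
Proof.
apply/seteqP; split.
  apply: smallest_sub; first exact: smallest_sigma_algebra.
  move=> _ [A [bA _ [B ->]]].
  have -> : num_points A @^-1` B = \bigcup_(n in B) count_event (fun _ : unit => A) (fun=> n).
    apply/seteqP; split=> [eta Beta|eta [n Bn h]]; last by rewrite /= (h tt).
    by exists (num_points A eta).
  rewrite bigcup_mkcond.
  apply: (@bigcupT_measurable _ (g_sigma_algebraType count_system)) => n.
  case: ifP => _; last exact: measurable0.
  by apply: sub_sigma_algebra; exists unit, (fun=> A), (fun=> n).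
apply: smallest_sub; first exact: sigma_algebra_measurable.
by move=> _ [J [a [v [ba ->]]]]; exact: measurable_count_event.
Qed.

(** The count events of finite families of windows generate the sigma-algebra and
are closed under intersections. *)
Lemma config_measure_unique (m1 m2 : {measure set (config R d) -> \bar R}) :
  (m1 setT < +oo)%E -> (forall E, count_system E -> m1 E = m2 E) ->
  forall E, measurable E -> m1 E = m2 E.
Proof.
move=> fin h E mE; apply: (measure_unique count_system (fun=> setT)) => //.
- exact: measurable_count_system.
- exact: count_systemI.
- by move=> _; exact: count_systemT.
- by apply/seteqP; split=> // x _; exists 0%N.
Qed.

(** The Poisson law is prescribed on disjoint windows only. Refining a family of
windows into the atoms of the algebra that it generates reduces arbitrary count
events to these. *)
Section atoms.
Variables (J : finType) (a : J -> set 'rV[R]_d).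
Hypothesis ba : forall i, bounded_borel (a i).

Definition atom (S : {set J}) : set 'rV[R]_d :=
  [set x | (exists i, a i x) /\ forall i, a i x <-> i \in S].

Lemma atom_trivIset : trivIset setT atom.
Proof.
move=> S S' _ _ [x [[_ h] [_ h']]]; apply/setP => i.
by apply/idP/idP => [/h/h'|/h'/h].
Qed.

Lemma atom_subset (S : {set J}) i : i \in S -> atom S `<=` a i.
Proof. by move=> iS x [_ h]; apply/h. Qed.

Lemma atom_disjoint (S : {set J}) i : i \notin S -> atom S `&` a i = set0.
Proof. by move=> iS; apply/seteqP; split=> // x [[_ /(_ i) h] /h]; exact/negP. Qed.

Lemma atom_cover i x : a i x -> exists2 S : {set J}, i \in S & atom S x.
Proof.
move=> ax; exists (finset (fun j => x \in a j)); first by rewrite finset.inE mem_set.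
by split; [exists i|move=> j; rewrite finset.inE; split=> [/mem_set|/set_mem]].
Qed.

Lemma bounded_borel_atom S : bounded_borel (atom S).
Proof.
have -> : atom S = (\bigcup_(i in [set: J]) a i) `&`
    \bigcap_(i in [set: J]) (if i \in S then a i else ~` a i).
  apply/seteqP; split=> [x [[i aix] h]|x [[i _ aix] h]].
    split; first by exists i.
    by move=> j _; case: ifPn => jS; [apply/h|move=> /h; exact/negP].
  split; first by exists i.
  move=> j; have := h j I; case: ifPn => jS ajx; split=> // /ajx //.
rewrite setIC; apply: bounded_borelI.
  apply: fin_bigcap_measurable => // i _.
  by case: ifP => _; [|apply: measurableC]; case: (ba i).
split; first by apply: fin_bigcup_measurable => // i _; case: (ba i).
have /choice[M aM] i : exists M : R, forall x, a i x -> `|x| <= M.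
  by have [_ /bounded_setP] := ba i.
apply/bounded_setP; exists (\sum_i `|M i|) => x [i _ /aM xM].
rewrite (le_trans xM)// (le_trans (ler_norm _))// (bigD1 i)//= lerDl.
by apply: sumr_ge0.
Qed.

Lemma num_points_atoms i eta :
  num_points (a i) eta = (\sum_(S : {set J} | i \in S) num_points (atom S) eta)%N.
Proof.
pose r : seq {set J} := seq.filter (fun S : {set J} => i \in S) (index_enum _).
have -> : a i = \big[setU/set0]_(S <- r) atom S.
  rewrite /r big_filter -bigcup_seq_cond; apply/seteqP; split=> [x /atom_cover[S iS Sx]|x].
    by exists S => //=; rewrite mem_index_enum.
  by move=> [S /= /andP[_ iS]]; exact: atom_subset.
rewrite num_points_bigsetU ?filter_uniq ?index_enum_uniq//.
- by rewrite /r big_filter.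
- by move=> S; case: (bounded_borel_atom S).
- exact: atom_trivIset.
Qed.

Lemma count_event_atoms (v : J -> nat) :
  count_event a v = \bigcup_(w in [set w : {ffun {set J} -> nat} |
    forall i, (\sum_(S : {set J} | i \in S) w S)%N = v i]) count_event atom w.
Proof.
apply/seteqP; split=> [eta h|eta [w /= wv h] i]; last first.
  by rewrite num_points_atoms -wv; apply: eq_bigr => S _; exact: h.
exists [ffun S => num_points (atom S) eta] => [i|S]; last by rewrite ffunE.
by under eq_bigr do rewrite ffunE; rewrite -num_points_atoms.
Qed.

End atoms.

Lemma measure_countable_bigcup (T : countType) (F : T -> set (config R d)) (D : set T)
    (m1 m2 : {measure set (config R d) -> \bar R}) :
  (forall t, measurable (F t)) -> trivIset setT F ->
  (forall t, D t -> m1 (F t) = m2 (F t)) ->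
  m1 (\bigcup_(t in D) F t) = m2 (\bigcup_(t in D) F t).
Proof.
move=> mF tF m12.
pose G n : set (config R d) := if @pickle_inv T n is Some t then
  (if t \in D then F t else set0) else set0.
have GE : \bigcup_(t in D) F t = \bigcup_n G n.
  apply/seteqP; split=> [x [t Dt Ft]|x [n _]].
    by exists (choice.pickle t) => //; rewrite /G pickleK_inv mem_set.
  by rewrite /G; case: pickle_inv => // t; case: ifPn => // /set_mem Dt Ft; exists t.
have mG n : measurable (G n) by rewrite /G; case: pickle_inv => // t; case: ifP.
have tG : trivIset setT G.
  apply/trivIsetP => i j _ _ ij; rewrite /G.
  case ui : (@pickle_inv T i) => [t|]; last by rewrite set0I.
  case uj : (@pickle_inv T j) => [t'|]; last by rewrite setI0.
  case: ifP => _; last by rewrite set0I.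
  case: ifP => _; last by rewrite setI0.
  move/trivIsetP : tF; apply => //; apply: contra_neq ij => tt'.
  have := @pickle_invK T i; have := @pickle_invK T j.
  by rewrite ui uj /= tt' => -> ->.
rewrite GE !measure_bigcup//; apply: eq_eseriesr => n _; rewrite /G.
case: pickle_inv => [t|]; last by rewrite !measure0.
by case: ifPn => [/set_mem|_]; [exact: m12|rewrite !measure0].
Qed.

(** Adding L to the windows and passing to atoms, one obtains disjoint windows that
lie inside or outside L and cover L. A count event of the original windows
is a countable disjoint union of count events of these atoms. *)
Lemma config_measure_unique_disjoint (L : set 'rV[R]_d)
    (m1 m2 : {measure set (config R d) -> \bar R}) : bounded_borel L ->
  (m1 setT < +oo)%E ->
  (forall (J : finType) (a : J -> set 'rV[R]_d) (v : J -> nat),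
    (forall j, bounded_borel (a j)) -> trivIset setT a ->
    (forall j, a j `<=` L \/ a j `&` L = set0) -> L `<=` \bigcup_j a j ->
    m1 (count_event a v) = m2 (count_event a v)) ->
  forall E, measurable E -> m1 E = m2 E.
Proof.
move=> bL fin h; apply: config_measure_unique => // _ [J [a [v [ba ->]]]].
pose a' (i : option J) := if i is Some j then a j else L.
have ba' i : bounded_borel (a' i) by case: i.
have -> : count_event a v = \bigcup_(n in [set: nat])
    count_event a' (fun i => if i is Some j then v j else n).
  apply/seteqP; split=> [eta ae|eta [n _ ae] j]; last exact: (ae (Some j)).
  by exists (num_points L eta) => // -[j|//]; exact: ae.
apply: (measure_countable_bigcup (T := nat)) => [n||n _].
- exact: measurable_count_event.
- by move=> n n' _ _ [eta [/(_ None) /= <- /(_ None) /= <-]].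
rewrite count_event_atoms//.
apply: (@measure_countable_bigcup {ffun {set option J} -> nat}) => [w||w _].
- by apply: measurable_count_event => S; exact: bounded_borel_atom.
- by move=> w w' _ _ [eta [aw aw']]; apply/ffunP => S; rewrite -aw -aw'.
apply: h.
- by move=> S; exact: bounded_borel_atom.
- exact: atom_trivIset.
- move=> S; case: (boolP (None \in S)) => NS; first by left; exact: (atom_subset NS).
  by right; exact: (@atom_disjoint _ a' S None NS).
by move=> x Lx; have [|S NS Sx] := @atom_cover _ a' None x; [|exists S].
Qed.

End count_families.

(** * Lebesgue measure and the Poisson process *)

Section volumes.
Variables (R : realType) (d : nat).
Implicit Types A B : set 'rV[R]_d.
Local Notation leb := (lebesgue_rV R d).

Lemma lebesgue_cube n : leb (@cube R d n) = ((n%:R *+ 2) ^+ d)%:E.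
Proof.
rewrite (_ : @cube R d n = [set x | forall j, x ord0 j \in `[- n%:R, n%:R]]); last first.
  by apply/seteqP; split=> x xn j; have := xn j; rewrite in_itv.
rewrite (@lebesgue_rV_box R d (fun=> - n%:R) (fun=> n%:R)).
  by rewrite prodr_const card_ord opprK mulr2n.
by move=> j; rewrite lerNl (le_trans _ (ler0n _ _))// oppr_le0.
Qed.

Lemma lebesgue_bounded A : bounded_borel A -> (leb A < +oo)%E.
Proof.
move=> [mA /bounded_subset_cube[n An]].
apply: (@le_lt_trans _ _ (leb (@cube R d n))); last by rewrite lebesgue_cube ltry.
by apply: le_measure => //; rewrite inE//; exact: measurable_cube.
Qed.

Lemma volumeE A : bounded_borel A -> leb A = (volume A)%:E.
Proof. by move=> bA; rewrite /volume fineK// ge0_fin_numE// lebesgue_bounded. Qed.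

Lemma volume_ge0 A : 0 <= volume A.
Proof. exact: fine_ge0. Qed.

Lemma volume_cube n : volume (@cube R d n) = (n%:R *+ 2) ^+ d.
Proof. by rewrite /volume lebesgue_cube. Qed.

Lemma measurable_rV1 (x : 'rV[R]_d) : measurable [set x].
Proof.
rewrite (_ : [set x] = [set t | id t = cst x t]); last by [].
exact: measurable_rV_eq.
Qed.

Hypothesis d_gt0 : (0 < d)%N.

Lemma lebesgue_rV1 (x : 'rV[R]_d) : leb [set x] = 0%E.
Proof.
rewrite (_ : [set x] = [set y | forall j, y ord0 j \in `[x ord0 j, x ord0 j]]); last first.
  apply/seteqP; split=> [y -> j|y yx]; first by rewrite bound_itvE.
  by apply/rowP => j; have := yx j; rewrite itvxx inE => /eqP.
rewrite (@lebesgue_rV_box R d (x ord0) (x ord0))//.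
by rewrite (bigD1 (Ordinal d_gt0))//= subrr mul0r.
Qed.

Lemma volumeD1 A x : bounded_borel A -> volume (A `\ x) = volume A.
Proof.
move=> [mA bA]; rewrite /volume; congr fine.
rewrite [RHS](measureDI _ mA (measurable_rV1 x)) -[LHS]adde0; congr (_ + _)%E.
apply/esym/eqP; rewrite -measure_le0 -(lebesgue_rV1 x).
apply: le_measure; rewrite ?inE; [|exact: measurable_rV1|exact: subIsetr].
by apply: measurableI => //; exact: measurable_rV1.
Qed.

Lemma lebesgue_finite_set A : finite_set A -> leb A = 0%E.
Proof.
move=> fA; rewrite -(fsbig_setU_set1 fA) measure_fsbig//.
- by rewrite fsbig1// => x _; exact: lebesgue_rV1.
- by move=> x _; exact: measurable_rV1.
- by move=> x y _ _ [z [/= <- <-]].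
Qed.

End volumes.

Lemma prod_option (R : realType) (J : finType) (F : option J -> R) :
  \prod_i F i = F None * \prod_j F (Some j).
Proof.
rewrite (bigD1 None)//=; congr (_ * _).
rewrite (reindex_omap Some id)//=; last by case.
by apply: eq_bigl => j; rewrite eqxx.
Qed.

Section poisson.
Variables (R : realType) (d : nat) (d_gt0 : (0 < d)%N).
Variable pi : probability (config R d) R.
Hypothesis pi_poisson : poisson_process pi.
Implicit Types A L : set 'rV[R]_d.
Local Notation leb := (lebesgue_rV R d).

Definition poisson_mass (l : R) (m : nat) : R := l ^+ m / m`!%:R * expR (- l).

(** This recursion is the Mecke formula for a single window. *)
Lemma poisson_mass_succ l m : l * poisson_mass l m = m.+1%:R * poisson_mass l m.+1.
Proof.
rewrite /poisson_mass factS natrM exprS; field.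
by rewrite nat1r !pnatr_eq0 -lt0n fact_gt0.
Qed.

Lemma poisson_count_event (J : finType) (a : J -> set 'rV[R]_d) (v : J -> nat) :
  (forall j, bounded_borel (a j)) -> trivIset setT a ->
  pi (count_event a v) = (\prod_j poisson_mass (volume (a j)) (v j))%:E.
Proof.
move=> ba ta.
have -> : count_event a v = [set eta | forall l : 'I_#|J|,
    num_points (a (enum_val l)) eta = v (enum_val l)].
  apply/seteqP; split=> [eta h l|eta h j] /=; first exact: h.
  by rewrite -(enum_rankK j); exact: h.
rewrite pi_poisson//.
  by rewrite -(big_enum_val (A := J) (fun j => poisson_mass (volume (a j)) (v j))).
by move=> i j _ _ /(ta _ _ I I)/enum_val_inj.
Qed.

(** Both sides are integrals of w against finite measures on configurations, and
these agree on count events by the product formula. *)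
Lemma poisson_void (L A : set 'rV[R]_d) (w : config R d -> \bar R) :
  bounded_borel L -> bounded_borel A -> L `&` A = set0 ->
  measurable_fun setT w -> (forall eta, 0 <= w eta)%E ->
  (\int[pi]_eta ((num_points A eta == 0%N)%:R%:E * w (config_restrict eta L)) =
   (expR (- volume A))%:E * \int[pi]_eta w (config_restrict eta L))%E.
Proof.
move=> bL bA LA mw w0; pose res (eta : config R d) := config_restrict eta L.
have mres : measurable_fun setT res by apply: measurable_restrict; case: bL.
pose k (eta : config R d) : R := (num_points A eta == 0%N)%:R.
have mk : measurable_fun setT k.
  rewrite /k (_ : (fun _ => _) = \1_(num_points A @^-1` [set 0%N])).
    apply: measurable_indic; rewrite -[X in measurable X]setTI.
    exact: (measurable_num_points bA).
  apply/funext => eta; rewrite indicE; congr (_%:R).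
  by case: eqVneq => e; [rewrite mem_set|rewrite memNset//; exact/eqP].
have k0 eta : 0 <= k eta by exact: ler0n.
pose m1 := measure_function_pushforward__canonical__measure_function_Measure
  (density_measure pi mk k0) mres.
pose m2 := mscale (NngNum (expR_ge0 (- volume A)))
  (measure_function_pushforward__canonical__measure_function_Measure pi mres).
have m12 E : measurable E -> m2 E = m1 E.
  apply: (config_measure_unique_disjoint (@bounded_borel0 R d)).
    apply: (@le_lt_trans _ _ ((expR (- volume A))%:E * pi setT)%E); first by [].
    by rewrite probability_setT mule1 ltry.
  move=> J a v ba ta _ _.
  pose a' (i : option J) := if i is Some j then L `&` a j else A.
  pose v' (i : option J) := if i is Some j then v j else 0%N.
  have resE : res @^-1` count_event a v = count_event (fun j => L `&` a j) v.
    by apply/seteqP; split=> eta h j; have := h j; rewrite /res num_points_restrict.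
  have baL j : bounded_borel (L `&` a j) by apply: bounded_borelI => //; case: bL.
  have taL : trivIset setT (fun j => L `&` a j).
    by move=> i j _ _ [x [[_ ?] [_ ?]]]; apply: (ta i j) => //; exists x.
  transitivity ((expR (- volume A))%:E * pi (count_event (fun j => L `&` a j) v))%E.
    by rewrite -resE.
  transitivity (\int[pi]_(eta in count_event (fun j => L `&` a j) v) (k eta)%:E)%E; last first.
    by rewrite -resE.
  rewrite poisson_count_event// integral_mkcond.
  transitivity (\int[pi]_eta (\1_(count_event a' v') eta)%:E)%E.
    rewrite integral_indic// ?setIT; last first.
      by apply: measurable_count_event => -[].
    have ba' i : bounded_borel (a' i) by case: i.
    have ta' : trivIset setT a'.
      move=> [i|] [j|]//= _ _ [x].
      + by move=> [[Lx ax] [_ ax']]; congr Some; apply: ta => //; exists x.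
      + by move=> [[Lx _] Ax]; have : (L `&` A) x by []; rewrite LA.
      + by move=> [Ax [Lx _]]; have : (L `&` A) x by []; rewrite LA.
    apply: (etrans _ (esym (poisson_count_event v' ba' ta'))).
    rewrite prod_option/= -EFinM; congr (_%:E * _%:E)%E.
    by rewrite /poisson_mass expr0 fact0 divr1 mul1r.
  apply: eq_integral => eta _; rewrite patchE indicE.
  have [h|h] := pselect (count_event (fun j => L `&` a j) v eta).
    rewrite (mem_set h) /k; case: eqVneq => e; [rewrite mem_set//; by case|].
    by rewrite memNset// => /(_ None); exact/eqP.
  rewrite (memNset h) memNset// => h'; apply: h => j; exact: (h' (Some j)).
have -> : (\int[pi]_eta w (config_restrict eta L) =
    \int[measure_function_pushforward__canonical__measure_function_Measure pi mres]_eta w eta)%E.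
  by rewrite ge0_integral_pushforward.
transitivity (\int[m2]_eta w eta)%E; last exact: ge0_integral_mscale.
rewrite [RHS](eq_measure_integral m1)//; last by move=> E mE _; exact: m12.
rewrite ge0_integral_pushforward// ge0_integral_density//; last by move=> eta; exact: w0.
exact: measurableT_comp.
Qed.

Let add_point (z : config R d * 'rV[R]_d) := config_add z.1 z.2.

Let madd : measurable_fun setT add_point.
Proof. exact: measurable_config_add. Qed.

Lemma num_points_add_setD1 A eta x : bounded_set A ->
  num_points A (config_add eta x) = (num_points (A `\ x) eta + (x \in A))%N.
Proof.
move=> bA; have [Ax|Ax] := pselect (A x); last first.
  rewrite memNset// addn0 /num_points; congr card_of; apply/seteqP; split.
    by move=> y [[ey|/= ->]//] Ay; split=> //; split=> // yx; apply: Ax; rewrite -yx.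
  by move=> y [ey [Ay _]]; split=> //; left.
rewrite mem_set// /num_points /card_of.
have -> : points (config_add eta x) `&` A = (points eta `&` (A `\ x)) `|` [set x].
  apply/seteqP; split=> [y [[ey|/= ->] Ay]|y [[ey [Ay _]]|/= ->]].
  - by have [->|yx] := pselect (y = x); [right|left].
  - by right.
  - by split=> //; left.
  - by split=> //; right.
rewrite card_fset_setU ?fset_set1 ?cardfs1//.
  by apply: finite_points; apply: bounded_set_subset bA; exact: subDsetl.
by apply/seteqP; split=> // y [[_ [_ yx]]].
Qed.

(** Adding a point in the window a_j turns the event into the one with v_j - 1 points
in a_j, up to a point of volume 0. By the product formula and
[poisson_mass_succ], volume(a_j) times its probability is v_j times the
probability of the original event; the v_j with a_j in L add up to N_L. *)
Lemma mecke_count_event (L : set 'rV[R]_d) (J : finType) (a : J -> set 'rV[R]_d) v :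
  bounded_borel L -> (forall j, bounded_borel (a j)) -> trivIset setT a ->
  (forall j, a j `<=` L \/ a j `&` L = set0) -> L `<=` \bigcup_j a j ->
  (\int[leb]_(x in L) pi [set eta | count_event a v (config_add eta x)] =
   \int[pi]_(eta in count_event a v) (num_points L eta)%:R%:E)%E.
Proof.
move=> bL ba ta aL La.
pose P j := `[< a j `<=` L >].
have aP j x : a j x -> P j = `[< L x >].
  move=> ajx; apply/asboolP/asboolP => [|Lx]; first exact.
  by case: (aL j) => // ajL; have : (a j `&` L) x by []; rewrite ajL.
pose rest j := \prod_(i | i != j) poisson_mass (volume (a i)) (v i).
pose q j := (if v j is m.+1 then poisson_mass (volume (a j)) m else 0) * rest j.
have q0 j : 0 <= q j.
  rewrite /q mulr_ge0//.
    by case: (v j) => // m; rewrite /poisson_mass !mulr_ge0 ?invr_ge0 ?exprn_ge0 ?volume_ge0 ?expR_ge0.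
  apply: prodr_ge0 => i _.
  by rewrite /poisson_mass !mulr_ge0 ?invr_ge0 ?exprn_ge0 ?volume_ge0 ?expR_ge0.
have piq j x : a j x -> pi [set eta | count_event a v (config_add eta x)] = (q j)%:E.
  move=> ajx.
  have xa i : (x \in a i) = (i == j).
    apply/idP/eqP => [/set_mem aix|->]; last by rewrite mem_set.
    by apply: ta => //; exists x.
  have [vj|[m vj]] : v j = 0%N \/ exists m, v j = m.+1.
  - by case: (v j) => [|m]; [left|right; exists m].
  - rewrite /q vj mul0r; rewrite [X in pi X](_ : _ = set0) ?measure0//.
    apply/seteqP; split=> // eta /(_ j); rewrite num_points_add_setD1; last by case: (ba j).
    by rewrite xa eqxx addn1 vj.
  - rewrite [X in pi X](_ : _ = count_event (fun i => a i `\ x)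
        (fun i => if i == j then m else v i)); last first.
      apply/seteqP; split=> eta h i; have := h i; rewrite num_points_add_setD1 ?xa.
      + by case: eqVneq => [->|_]; rewrite ?addn0// vj addn1 => -[].
      + by case: (ba i).
      + by case: eqVneq => [->|_] ->; rewrite ?addn0// vj addn1.
      + by case: (ba i).
    rewrite poisson_count_event.
    + congr (_%:E); rewrite (bigD1 j)//= eqxx volumeD1// /q vj; congr (_ * _).
      by apply: eq_bigr => i /negbTE ->; rewrite volumeD1.
    + by move=> i; apply: bounded_borelD => //; exact: measurable_rV1.
    + by move=> i i' _ _ [y [[? _] [? _]]]; apply: (ta i i') => //; exists y.
have mE : measurable (count_event a v) by exact: measurable_count_event.
have LE : L = \big[setU/set0]_(j <- seq.filter P (index_enum J)) a j.
  rewrite big_filter -bigcup_seq_cond; apply/seteqP; split=> [x Lx|x [j /= /andP[_]]].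
    have [j _ ajx] := La x Lx; exists j => //=.
    by rewrite mem_index_enum (aP j x ajx); exact/asboolP.
  by move=> /asboolP; exact.
transitivity (\sum_(j | P j) (volume (a j) * q j)%:E)%E.
  rewrite integral_mkcond.
  transitivity (\int[leb]_x (\sum_(j | P j) (q j * \1_(a j) x)%:E))%E.
    apply: eq_integral => x _; rewrite patchE; case: ifPn => [/set_mem Lx|/negP Lx].
      have [j _ ajx] := La x Lx; rewrite (bigD1 j)/=; last first.
        by rewrite (aP j x ajx); exact/asboolP.
      rewrite indicE mem_set// mulr1 big1 ?adde0 ?(piq j)// => i /andP[_ ij].
      rewrite indicE memNset ?mulr0// => aix; move/eqP: ij; apply.
      by apply: ta => //; exists x.
    rewrite big1// => j /asboolP jL; rewrite indicE memNset ?mulr0// => ajx.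
    by apply: Lx; apply/mem_set; exact: jL.
  under eq_integral do rewrite -big_filter.
  rewrite -[RHS]big_filter ge0_integral_sum//; last 2 first.
  - by move=> j; apply/measurable_EFinP; apply: measurable_funM => //; apply: measurable_indic; case: (ba j).
  - by move=> j x _; rewrite lee_fin mulr_ge0.
  apply: eq_bigr => j _; under eq_integral do rewrite EFinM.
  rewrite ge0_integralZl//.
  - rewrite integral_indic ?setIT//; last by case: (ba j).
    transitivity ((q j)%:E * (volume (a j))%:E)%E; last by rewrite -EFinM mulrC.
    by congr (_ * _)%E; exact: volumeE.
  - by apply/measurable_EFinP; apply: measurable_indic; case: (ba j).
  - by rewrite lee_fin.
transitivity (((\sum_(j | P j) v j)%N)%:R%:E * pi (count_event a v))%E; last first.
  transitivity (\int[pi]_(eta in count_event a v) ((\sum_(j | P j) v j)%N)%:R%:E)%E.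
    by rewrite integral_cst.
  apply: eq_integral => eta /set_mem ae; congr (_%:R%:E).
  rewrite [in RHS]LE num_points_bigsetU//.
  - by rewrite big_filter; apply: eq_bigr => j _; rewrite ae.
  - by move=> j; case: (ba j).
  - by rewrite filter_uniq// index_enum_uniq.
rewrite poisson_count_event// -EFinM sumEFin; congr (_%:E).
rewrite natr_sum mulr_suml; apply: eq_bigr => j _.
rewrite (bigD1 j)//= mulrA /q mulrA; congr (_ * _).
case: (v j) => [|m]; first by rewrite mulr0 mul0r.
exact: poisson_mass_succ.
Qed.

(** The left side is the integral of w against the image of pi times Lebesgue
measure on L under addition of a point, the right side its integral against the
law with density N_L; the two measures agree on count events. *)
Lemma mecke (L : set 'rV[R]_d) (w : config R d -> \bar R) : bounded_borel L ->
  measurable_fun setT w -> (forall eta, 0 <= w eta)%E ->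
  (\int[pi]_eta \int[leb]_x ((\1_L x)%:E * w (config_add eta x)) =
   \int[pi]_eta ((num_points L eta)%:R%:E * w eta))%E.
Proof.
move=> bL mw w0.
have mN : measurable_fun setT (fun eta : config R d => (num_points L eta)%:R : R).
  exact: measurable_natr (measurable_num_points bL).
have N0 (eta : config R d) : 0 <= (num_points L eta)%:R :> R by exact: ler0n.
pose k (z : config R d * 'rV[R]_d) : R := \1_L z.2.
have mk : measurable_fun setT k.
  by apply: measurableT_comp => //; apply: measurable_indic; case: bL.
have k0 z : 0 <= k z by [].
pose m2 := density_measure pi mN N0.
pose m1 := measure_function_pushforward__canonical__measure_function_Measure
  (density_measure (pi \x leb)%E mk k0) madd.
have m1E E : measurable E ->
    (m1 E = \int[leb]_(x in L) pi [set eta | E (config_add eta x)])%E.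
  move=> mE; transitivity (\int[(pi \x leb)%E]_(z in add_point @^-1` E) (k z)%:E)%E; first by [].
  rewrite integral_mkcond.
  transitivity (\int[(pi \x leb)%E]_z (k z * \1_E (add_point z))%:E)%E.
    apply: eq_integral => z _; rewrite patchE indicE.
    have [h|h] := pselect (E (add_point z)).
      by rewrite !mem_set ?mulr1.
    by rewrite !memNset ?mulr0.
  have mkE : measurable_fun setT (fun z => k z * \1_E (add_point z)).
    by apply: measurable_funM => //; apply: measurableT_comp.
  rewrite fubini_tonelli2/=; last 2 first.
  - exact/measurable_EFinP.
  - by move=> z; rewrite lee_fin mulr_ge0.
  rewrite [RHS]integral_mkcond; apply: eq_integral => x _; rewrite patchE.
  rewrite /k /= /fubini_G; case: ifPn => Lx; last first.
    by rewrite integral0_eq// => eta _; rewrite /= indicE (negbTE Lx) mul0r.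
  transitivity (\int[pi]_eta (\1_[set eta | E (config_add eta x)] eta)%:E)%E.
    apply: eq_integral => eta _; rewrite /= indicE Lx mul1r !indicE.
    by congr (_%:R%:E); apply/idP/idP => /set_mem ?; apply/mem_set.
  rewrite integral_indic ?setIT// -[X in measurable X]setTI.
  exact: (measurable_config_add2 x).
have m12 E : measurable E -> m1 E = m2 E.
  apply: (config_measure_unique_disjoint bL).
    rewrite m1E//; have mL : measurable L by case: bL.
    have -> : (\int[leb]_(x in L) pi [set eta | setT (config_add eta x)] =
        \int[leb]_(x in L) 1)%E.
      by apply: eq_integral => x _; exact: (probability_setT pi).
    by rewrite integral_cst// mul1e; exact: lebesgue_bounded.
  move=> J a v ba ta aL La; rewrite m1E; last exact: measurable_count_event.
  exact: mecke_count_event.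
have mwz : measurable_fun setT (w \o add_point) by exact: measurableT_comp.
have -> : (\int[pi]_eta ((num_points L eta)%:R%:E * w eta) = \int[m2]_eta w eta)%E.
  by rewrite ge0_integral_density.
rewrite [RHS](eq_measure_integral m1)//; last by move=> E mE _; rewrite m12.
rewrite ge0_integral_pushforward// ge0_integral_density//; last first.
  by move=> z; exact: w0.
rewrite fubini_tonelli1//.
  by apply: emeasurable_funM => //; exact/measurable_EFinP.
by move=> z; rewrite mule_ge0// ?lee_fin//; exact: w0.
Qed.

End poisson.

(** * Lattice boxes and summation over cells *)

Section lattice.
Variable d : nat.
Implicit Types i j k : 'rV[int]_d.

Definition box_point (n : nat) (u : {ffun 'I_d -> 'I_(n + n)}) : 'rV[int]_d :=
  \row_l ((u l)%:Z - n%:Z).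

Lemma box_point_inj n : injective (@box_point n).
Proof.
move=> u v /rowP uv; apply/ffunP => l; apply/val_inj.
by have := uv l; rewrite !mxE => /addIr[].
Qed.

Definition box (n : nat) : {fset 'rV[int]_d} := [fset box_point u | u in {ffun 'I_d -> 'I_(n + n)}]%fset.

Lemma in_box n i : (i \in box n) = [forall l, (- n%:Z <= i ord0 l < n%:Z)].
Proof.
apply/imfsetP/forallP => [[u _ ->] l|h].
  have -> : box_point u ord0 l = (u l)%:Z - n%:Z by rewrite mxE.
  by move: (ltn_ord (u l)); move: (nat_of_ord (u l)) => m; lia.
have h' l : (absz (i ord0 l + n%:Z)%R < n + n)%N by have /andP[] := h l; lia.
exists [ffun l => Ordinal (h' l)] => //.
apply/rowP => l; transitivity ((absz (i ord0 l + n%:Z)%R)%:Z - n%:Z); last by rewrite mxE ffunE.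
by move: (h l); move: (i ord0 l) => z /andP[]; lia.
Qed.

Lemma in_boxP n i : reflect (forall l, - n%:Z <= i ord0 l < n%:Z) (i \in box n).
Proof. by rewrite in_box; exact: forallP. Qed.

Lemma card_box n : #|` box n| = ((n + n) ^ d)%N.
Proof.
rewrite card_imfset//=; last exact: box_point_inj.
by rewrite -cardE card_ffun !card_ord.
Qed.

Lemma box_subset m n : (m <= n)%N -> (box m `<=` box n)%fset.
Proof.
move=> mn; apply/fsubsetP => i /in_boxP h; apply/in_boxP => l.
have /andP[] := h l; lia.
Qed.

Definition inorm i : nat := \max_l `|i ord0 l|%N.

Lemma leq_inorm i l : (`|i ord0 l| <= inorm i)%N.
Proof. exact: (leq_bigmax (F := fun l => `|i ord0 l|%N)). Qed.

Lemma inormN i : inorm (- i) = inorm i.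
Proof. by apply: eq_bigr => l _; rewrite mxE abszN. Qed.

Lemma notin_box n i : i \notin box n -> (n <= inorm i)%N.
Proof.
move=> h; rewrite leqNgt; apply: contra h => h; apply/in_boxP => l.
have := leq_ltn_trans (leq_inorm i l) h; lia.
Qed.

Lemma box_shift n i j : j \in box n -> j - i \in box (n + inorm i).
Proof.
move=> /in_boxP h; apply/in_boxP => l; rewrite !mxE.
move: (h l) (leq_inorm i l); move: (j ord0 l) (i ord0 l) (inorm i) => a b c; lia.
Qed.

End lattice.

Lemma ler_sum_fset (R : realType) (T : choiceType) (A B : {fset T}) (F : T -> R) :
  (A `<=` B)%fset -> (forall i, 0 <= F i) -> \sum_(i <- A) F i <= \sum_(i <- B) F i.
Proof.
move=> AB F0; rewrite [leRHS](big_fsetID _ (mem A))/=.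
have -> : [fset x in B | x \in mem A]%fset = A.
  apply/fsetP => i; rewrite !inE/= andbC; apply: andb_idr => h.
  exact: (fsubsetP AB).
by rewrite lerDl sumr_ge0.
Qed.

(** Bounds the number of lattice points in the shell between two boxes. *)
Lemma expn_diff_le (a b m : nat) : (a <= b)%N ->
  (b ^ m.+1 - a ^ m.+1 <= m.+1 * (b - a) * b ^ m)%N.
Proof.
move=> ab; elim: m => [|m IHm]; first by rewrite !expn1 expn0 mul1n muln1.
have h : (a ^ m.+1 <= b ^ m.+1)%N by rewrite leq_exp2r.
have h1 : (b ^ m.+2 - a ^ m.+2 = b * (b ^ m.+1 - a ^ m.+1) + (b - a) * a ^ m.+1)%N.
  rewrite (expnS b) (expnS a) mulnBr mulnBl addnBA ?leq_mul// subnK//.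
  by rewrite leq_mul.
rewrite h1; apply: (@leq_trans (b * (m.+1 * (b - a) * b ^ m) + (b - a) * b ^ m.+1)).
  by rewrite leq_add// leq_mul.
by rewrite !(expnS b); lia.
Qed.

Section summability.
Variables (R : realType) (d : nat) (d_gt0 : (0 < d)%N).
Variable psi : R -> R.
Hypothesis psi_ge0 : forall r : R, 0 <= r -> 0 <= psi r.
Hypothesis psi_anti : forall r s : R, 0 <= r -> r <= s -> psi s <= psi r.
Hypothesis psi_int :
  (\int[lebesgue_measure]_(r in `[0%R, +oo[) (psi r * r ^+ d.-1)%:E < +oo)%E.
(** The sum is the integral of a step function below f. *)
Lemma sum_le_integral (b : nat -> R) (f : R -> R) (N : nat) :
  (forall k, 0 <= b k) -> (forall r, 0 <= r -> 0 <= f r) ->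
  (forall k r, k%:R < r <= k.+1%:R -> b k <= f r) ->
  ((\sum_(k < N) b k)%:E <= \int[lebesgue_measure]_(r in `[0%R, +oo[) (f r)%:E)%E.
Proof.
move=> b0 f0 bf; pose A (k : nat) : set R := `]k%:R, k.+1%:R]%classic.
have mA k : measurable (A k) by exact: measurable_itv.
have Ab : (\int[lebesgue_measure]_r (\sum_(k < N) (b k * \1_(A k) r)%:E) =
    (\sum_(k < N) b k)%:E)%E.
  rewrite ge0_integral_sum//.
  - rewrite -sumEFin; apply: eq_bigr => k _; under eq_integral do rewrite EFinM.
    rewrite ge0_integralZl//.
    + rewrite [X in (_ * X)%E](_ : _ = lebesgue_measure (A k)); last first.
        by have := integral_indic lebesgue_measure measurableT (mA k); rewrite setIT => ->.
      by rewrite lebesgue_measure_itv/= lte_fin ltr_nat ltnSn -EFinD -natrB// subSnn mule1.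
    + by apply/measurable_EFinP; exact: (measurable_indic (mA k)).
    + by rewrite lee_fin.
  - move=> k; apply/measurable_EFinP; apply: measurable_funM => //.
    exact: (measurable_indic (mA k)).
  - by move=> k r _; rewrite lee_fin mulr_ge0.
rewrite -Ab [leRHS]integral_mkcond; apply: ge0_le_integral_lower => r.
  by apply: sume_ge0 => k _; rewrite lee_fin mulr_ge0.
rewrite sumEFin patchE; have [r0|r0] := leP r 0.
  rewrite big1; last first.
    move=> k _; rewrite indicE memNset ?mulr0// /A/= in_itv/= => /andP[kr _].
    by have := lt_le_trans kr r0; rewrite ltNge ler0n.
  by case: ifPn => [/set_mem/=|//]; rewrite in_itv/= andbT => /f0; rewrite lee_fin.
rewrite mem_set/= ?in_itv/= ?andbT; last exact: ltW.
rewrite lee_fin; have [[k [kN rk]]|h] := pselect (exists k : nat, (k < N)%N /\ A k r).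
  rewrite (bigD1 (Ordinal kN))//= indicE mem_set// mulr1 big1 ?addr0; last first.
    move=> l /eqP lk; rewrite indicE memNset ?mulr0// => lr; apply: lk; apply/val_inj => /=.
    move: rk lr; rewrite /A/= !in_itv/= => /andP[a1 a2] /andP[a3 a4].
    have := lt_le_trans a1 a4; have := lt_le_trans a3 a2; rewrite !ltr_nat; lia.
  by apply: bf; move: rk; rewrite /A/= in_itv.
rewrite big1 ?f0 ?ltW// => k _; rewrite indicE memNset ?mulr0// => kr; apply: h.
by exists k.
Qed.

(** Points in the cells i and j have distance at least |i - j| - 1 in every
coordinate that realises the maximum, so that psi at their distance is at most
[Psi] at |i - j|. For neighbouring cells the bound is psi(0). *)
Definition Psi (k : nat) : R := psi k.-1%:R.

Lemma Psi_ge0 k : 0 <= Psi k. Proof. by apply: psi_ge0. Qed.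

Lemma Psi_anti k l : (k <= l)%N -> Psi l <= Psi k.
Proof. by move=> kl; apply: psi_anti => //; rewrite ler_nat; lia. Qed.

Let shell n : R := ((n.+1 + n.+1) ^ d - (n + n) ^ d)%N%:R.

Let shell_le n : (3 <= n)%N -> shell n * Psi n <=
  2 * d%:R * 8 ^+ d.-1 * (psi (n - 2).+1%:R * (n - 2)%:R ^+ d.-1).
Proof.
move=> n3; have -> : (n - 2).+1 = n.-1 by lia.
rewrite mulrCA -/(Psi n) [leLHS]mulrC ler_wpM2l ?Psi_ge0//.
have -> : 2 * d%:R * 8 ^+ d.-1 * (n - 2)%:R ^+ d.-1 =
    ((2 * d) * (8 * (n - 2)) ^ d.-1)%N%:R :> R.
  by rewrite !natrM natrX natrM exprMn mulrA.
rewrite ler_nat.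
have := @expn_diff_le (n + n) (n.+1 + n.+1) d.-1; rewrite prednK// => /(_ _)/leq_trans; apply; first lia.
have -> : (n.+1 + n.+1 - (n + n) = 2)%N by lia.
rewrite [(d * 2)%N]mulnC leq_mul//; case: (d.-1) => [|e]; first by rewrite !expn0.
by rewrite leq_exp2r//; lia.
Qed.

Definition boxsum n : R := \sum_(i <- box d n) Psi (inorm i).

Let boxsum_succ n : boxsum n.+1 <= boxsum n + shell n * Psi n.
Proof.
rewrite /boxsum (big_fsetID _ (mem (box d n)))/=.
have -> : [fset x in box d n.+1 | x \in mem (box d n)]%fset = box d n.
  apply/fsetP => i; rewrite !inE/= andbC; apply: andb_idr => h.
  exact: (fsubsetP (box_subset d (leqnSn n))).
rewrite lerD2l; set B := [fset x in _ | _]%fset.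
have cB : #|` B| = ((n.+1 + n.+1) ^ d - (n + n) ^ d)%N.
  have -> : B = (box d n.+1 `\` box d n)%fset.
    by apply/fsetP => i; rewrite !inE/= andbC.
  rewrite cardfsD (fsetIidPr _) ?card_box//; exact: box_subset.
apply: (@le_trans _ _ (\sum_(i <- B) Psi n)).
  rewrite big_seq [leRHS]big_seq; apply: ler_sum => i; rewrite !inE/= => /andP[_ h].
  by apply: Psi_anti; exact: notin_box.
by rewrite big_const_seq count_predT iter_addr_0 /= cB -mulr_natl.
Qed.

Let boxsum_mono m n : (m <= n)%N -> boxsum m <= boxsum n.
Proof. by move=> mn; apply: ler_sum_fset => [|i]; [exact: box_subset|exact: Psi_ge0]. Qed.

(** The shell between the boxes n and n+1 contains O(n^(d-1)) lattice points, on
each of which the summand is at most psi(n-1); the resulting series is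
dominated by the integral of psi(r) r^(d-1). *)
Lemma boxsum_bounded : exists S : R, forall n, boxsum n <= S.
Proof.
have [S0 intS] : exists S0 : R,
    (\int[lebesgue_measure]_(r in `[0%R, +oo[) (psi r * r ^+ d.-1)%:E = S0%:E)%E.
  exists (fine (\int[lebesgue_measure]_(r in `[0%R, +oo[) (psi r * r ^+ d.-1)%:E)).
  rewrite fineK// ge0_fin_numE//; apply: integral_ge0 => r /=.
  by rewrite in_itv/= andbT => r0; rewrite lee_fin mulr_ge0 ?exprn_ge0// psi_ge0.
pose C : R := 2 * d%:R * 8 ^+ d.-1.
have C0 : 0 <= C by rewrite /C !mulr_ge0 ?exprn_ge0.
pose b (k : nat) : R := psi k.+1%:R * k%:R ^+ d.-1.
have hb N : \sum_(k < N) b k <= S0.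
  rewrite -lee_fin -intS; apply: (@sum_le_integral b (fun r => psi r * r ^+ d.-1)).
  - by move=> k; rewrite mulr_ge0 ?exprn_ge0 ?psi_ge0.
  - by move=> r r0; rewrite mulr_ge0 ?exprn_ge0 ?psi_ge0.
  - move=> k r /andP[kr rk]; have r0 : 0 <= r by rewrite ltW// (le_lt_trans _ kr).
    by rewrite ler_pM ?exprn_ge0 ?psi_ge0 ?psi_anti// lerXn2r ?nnegrE// ltW.
have b0 k : 0 <= b k by rewrite mulr_ge0 ?exprn_ge0 ?psi_ge0.
have step n : boxsum (n + 3) <= boxsum 3 + C * \sum_(k < n.+1) b k.
  elim: n => [|n IHn].
    by rewrite add0n lerDl mulr_ge0// sumr_ge0.
  rewrite addSn; apply: le_trans (boxsum_succ _) _.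
  rewrite big_ord_recr/= mulrDr addrA lerD//.
  apply: le_trans (shell_le _) _; first by lia.
  by rewrite (_ : (n + 3 - 2 = n.+1)%N)//; lia.
exists (boxsum 3 + C * S0) => n.
apply: le_trans (boxsum_mono (leq_addr 3 n)) _.
by apply: le_trans (step n) _; rewrite lerD2l ler_wpM2l.
Qed.

Lemma boxsum_tail (e : R) : 0 < e -> exists m, forall n,
  \sum_(k <- box d n) (if k \in box d m then 0 else Psi (inorm k)) <= e.
Proof.
move=> e0; have [S hS] := boxsum_bounded.
have hs : has_sup [set boxsum n | n in [set: nat]].
  by split; [exists (boxsum 0), 0%N|exists S => _ [n _ <-]].
have [_ [m _ <-] hm] := sup_adherent e0 hs; exists m => n.
have hub k : boxsum k <= sup [set boxsum n | n in [set: nat]].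
  by apply: sup_upper_bound => //; exists k.
set F := fun k => if k \in box d m then 0 else Psi (inorm k).
have F0 k : 0 <= F k by rewrite /F; case: ifP => // _; exact: Psi_ge0.
apply: (@le_trans _ _ (\sum_(k <- box d (n + m)) F k)).
  by apply: ler_sum_fset => //; apply: box_subset; exact: leq_addr.
have -> : \sum_(k <- box d (n + m)) F k = boxsum (n + m) - boxsum m.
  set X := [fset x in box d (n + m) | x \notin mem (box d m)]%fset.
  have sub : [fset x in box d (n + m) | x \in mem (box d m)]%fset = box d m.
    apply/fsetP => i; rewrite !inE/= andbC; apply: andb_idr => h.
    exact: (fsubsetP (box_subset d (leq_addl n m))).
  have e1 : \sum_(k <- box d (n + m)) F k = \sum_(k <- X) Psi (inorm k).
    rewrite (big_fsetID _ (mem (box d m)))/= sub.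
    rewrite [X in X + _ = _]big_seq [X in X + _ = _]big1 ?add0r; last first.
      by move=> i im; rewrite /F im.
    by apply: eq_big_seq => i; rewrite !inE/= /F => /andP[_ /negbTE ->].
  by rewrite e1 /boxsum (big_fsetID _ (mem (box d m)) (box d (n + m)))/= sub addrC addrK.
rewrite lerBlDl; apply: le_trans (hub _) _; rewrite -lerBlDr; exact: ltW.
Qed.

(** Lattice translations change boxes only by a fixed amount, so that sums of a
nonnegative function over translated boxes are controlled by sums over boxes
centred at the origin. *)
Lemma sum_box_shift (F : 'rV[int]_d -> R) i n : (forall k, 0 <= F k) ->
  \sum_(j <- box d n) F (j - i) <= \sum_(k <- box d (n + inorm i)) F k.
Proof.
move=> F0; rewrite -(big_imfset _ imfset_key (h := fun j => j - i) (A := mem (box d n)) F)/=; last first.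
  by move=> a b _ _ /addIr.
apply: ler_sum_fset => //; apply/fsubsetP => _ /imfsetP[/= j jn ->].
exact: box_shift.
Qed.

(** The bounds are uniform in the row because the summands depend on j - i only. *)
Lemma Psi_row_sum : exists S : R, 0 <= S /\
  forall i n, \sum_(j <- box d n) Psi (inorm (j - i)) <= S.
Proof.
have [S hS] := boxsum_bounded; exists S; split.
  by apply: le_trans (hS 0); rewrite sumr_ge0// => k _; exact: Psi_ge0.
move=> i n; apply: le_trans (hS (n + inorm i)%N).
by apply: (@sum_box_shift (fun k => Psi (inorm k))) => k; exact: Psi_ge0.
Qed.

Lemma Psi_row_tail (e : R) : 0 < e -> exists m, forall i n,
  \sum_(j <- box d n) (if j - i \in box d m then 0 else Psi (inorm (j - i))) <= e.
Proof.
move=> /boxsum_tail[m hm]; exists m => i n; apply: le_trans (hm (n + inorm i)%N).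
apply: (@sum_box_shift (fun k => if k \in box d m then 0 else Psi (inorm k))) => k.
by case: ifP => // _; exact: Psi_ge0.
Qed.

End summability.

Section cells.
Variables (R : realType) (d : nat).
Implicit Types (x y : 'rV[R]_d) (i j : 'rV[int]_d) (A : set 'rV[R]_d).

Definition cell_of x : 'rV[int]_d := \row_l Num.floor (x ord0 l).

Lemma cellP i x : cell i x <-> cell_of x = i.
Proof.
split=> [h|<- l]; last by rewrite mxE -(intrD _ _ 1) floor_itv.
apply/rowP => l; rewrite mxE; apply: floor_def; have := h l.
by rewrite intrD.
Qed.

Lemma measurable_cell i : measurable (@cell R d i).
Proof.
rewrite (_ : cell i = \bigcap_(l in [set: 'I_d])
    ((fun x : 'rV[R]_d => x ord0 l) @^-1` `[(i ord0 l)%:~R, (i ord0 l)%:~R + 1[%classic)).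
  apply: fin_bigcap_measurable => // l _; rewrite -[X in measurable X]setTI.
  exact: measurable_coord.
apply/seteqP; split=> [x xn l _|x xn l] /=; first by rewrite in_itv/=; exact: xn.
by have := xn l I; rewrite /= in_itv.
Qed.

Lemma cell_subset_cube i : @cell R d i `<=` @cube R d (inorm i).+1.
Proof.
move=> x xi l; have /andP[h1 h2] := xi l.
have h : (`|i ord0 l| <= inorm i)%N by exact: leq_inorm.
have h3 : (- (inorm i)%:Z <= i ord0 l <= (inorm i)%:Z)%R by move: h; lia.
have /andP[h4 h5] := h3; rewrite -(ler_int R) in h4; rewrite -(ler_int R) in h5.
rewrite rmorphN/= in h4; rewrite -natr1; apply/andP; split.
  by apply: le_trans h1; apply: le_trans h4; rewrite lerN2 lerDl.
by rewrite (le_trans (ltW h2))// lerD2r.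
Qed.

Lemma bounded_borel_cell i : bounded_borel (@cell R d i).
Proof.
split; first exact: measurable_cell.
by apply: bounded_set_subset (@cell_subset_cube i) _; exact: bounded_cube.
Qed.

Definition hcube (n : nat) : set 'rV[R]_d := [set x | cell_of x \in box d n].

Lemma hcubeP n x : hcube n x <-> forall l, - n%:R <= x ord0 l < n%:R.
Proof.
rewrite /hcube/=; split=> [/in_boxP h l|h].
  by have := h l; rewrite mxE floor_ge_int floor_lt_int rmorphN.
by apply/in_boxP => l; rewrite mxE floor_ge_int floor_lt_int rmorphN; exact: h.
Qed.

Lemma hcube_subset n : hcube n `<=` @cube R d n.
Proof. by move=> x /hcubeP h l; have /andP[-> /ltW ->] := h l. Qed.

Lemma cube_subset_hcube n : @cube R d n `<=` hcube n.+1.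
Proof.
move=> x h; apply/hcubeP => l; have /andP[h1 h2] := h l; rewrite -natr1.
by rewrite (le_trans _ h1) ?lerN2 ?lerDl//= (le_lt_trans h2)// ltrDl.
Qed.

Lemma hcube_bigcup n : hcube n = \big[setU/set0]_(i <- box d n) cell i.
Proof.
rewrite -bigcup_seq; apply/seteqP; split=> [x xn|x [i /= ib /cellP h]].
  by exists (cell_of x) => //; apply/cellP.
by rewrite /hcube /= h.
Qed.

Lemma bounded_borel_hcube n : bounded_borel (hcube n).
Proof.
split; last first.
  by apply: bounded_set_subset (@bounded_cube R d n); exact: hcube_subset.
by rewrite hcube_bigcup; apply: bigsetU_measurable => i _; exact: measurable_cell.
Qed.

Lemma hcube_le m n : (m <= n)%N -> hcube m `<=` hcube n.
Proof. by move=> mn x /=; apply: (fsubsetP (box_subset d mn)). Qed.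

Lemma coord_le_enorm x l : `|x ord0 l| <= enorm x.
Proof.
rewrite /enorm -sqrtr_sqr ler_wsqrtr// (bigD1 l)//= lerDl.
by apply: sumr_ge0 => j _; exact: sqr_ge0.
Qed.

Lemma enorm_ge0 x : 0 <= enorm x. Proof. exact: sqrtr_ge0. Qed.

Lemma norm_le_enorm x : `|x| <= enorm x.
Proof. by apply: norm_leP => [|l]; [exact: enorm_ge0|exact: coord_le_enorm]. Qed.

(** The Euclidean distance dominates each coordinate difference, and passing from
a coordinate to its integer part changes a difference by less than 1. *)
Lemma cell_dist x y : (inorm (cell_of y - cell_of x)).-1%:R <= enorm (x - y).
Proof.
suff h : (inorm (cell_of y - cell_of x))%:R <= enorm (x - y) + 1.
  case: (inorm _) h => [|n] h /=; first exact: enorm_ge0.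
  by rewrite -natr1 lerD2r in h.
have [n0|n0] := posnP (inorm (cell_of y - cell_of x)).
  by rewrite n0 addr_ge0// enorm_ge0.
have [d0|d0] := posnP d.
  by move: n0; rewrite /inorm big1// => -[l hl] _; exfalso; move: hl; rewrite d0.
have [l hl] : exists l, inorm (cell_of y - cell_of x) = `|(cell_of y - cell_of x)%R ord0 l|%N.
  have := @bigop.eq_bigmax _ (fun l : 'I_d => `|(cell_of y - cell_of x)%R ord0 l|%N).
  by rewrite card_ord => /(_ d0)[l hl]; exists l.
rewrite hl natr_absz intr_norm !mxE rmorphB/=.
apply: le_trans (_ : `|(x - y) ord0 l| + 1 <= _); last by rewrite lerD2r coord_le_enorm.
rewrite !mxE; have /andP[a1 a2] := floor_itv (x ord0 l).
have /andP[b1 b2] := floor_itv (y ord0 l); rewrite !intrD in a2 b2.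
move: (Num.floor (x ord0 l))%:~R (Num.floor (y ord0 l))%:~R a1 a2 b1 b2 => fx fy a1 a2 b1 b2.
have c1 : x ord0 l - y ord0 l <= `|x ord0 l - y ord0 l| := ler_norm _.
have c2 : - (x ord0 l - y ord0 l) <= `|x ord0 l - y ord0 l| by rewrite -normrN ler_norm.
rewrite ler_norml; apply/andP; split; lra.
Qed.

(** Turns sums over points of functions of the cell into sums over the lattice of
counts, where summability of psi and second moments apply. *)
Lemma sum_cells (A : set 'rV[R]_d) n (g : 'rV[int]_d -> R) :
  finite_set A -> A `<=` hcube n ->
  \sum_(y \in A) g (cell_of y) = \sum_(j <- box d n) g j * (card_of (A `&` cell j))%:R.
Proof.
move=> fA An.
have -> : \sum_(j <- box d n) g j * (card_of (A `&` cell j))%:R =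
    \sum_(j <- box d n) \sum_(y <- fset_set A) (if cell_of y == j then g j else 0).
  apply: eq_bigr => j _; rewrite card_of_sum ?mulr_fsumr; last by apply: finite_setIl.
  rewrite fsbig_mkcondr fsbig_finite//=; apply: eq_bigr => y _; rewrite mulr1.
  by case: eqVneq => yj; [rewrite mem_set//; apply/cellP|rewrite memNset// => /cellP/eqP; exact/negP].
rewrite exchange_big/= fsbig_finite//=; apply: eq_big_seq => y.
rewrite in_fset_set// inE => Ay.
rewrite (big_fsetD1 (cell_of y))/=; last exact: (An y Ay).
rewrite eqxx big_seq big1 ?addr0// => j; rewrite !inE => /andP[jy _].
by rewrite eq_sym (negbTE jy).
Qed.

End cells.

(** * Pair energies *)

Section energies.
Variables (R : realType) (d : nat) (phi : 'rV[R]_d -> R).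
Hypothesis phi_even : forall x, phi (- x) = phi x.
Implicit Types (A B X Y : set 'rV[R]_d) (x y : 'rV[R]_d).

Definition cross (f : 'rV[R]_d -> R) X Y : R := \sum_(x \in X) \sum_(y \in Y) f (x - y).

Lemma crossC f X Y : (forall x, f (- x) = f x) -> finite_set X -> finite_set Y ->
  cross f X Y = cross f Y X.
Proof.
move=> fN fX fY; rewrite /cross exchange_fsbig//; apply: eq_fsbigr => y _.
by apply: eq_fsbigr => x _; rewrite -fN opprB.
Qed.

Let offdiag x y : R := if y == x then 0 else phi (x - y).

Let energyE X : finite_set X ->
  energy phi X = 2^-1 * \sum_(x \in X) \sum_(y \in X) offdiag x y.
Proof.
move=> fX; rewrite /energy; congr (_ * _); apply: eq_fsbigr => x /set_mem Xx.
rewrite [RHS](fsbigD1 x)//= {1}/offdiag eqxx add0r.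
by apply: eq_fsbigr => y /set_mem[_ /= /eqP yx]; rewrite /offdiag (negbTE yx).
Qed.

Let offdiag_disjoint X Y : X `&` Y = set0 ->
  \sum_(x \in X) \sum_(y \in Y) offdiag x y = cross phi X Y.
Proof.
move=> XY; apply: eq_fsbigr => x /set_mem Xx; apply: eq_fsbigr => y /set_mem Yy.
rewrite /offdiag; case: eqVneq => // yx; exfalso.
have : (X `&` Y) x by split=> //; rewrite -yx.
by rewrite XY.
Qed.

Lemma energyU X Y : finite_set X -> finite_set Y -> X `&` Y = set0 ->
  energy phi (X `|` Y) = energy phi X + energy phi Y + cross phi X Y.
Proof.
move=> fX fY XY; have fXY : finite_set (X `|` Y) by rewrite finite_setU.
have YX : Y `&` X = set0 by rewrite setIC.
rewrite !energyE// fsbigU0 ?XY//=.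
have h Z : finite_set Z -> \sum_(x \in Z) \sum_(y \in X `|` Y) offdiag x y =
    \sum_(x \in Z) \sum_(y \in X) offdiag x y + \sum_(x \in Z) \sum_(y \in Y) offdiag x y.
  by move=> fZ; rewrite -fsbig_split//; apply: eq_fsbigr => x _; rewrite fsbigU0 ?XY.
rewrite (h _ fX) (h _ fY) (offdiag_disjoint XY) (offdiag_disjoint YX) (crossC phi_even fY fX).
move: (cross phi X Y) (\sum_(x \in X) \sum_(y \in X) _) (\sum_(x \in Y) \sum_(y \in Y) _).
by move=> a b c; field.
Qed.

Lemma energy1 x : energy phi [set x] = 0.
Proof.
rewrite energyE// fsbig_set1 fsbig_set1 /offdiag eqxx mulr0//.
Qed.

Lemma energyU1 X x : finite_set X -> ~ X x ->
  energy phi (X `|` [set x]) - energy phi X = \sum_(y \in X) phi (x - y).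
Proof.
move=> fX Xx; rewrite energyU//.
  rewrite energy1 addr0 addrAC subrr add0r crossC//.
  by rewrite /cross fsbig_set1.
by apply/seteqP; split=> // y [Xy /= yx]; apply: Xx; rewrite -yx.
Qed.

Lemma energyD X Y : finite_set X -> finite_set Y -> X `&` Y = set0 ->
  energy phi (X `|` Y) - energy phi Y = energy phi X + cross phi X Y.
Proof. by move=> fX fY XY; rewrite energyU// addrAC addrK. Qed.

(** A N^2 - B N >= - B^2 / (4 A) for every occupied cell. This linear lower bound
by the number of occupied cells, rather than of points, is what a thin shell
can contribute to the energy. *)
Lemma energy_stable : superstable phi -> exists2 b : R, 0 <= b &
  forall X (s : {fset 'rV[int]_d}), finite_set X -> (forall x, X x -> cell_of x \in s) ->
    - b * #|` s|%:R <= energy phi X.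
Proof.
move=> [A [B [A0 B0 h]]]; exists (B ^+ 2 / (4 * A)).
  by rewrite divr_ge0 ?sqr_ge0// mulr_ge0// ltW.
move=> X s fX Xs; apply: le_trans (h X fX).
rewrite (@fsbigTE _ _ _ _ s) /=; last first.
  move=> i ib; rewrite (_ : X `&` cell i = set0).
    by rewrite /card_of fset_set0 cardfs0 expr0n/= !mulr0 subrr.
  by apply/seteqP; split=> // x [/Xs xs /cellP xi]; move: ib; rewrite -xi xs.
have -> : #|` s|%:R = \sum_(i <- s) (1 : R).
  by rewrite big_const_seq count_predT iter_addr_0.
rewrite mulr_sumr; apply: ler_sum => i _; rewrite mulr1.
move: (card_of _)%:R => N; rewrite -subr_ge0.
have -> : A * N ^+ 2 - B * N - - (B ^+ 2 / (4 * A)) = A * (N - B / (2 * A)) ^+ 2.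
  by field; rewrite gt_eqF.
by rewrite mulr_ge0 ?sqr_ge0// ltW.
Qed.

Hypothesis phi_measurable : measurable_fun [set: 'rV[R]_d] phi.

Lemma measurable_energy d' (T : measurableType d') (kappa : T -> config R d) C :
  measurable_fun setT kappa -> bounded_borel C ->
  measurable_fun setT (fun t => energy phi (points (kappa t) `&` C)).
Proof.
move=> mk bC; have fin t : finite_set (points (kappa t) `&` C).
  by apply: finite_points; case: bC.
rewrite (_ : (fun _ => _) = fun t => 2^-1 *
  \sum_(x \in points (kappa t) `&` C) \sum_(y \in points (kappa t) `&` C) offdiag x y).
  apply: measurable_funM => //.
  pose g (z : T * 'rV[R]_d) := \sum_(y \in points (kappa z.1) `&` C) offdiag z.2 y.
  apply: (@measurable_sum_points _ _ _ _ _ _ mk bC g).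
  pose f (z : (T * 'rV[R]_d) * 'rV[R]_d) := offdiag z.1.2 z.2.
  have mk1 : measurable_fun setT (fun z : T * 'rV[R]_d => kappa z.1) by exact: measurableT_comp.
  apply: (@measurable_sum_points _ _ _ _ _ _ mk1 bC f).
  have m12 : measurable_fun setT (fun z : (T * 'rV[R]_d) * 'rV[R]_d => z.1.2).
    exact: (measurableT_comp measurable_snd measurable_fst).
  apply: measurable_fun_ifT => //.
    apply: (measurable_fun_bool true); rewrite setTI.
    rewrite (_ : _ @^-1` _ = [set z : (T * 'rV[R]_d) * 'rV[R]_d | z.2 = z.1.2]).
      by apply: measurable_rV_eq => //; exact: measurable_snd.
    by apply/seteqP; split=> z /= /eqP.
  apply: measurableT_comp => //; apply: measurable_rVB => //; exact: measurable_snd.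
by apply/funext => t; rewrite energyE.
Qed.

End energies.

(** * Existence of birth and conditional energies *)

(** s + t and t are nondecreasing and bounded. Applied to s, the partial sums of
phi around a point, and t, those of psi: as phi >= - psi, adding psi makes the
terms nonnegative, and beyond the finitely many nearby points phi <= psi. *)
Lemma cvg_of_domination (R : realType) (s t : nat -> R) (K M : R) :
  (forall n, s n + t n <= s n.+1 + t n.+1) -> (forall n, t n <= t n.+1) ->
  (forall n, t n <= M) -> (forall n, s n <= K + t n) -> cvgn s.
Proof.
move=> st tt tM sK.
have ct : cvgn t.
  apply: nondecreasing_is_cvgn; first exact/nondecreasing_seqP.
  by exists M => _ [n _ <-].
have cst : cvgn (fun n => s n + t n).
  apply: nondecreasing_is_cvgn; first exact/nondecreasing_seqP.
  exists (K + M + M) => _ [n _ <-]; rewrite lerD//.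
  by rewrite (le_trans (sK n))// lerD2l.
rewrite (_ : s = (fun n => s n + t n - t n)); first exact: is_cvgB.
by apply/funext => n; rewrite addrK.
Qed.

Section limits.
Variables (R : realType) (d : nat) (phi : 'rV[R]_d -> R) (psi : R -> R) (r0 : R).
Hypothesis phi_even : forall x, phi (- x) = phi x.
Hypothesis psi_ge0 : forall r : R, 0 <= r -> 0 <= psi r.
Hypothesis psi_anti : forall r s : R, 0 <= r -> r <= s -> psi s <= psi r.
Hypothesis phi_lower : forall x, - psi (enorm x) <= phi x.
Hypothesis phi_upper : forall x, r0 <= enorm x -> phi x <= psi (enorm x).
Implicit Types (x y : 'rV[R]_d) (i j : 'rV[int]_d) (omega zeta : config R d) (n : nat).
Implicit Types (D L X Y : set 'rV[R]_d).

(** Bounds the sum of psi(x - y) over the points y in the box n, uniformly in x in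
the cell i. *)
Definition tail_sum i n omega : R :=
  \sum_(j <- box d n) Psi psi (inorm (j - i)) * (num_points (cell j) omega)%:R.

(** The configurations for which psi is summable around every cell. On them birth
and conditional energies exist. They have full measure under tempered
invariant laws, and membership is not affected by changes in a bounded set. *)
Definition summable_configs : set (config R d) :=
  [set omega | forall i, exists m : nat, forall n, tail_sum i n omega <= m%:R].

Let Psi0 k : 0 <= Psi psi k := Psi_ge0 psi_ge0 k.

Lemma psi_le_Psi x y : psi (enorm (x - y)) <= Psi psi (inorm (cell_of y - cell_of x)).
Proof. by apply: psi_anti => //; exact: cell_dist. Qed.

Lemma psi_sum_le omega x X n : X `<=` points omega `&` hcube n ->
  \sum_(y \in X) psi (enorm (x - y)) <= tail_sum (cell_of x) n omega.
Proof.
move=> Xn; have fX : finite_set X.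
  by apply: sub_finite_set Xn _; apply: finite_points; case: (bounded_borel_hcube R d n).
apply: (@le_trans _ _ (\sum_(y \in X) Psi psi (inorm (cell_of y - cell_of x)))).
  by apply: ler_fsumr => // y _; exact: psi_le_Psi.
rewrite (@sum_cells _ _ X n (fun j => Psi psi (inorm (j - cell_of x))))//; last first.
  by move=> y /Xn[].
apply: ler_sum => j _; rewrite ler_wpM2l// ler_nat; apply: card_fset_set_le.
  by apply: finite_points; case: (bounded_borel_cell R j).
by move=> y [/Xn[]].
Qed.

Lemma cvg_sum_phi omega x D : summable_configs omega ->
  cvgn (fun n => \sum_(y \in points omega `&` (cube n `\` D)) phi (x - y)).
Proof.
move=> /(_ (cell_of x))[M hM].
pose Y n := points omega `&` (cube n `\` D).
have fY n : finite_set (Y n).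
  apply: finite_points; apply: bounded_set_subset (@bounded_cube R d n); exact: subDsetl.
have YS n : Y n `<=` Y n.+1.
  by move=> y [oy [yn yD]]; split=> //; split=> //; exact: subset_cube (leqnSn n) _ yn.
(* The finitely many points where phi need not be below psi. *)
pose near_set : set 'rV[R]_d := points omega `&` [set y | enorm (x - y) < r0].
have fN : finite_set near_set.
  apply: finite_points; apply/bounded_setP; exists (`|x| + r0) => y /= h.
  have : `|y - x| <= r0.
    by rewrite -normrN opprB (le_trans (norm_le_enorm _))// ltW.
  by have := lerB_dist y x; rewrite lerBlDr; move=> h1 h2; rewrite (le_trans h1)// addrC lerD2l.
change (cvgn (fun n => \sum_(y \in Y n) phi (x - y))).
apply: (@cvg_of_domination _ _ (fun n => \sum_(y \in Y n) psi (enorm (x - y)))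
   (\sum_(y \in near_set) `|phi (x - y)|) M%:R).
- move=> n; rewrite -!fsbig_split//=.
  apply: ler_fsumr_subset => // y _.
  by rewrite -lerBlDr sub0r.
- move=> n; apply: ler_fsumr_subset => // y _; apply: psi_ge0; exact: enorm_ge0.
- move=> n; apply: le_trans (hM n.+1); apply: psi_sum_le => y [oy [yn _]].
  by split=> //; exact: cube_subset_hcube.
- move=> n; pose N := [set y | enorm (x - y) < r0].
  apply: (@le_trans _ _ (\sum_(y \in Y n) ((if y \in N then `|phi (x - y)| else 0) +
      psi (enorm (x - y))))).
    apply: ler_fsumr => // y _; case: ifPn => [_|yN].
      by rewrite (le_trans (ler_norm _))// lerDl psi_ge0// enorm_ge0.
    rewrite add0r phi_upper// leNgt; apply: contra yN => h.
    by apply/mem_set.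
  rewrite fsbig_split//= lerD2r -fsbig_mkcondr; apply: ler_fsumr_subset => //.
  by move=> y [[oy _] yN].
Qed.

Lemma cvg_birth_energy omega x : summable_configs omega ->
  cvgn (fun n => energy phi ((points omega `&` cube n) `|` [set x]) -
                 energy phi (points omega `&` cube n)).
Proof.
move=> ro; have fc n : finite_set (points omega `&` cube n).
  by apply: finite_points; exact: bounded_cube.
have [ox|ox] := pselect (points omega x); last first.
  have /(_ set0) := @cvg_sum_phi omega x _ ro; rewrite (_ : (fun _ => _) = (fun n =>
    energy phi ((points omega `&` cube n) `|` [set x]) - energy phi (points omega `&` cube n)))//.
  apply/funext => n; rewrite energyU1// ?setD0//.
  by move=> [].
have [m xm] := mem_some_cube x.
apply: (cvgP (0 : R)); apply: cvg_trans (@cvg_cst _ (0 : R) _ \oo _).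
apply: near_eq_cvg; exists m => // n /= mn.
suff -> : (points omega `&` cube n) `|` [set x] = points omega `&` cube n by rewrite subrr.
by apply/setUidPl => _ ->; split=> //; exact: subset_cube xm.
Qed.

Lemma conditional_energyE omega L n : bounded_set L -> L `<=` cube n ->
  energy phi (points omega `&` cube n) - energy phi (points omega `&` (cube n `\` L)) =
  energy phi (points omega `&` L) +
  cross phi (points omega `&` L) (points omega `&` (cube n `\` L)).
Proof.
move=> bL Ln.
have -> : points omega `&` cube n =
    (points omega `&` L) `|` (points omega `&` (cube n `\` L)).
  by rewrite -setIUr setDUK.
rewrite energyD//.
- exact: finite_points.
- by apply: finite_points; apply: bounded_set_subset (@bounded_cube R d n); exact: subDsetl.
- by apply/seteqP; split=> // y [[_ Ly] [_ [_]]].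
Qed.

Lemma cvg_conditional_energy omega L : summable_configs omega -> bounded_set L ->
  cvgn (fun n => energy phi (points omega `&` cube n) -
                 energy phi (points omega `&` (cube n `\` L))).
Proof.
move=> ro bL; have [m Lm] := bounded_subset_cube bL.
suff h : cvgn (fun n => energy phi (points omega `&` L) +
  cross phi (points omega `&` L) (points omega `&` (cube n `\` L))).
  apply: (cvgP (limn (fun n => energy phi (points omega `&` L) +
    cross phi (points omega `&` L) (points omega `&` (cube n `\` L))))).
  apply: cvg_trans h; apply: near_eq_cvg; exists m => // n /= mn.
  by rewrite conditional_energyE//; apply: subset_trans Lm _; exact: subset_cube.
apply: is_cvgD; first exact: is_cvg_cst.
rewrite /cross (_ : (fun n => _) = (fun n => \sum_(x <- fset_set (points omega `&` L))
    \sum_(y \in points omega `&` (cube n `\` L)) phi (x - y))); last first.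
  by apply/funext => n; rewrite fsbig_finite//; exact: finite_points.
elim: (enum_fset (fset_set (points omega `&` L))) => [|x s IHs].
  rewrite (_ : (fun n => _) = cst 0); first exact: is_cvg_cst.
  by apply/funext => n; rewrite big_nil.
rewrite (_ : (fun n => _) = (fun n => \sum_(y \in points omega `&` (cube n `\` L)) phi (x - y) +
   \sum_(x <- s) \sum_(y \in points omega `&` (cube n `\` L)) phi (x - y))); last first.
  by apply/funext => n; rewrite big_cons.
by apply: is_cvgD => //; exact: cvg_sum_phi.
Qed.

(** Both energies are limits of differences of energies in cubes, and before the
limit the identity is a telescoping one. It makes b(x, eta) the factor
by which a new point changes the Gibbs density, which is the source of the
Georgii-Nguyen-Zessin formula. *)
Lemma conditional_energy_add omega L x : summable_configs omega -> bounded_set L ->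
  L x -> ~ points omega x ->
  conditional_energy phi L (config_add omega x) =
  conditional_energy phi L omega + birth_energy phi x omega.
Proof.
move=> ro bL Lx ox.
have c1 := cvg_conditional_energy ro bL; have c2 := @cvg_birth_energy omega x ro.
rewrite /conditional_energy /birth_energy; apply: cvg_lim => //.
apply: (cvg_trans _ (cvgD c1 c2)); apply: near_eq_cvg.
have [m Lm] := bounded_subset_cube bL; exists m => // n /= mn.
have Ln : L `<=` cube n by apply: subset_trans Lm _; exact: subset_cube.
have -> : points (config_add omega x) `&` cube n = (points omega `&` cube n) `|` [set x].
  apply/seteqP; split=> [y [[oy|/= ->] yn]|y [[oy yn]|/= ->]]; [by left|by right| |].
    by split=> //; left.
  by split; [right|exact: Ln].
have -> : points (config_add omega x) `&` (cube n `\` L) = points omega `&` (cube n `\` L).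
  apply/seteqP; split=> [y [[oy|/= ->] [yn nL]]|y [oy yn]] //.
  by split=> //; left.
by rewrite addrC addrA subrK.
Qed.

Lemma summable_configs_finite_change omega zeta D : bounded_set D ->
  (forall A, bounded_set A -> num_points A zeta <= num_points A omega + num_points (A `&` D) zeta)%N ->
  summable_configs omega -> summable_configs zeta.
Proof.
move=> bD h ro i; have [M hM] := ro i.
have [m Dm] := bounded_subset_cube bD.
pose c : R := Psi psi 0 * (num_points D zeta)%:R.
exists (M + (Num.truncn c).+1)%N => n.
apply: (@le_trans _ _ (tail_sum i n omega +
   \sum_(j <- box d n) Psi psi (inorm (j - i)) * (num_points (cell j `&` D) zeta)%:R)).
  rewrite /tail_sum -big_split/=; apply: ler_sum => j _.
  by rewrite -mulrDr ler_wpM2l// -natrD ler_nat h//; case: (bounded_borel_cell R j).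
rewrite natrD lerD//.
apply: (@le_trans _ _ c); last by rewrite ltW// truncnS_gt.
apply: (@le_trans _ _ (\sum_(j <- box d n) Psi psi 0 * (num_points (cell j `&` D) zeta)%:R)).
  apply: ler_sum => j _; rewrite ler_wpM2r//.
  by rewrite /Psi; apply: psi_anti.
rewrite -mulr_sumr /c ler_wpM2l//.
have fA : finite_set (points zeta `&` D `&` hcube n).
  by apply: finite_setIl; exact: finite_points.
have := @sum_cells R d (points zeta `&` D `&` hcube n) n (fun=> 1) fA (@subIsetr _ _ _).
under [X in _ = X -> _]eq_bigr do rewrite mul1r.
rewrite -card_of_sum// => e.
apply: (@le_trans _ _ (\sum_(j <- box d n) (card_of (points zeta `&` D `&` hcube n `&` cell j))%:R)).
  rewrite le_eqVlt; apply/orP; left; apply/eqP; apply: eq_big_seq => j jn.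
  congr (card_of _)%:R; apply/seteqP; split=> [y [zy [jy Dy]]|y [[[zy Dy] _] jy]] //.
  split=> //; split=> //; rewrite hcube_bigcup.
  by rewrite -bigcup_seq; exists j.
rewrite -e ler_nat; apply: card_fset_set_le; first exact: finite_points.
by move=> y [].
Qed.

Lemma summable_configs_paste omega eta L : bounded_set L ->
  summable_configs omega -> summable_configs (paste L eta omega).
Proof.
move=> bL; apply: summable_configs_finite_change bL _ => A bA.
rewrite num_points_paste// addnC leq_add//.
  by apply: num_points_le => //; exact: subDsetl.
rewrite num_points_paste; last by apply: bounded_set_subset bA; exact: subIsetl.
by rewrite -setIA setIid leq_addr.
Qed.

Lemma measurable_summable_configs : measurable summable_configs.
Proof.
rewrite (_ : summable_configs = \bigcap_(i in [set: 'rV[int]_d])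
    \bigcup_m \bigcap_n [set omega | tail_sum i n omega <= m%:R]).
  rewrite -[X in measurable X]setCK setC_bigcap; apply: measurableC.
  apply: countable_bigcupT_measurable => [|i]; first exact: countableP.
  apply: measurableC.
  apply: bigcup_measurable => m _; apply: bigcap_measurable => // n _.
  have mt : measurable_fun setT (tail_sum i n).
    apply: measurable_sum => j; apply: measurable_funM => //.
    apply: measurable_natr; apply: measurable_num_points; exact: bounded_borel_cell.
  rewrite -[X in measurable X]setTI.
  by apply: measurable_fun_le.
apply/seteqP; split=> [omega h i _|omega h i].
  have [m hm] := h i; exists m => // n _; exact: hm.
by have [m _ hm] := h i I; exists m => n; exact: hm.
Qed.

Hypothesis phi_measurable : measurable_fun [set: 'rV[R]_d] phi.

(** Joint measurability, needed to exchange the integrals over configurations and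
positions. *)
Lemma measurable_birth_rate :
  measurable_fun (summable_configs `*` setT)
    (fun z : config R d * 'rV[R]_d => birth_rate phi z.2 z.1).
Proof.
apply: measurableT_comp => //; apply: measurableT_comp => //.
have mS : measurable (summable_configs `*` [set: 'rV[R]_d]).
  by apply: measurableX => //; exact: measurable_summable_configs.
apply: (@measurable_fun_cvg _ _ _ _ (fun n z =>
   energy phi ((points z.1 `&` cube n) `|` [set z.2]) - energy phi (points z.1 `&` cube n))).
  move=> n; apply: measurable_funTS.
  pose Q := [set z : config R d * 'rV[R]_d | points z.1 z.2] `&` [set z | cube n z.2].
  have mQ : measurable Q.
    apply: measurableI; first exact: measurable_mem_config.
    rewrite -[X in measurable X]setTI; apply: measurable_snd => //.
    exact: measurable_cube.
  rewrite (_ : (fun _ => _) = (fun z => if z \in Q then 0 else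
      \sum_(y \in points z.1 `&` cube n) phi (z.2 - y))).
    apply: measurable_fun_if => //.
    - by apply: (measurable_fun_bool true); rewrite setTI preimage_mem_true.
    - apply: measurable_funTS.
      have mk : measurable_fun [set: config R d * 'rV[R]_d] (fun z => z.1) by exact: measurable_fst.
      have mf : measurable_fun setT
          (fun z : (config R d * 'rV[R]_d) * 'rV[R]_d => phi (z.1.2 - z.2)).
        apply: measurableT_comp => //; apply: measurable_rVB => //.
        exact: measurableT_comp.
      exact: (measurable_sum_points mk (bounded_borel_cube R d n) mf).
  apply/funext => z; case: ifPn => zQ.
    have [zz zn] : Q z by rewrite inE in zQ.
    suff -> : (points z.1 `&` cube n) `|` [set z.2] = points z.1 `&` cube n by rewrite subrr.
    by apply/setUidPl => _ ->.
  rewrite energyU1//; first by apply: finite_points; exact: bounded_cube.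
  by move: zQ; rewrite notin_setE.
move=> z [Sz _]; exact: (@cvg_birth_energy z.1 z.2 Sz).
Qed.

Lemma measurable_conditional_energy L omega : bounded_borel L -> summable_configs omega ->
  measurable_fun setT (fun eta => conditional_energy phi L (paste L eta omega)).
Proof.
move=> [mL bL] ro.
apply: (@measurable_fun_cvg _ _ _ _ (fun n eta =>
   energy phi (points (paste L eta omega) `&` cube n) -
   energy phi (points (paste L eta omega) `&` (cube n `\` L)))).
  move=> n; apply: measurable_funB; apply: measurable_energy => //.
  - exact: measurable_paste.
  - exact: bounded_borel_cube.
  - exact: measurable_paste.
  - by apply: bounded_borelD => //; exact: bounded_borel_cube.
move=> eta _; apply: cvg_conditional_energy => //; exact: summable_configs_paste.
Qed.

End limits.

(** * Tempered invariant laws *)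

Section measure_tools.
Context d (T : measurableType d) (R : realType).
Local Open Scope ereal_scope.

(** Monotone convergence along the truncations min(f, m). *)
Lemma integral_le_of_truncation (mu : {measure set T -> \bar R}) (f : T -> R) (C : \bar R) :
  measurable_fun setT f -> (forall x, 0 <= f x)%R ->
  (forall m : nat, \int[mu]_x (Num.min (f x) m%:R)%:E <= C) ->
  \int[mu]_x (f x)%:E <= C.
Proof.
move=> mf f0 h.
have fE x : (Num.min (f x) n%:R)%:E @[n --> \oo] --> (f x)%:E.
  apply: (cvg_trans _ (@cvg_cst _ (f x)%:E _ \oo _)); apply: near_eq_cvg.
  exists (Num.truncn (f x)).+1 => // n /= fn; congr EFin.
  rewrite min_l// ltW// (lt_le_trans (truncnS_gt _))//.
  by rewrite ler_nat.
have -> : \int[mu]_x (f x)%:E = \int[mu]_x limn (fun n => (Num.min (f x) n%:R)%:E).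
  by apply: eq_integral => x _; apply/esym/cvg_lim.
rewrite monotone_convergence//.
- apply: lime_le; last by apply: nearW => n; exact: h.
  apply: ereal_nondecreasing_is_cvgn => m n mn; apply: ge0_le_integral_lower => x.
    by rewrite lee_fin le_min f0/=.
  by rewrite lee_fin le_min ge_min lexx/= ge_min ler_nat mn orbT.
- move=> n; apply/measurable_EFinP; exact: measurable_minr.
- by move=> n x _; rewrite lee_fin le_min f0/=.
- by move=> x _ m n mn; rewrite lee_fin le_min ge_min lexx/= ge_min ler_nat mn orbT.
Qed.

(** Markov's inequality. *)
Lemma mul_measure_le_integral (mu : {measure set T -> \bar R}) (A : set T) (m : R)
  (f : T -> \bar R) : measurable A -> (0 <= m)%R -> (forall x, 0 <= f x) ->
  (forall x, A x -> m%:E <= f x) -> m%:E * mu A <= \int[mu]_x f x.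
Proof.
move=> mA m0 f0 fA.
have -> : mu A = \int[mu]_x (\1_A x)%:E by rewrite integral_indic// setIT.
rewrite -ge0_integralZ_lower//.
apply: ge0_le_integral_lower => x; rewrite -EFinM; first by rewrite lee_fin mulr_ge0.
have [xA|xA] := pselect (A x); rewrite indicE; first by rewrite mem_set// mulr1 fA.
by rewrite memNset// mulr0.
Qed.

Variable P : probability T R.

Lemma exists_small_difference (F : nat -> set T) (e : R) : (0 < e)%R ->
  (forall n, measurable (F n)) -> (forall n, F n `<=` F n.+1) ->
  exists n, P ((\bigcup_m F m) `\` F n) <= e%:E.
Proof.
move=> e0 mF FS.
have mU : measurable (\bigcup_m F m) by exact: bigcup_measurable.
have nF : nondecreasing_seq F by apply/nondecreasing_seqP => n; apply/subsetPset.
have c := nondecreasing_cvg_mu mF mU nF.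
have fU : P (\bigcup_m F m) \is a fin_num by exact: fin_num_measure.
apply: contrapT => /forallNP h.
have : P (\bigcup_m F m) <= P (\bigcup_m F m) - e%:E.
  apply: (cvge_le _ (c _ P)); apply: nearW => n /=.
  have /negP := h n; rewrite -ltNge.
  have -> : P ((\bigcup_m F m) `\` F n) = P (\bigcup_m F m) - P (F n).
    have := @measureD _ _ _ P _ (F n) mU (mF n).
    rewrite (_ : (\bigcup_m F m) `&` F n = F n); last first.
      by apply/setIidPr => x Fx; exists n.
    by apply; rewrite ltey_eq fU.
  have fF : P (F n) \is a fin_num by exact: fin_num_measure.
  move: fU fF; case: (P _) => [a| |]// _; case: (P _) => [b| |]// _.
  rewrite -!EFinB lee_fin lte_fin; lra.
apply/negP; rewrite -ltNge lteBlDr// lteDl// lte_fin//.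
Qed.

End measure_tools.

Section temperedness.
Variables (R : realType) (d : nat).
Hypothesis d_gt0 : (0 < d)%N.
Implicit Types (i j : 'rV[int]_d) (omega : config R d) (n : nat).

Definition ivec i : 'rV[R]_d := \row_l (i ord0 l)%:~R.

Lemma num_points_cell_translate i j omega :
  num_points (cell j) (translate (ivec i) omega) = num_points (cell (j + i)) omega.
Proof.
rewrite num_points_translate; last by case: (bounded_borel_cell R j).
congr num_points; apply/seteqP; split=> y h l; have := h l; rewrite !mxE intrD.
  by rewrite lerBrDr ltrBlDr [_ + 1 + _]addrAC.
by rewrite lerBrDr ltrBlDr [_ + 1 + _]addrAC.
Qed.

Definition square_sum n omega : R :=
  \sum_(i <- box d n) (num_points (cell i) omega)%:R ^+ 2.

Lemma measurable_square_sum n : measurable_fun setT (square_sum n).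
Proof.
apply: measurable_sum => i; apply: measurable_funX.
apply: measurable_natr; apply: measurable_num_points; exact: bounded_borel_cell.
Qed.

Lemma square_sum_translate i n omega :
  square_sum n (translate (ivec i) omega) <= square_sum (n + inorm i) omega.
Proof.
rewrite /square_sum.
have := @sum_box_shift R d (fun k => (num_points (cell k) omega)%:R ^+ 2) (- i) n
  (fun k => sqr_ge0 _).
rewrite inormN; apply: le_trans; rewrite le_eqVlt; apply/orP; left; apply/eqP.
by apply: eq_bigr => j _; rewrite num_points_cell_translate opprK.
Qed.

Lemma square_sum_untranslate i n omega :
  square_sum n omega <= square_sum (n + inorm i) (translate (ivec i) omega).
Proof.
rewrite /square_sum.
have := @sum_box_shift R d (fun k => (num_points (cell k) (translate (ivec i) omega))%:R ^+ 2) i n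
  (fun k => sqr_ge0 _).
apply: le_trans; rewrite le_eqVlt; apply/orP; left; apply/eqP.
by apply: eq_bigr => j _; rewrite num_points_cell_translate subrK.
Qed.

(** Temperedness bounds the mean squares over boxes centred at the origin by t.
Allowing an offset k of the box size and then taking the union over k makes the
event invariant under lattice translations for each fixed t, so that it can be
inserted into expectations under invariant laws. *)
Definition moderate_from (t k : nat) : set (config R d) :=
  [set omega | forall n, square_sum n omega <= t%:R * (n + k)%:R ^+ d].

Definition moderate (t : nat) : set (config R d) := \bigcup_k moderate_from t k.

Lemma measurable_moderate_from t k : measurable (moderate_from t k).
Proof.
rewrite (_ : moderate_from t k =
    \bigcap_n [set omega | square_sum n omega <= t%:R * (n + k)%:R ^+ d]).
  apply: bigcap_measurable => [|n _]; first by exists 0%N.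
  rewrite -[X in measurable X]setTI.
  by apply: measurable_fun_le => //; exact: measurable_square_sum.
by apply/seteqP; split=> [omega h n _|omega h n]; [exact: h|exact: (h n I)].
Qed.

Lemma measurable_moderate t : measurable (moderate t).
Proof. by apply: bigcup_measurable => k _; exact: measurable_moderate_from. Qed.

Lemma moderate_from_subset t k : moderate_from t k `<=` moderate_from t k.+1.
Proof.
move=> omega h n; apply: le_trans (h n) _; rewrite ler_wpM2l// lerXn2r ?nnegrE//.
by rewrite ler_nat addnS.
Qed.

Lemma moderate_le s t : (s <= t)%N -> moderate s `<=` moderate t.
Proof.
move=> st omega [k _ h]; exists k => // n; apply: le_trans (h n) _.
by rewrite ler_wpM2r ?exprn_ge0// ler_nat.
Qed.

Lemma moderate_translate t i : translate (ivec i) @^-1` moderate t = moderate t.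
Proof.
apply/seteqP; split=> omega [k _ h]; exists (k + inorm i)%N => // n.
  by apply: le_trans (square_sum_untranslate i n omega) (le_trans (h _) _); rewrite addnA addnAC.
by apply: le_trans (square_sum_translate i n omega) (le_trans (h _) _); rewrite addnA addnAC.
Qed.

Lemma bounded_borel_wide_cell i : bounded_borel (@wide_cell R d i).
Proof.
split.
  rewrite (_ : wide_cell i = \bigcap_(l in [set: 'I_d])
    ((fun x : 'rV[R]_d => x ord0 l) @^-1` `[(i ord0 l)%:~R - 1, (i ord0 l)%:~R + 1]%classic)).
    apply: fin_bigcap_measurable => // l _; rewrite -[X in measurable X]setTI.
    by apply: measurable_coord.
  by apply/seteqP; split=> x h l; have := h l => /=; rewrite in_itv/=; [move=> ? _|apply].
apply: bounded_set_subset (@bounded_cube R d (inorm i).+2) => x h l.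
have /andP[h1 h2] := h l; have hl : (`|i ord0 l| <= inorm i)%N by exact: leq_inorm.
have : `|(i ord0 l)%:~R| <= (inorm i)%:R :> R.
  by rewrite -intr_norm -[(inorm i)%:R]/((inorm i)%:Z%:~R) ler_int; lia.
rewrite ler_norml => /andP[h3 h4]; rewrite -!natr1; lra.
Qed.

Lemma finite_box_closed n : finite_set [set i : 'rV[int]_d | forall l : 'I_d, `|i ord0 l| <= n%:Z].
Proof.
apply: (@sub_finite_set _ _ [set` box d n.+1]); last exact: finite_fset.
by move=> i hi /=; apply/in_boxP => l; have := hi l; lia.
Qed.

Lemma tempered_subset_moderate : @tempered_configs R d `<=` \bigcup_t moderate t.
Proof.
move=> omega [t t0 h]; exists (Num.truncn (t * 2 ^+ d)).+1 => //; exists 0%N => // n.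
rewrite addn0; case: n => [|n].
  rewrite /square_sum (_ : box d 0 = fset0) ?big_seq_fset0; last first.
    by apply/cardfs0_eq; rewrite card_box addn0 exp0n.
  by rewrite mulr_ge0// exprn_ge0.
apply: le_trans (le_trans (h n.+1 isT) _).
  rewrite /square_sum.
  pose A := [set i : 'rV[int]_d | forall l : 'I_d, `|i ord0 l| <= n.+1%:Z].
  have fA : finite_set A by exact: finite_box_closed.
  apply: (@le_trans _ _ (\sum_(i <- box d n.+1) (num_points (wide_cell i) omega)%:R ^+ 2)).
    apply: ler_sum => i _; rewrite lerXn2r ?nnegrE// ler_nat; apply: num_points_le.
      by case: (bounded_borel_wide_cell i).
    move=> x xi l; have /andP[h1 h2] := xi l.
    by rewrite (ltW h2) andbT (le_trans _ h1)// lerBlDr lerDl.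
  rewrite fsbig_finite//=; apply: ler_sum_fset => [|i]; last exact: sqr_ge0.
  apply/fsubsetP => i /in_boxP ib; rewrite in_fset_set// inE /A/= => l.
  by have := ib l; lia.
rewrite volume_cube -mulr_natl exprMn mulrA ler_wpM2r ?exprn_ge0//.
by rewrite ltW// truncnS_gt.
Qed.

Lemma measurable_tempered_configs : measurable (@tempered_configs R d).
Proof.
rewrite (_ : @tempered_configs R d = \bigcup_(t : nat) \bigcap_n [set omega : config R d |
   \sum_(i \in [set i : 'rV[int]_d | forall l : 'I_d, `|i ord0 l| <= n.+1%:Z])
      ((num_points (wide_cell i) omega)%:R ^+ 2 : R) <= t.+1%:R * volume (@cube R d n.+1)]).
  apply: bigcup_measurable => t _; apply: bigcap_measurable => [|n _]; first by exists 0%N.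
  rewrite -[X in measurable X]setTI; apply: measurable_fun_le => //.
  rewrite (_ : (fun _ => _) = (fun omega : config R d =>
    \sum_(i <- fset_set [set i : 'rV[int]_d | forall l : 'I_d, `|i ord0 l| <= n.+1%:Z])
      (num_points (wide_cell i) omega)%:R ^+ 2)); last first.
    by apply/funext => omega; rewrite fsbig_finite//; exact: finite_box_closed.
  apply: measurable_sum => i; apply: measurable_funX; apply: measurable_natr.
  by apply: measurable_num_points; exact: bounded_borel_wide_cell.
apply/seteqP; split=> omega.
  move=> [t t0 h]; exists (Num.truncn t) => // n _; apply: le_trans (h n.+1 isT) _.
  by rewrite ler_wpM2r ?volume_ge0// ltW// truncnS_gt.
by move=> [t _ h]; exists t.+1%:R => // -[|n]// _; exact: (h n I).
Qed.

Section invariant_law.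
Variable mu : probability (config R d) R.
Hypothesis mu_ti : translation_invariant mu.

Lemma integral_translate x (f : config R d -> \bar R) :
  measurable_fun setT f -> (forall omega, 0 <= f omega)%E ->
  (\int[mu]_omega f (translate x omega) = \int[mu]_omega f omega)%E.
Proof.
move=> mf f0.
have mt : measurable_fun setT (@translate R d x) by exact: measurable_translate.
transitivity (\int[pushforward mu (@translate R d x)]_omega f omega)%E.
  by rewrite ge0_integral_pushforward.
by apply: eq_measure_integral => A mA _; exact: mu_ti.
Qed.

(** By invariance of the law and of the event, the expectation is the same for all
cells, hence equal to its average over the box of size K, and on the event
this average is at most t for large K. Truncating the square at m makes
the contribution of the configurations for which K is not large enough
yet at most m times their probability, which tends to 0. *)
Lemma moderate_second_moment t i :
  (\int[mu]_omega (\1_(moderate t) omega * (num_points (cell i) omega)%:R ^+ 2)%:E <= t%:R%:E)%E.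
Proof.
have mN j : measurable_fun [set: config R d] (fun omega => (num_points (cell j) omega)%:R ^+ 2 : R).
  apply: measurable_funX; apply: measurable_natr; apply: measurable_num_points.
  exact: bounded_borel_cell.
have mI : measurable (moderate t) by exact: measurable_moderate.
have mI1 : measurable_fun setT (\1_(moderate t) : config R d -> R) by exact: measurable_indic.
apply: integral_le_of_truncation => [|omega|m].
- exact: measurable_funM.
- by rewrite mulr_ge0// sqr_ge0.
pose g j omega : R := Num.min (\1_(moderate t) omega * (num_points (cell j) omega)%:R ^+ 2) m%:R.
have g0 j omega : 0 <= g j omega by rewrite le_min mulr_ge0//= sqr_ge0.
have mg j : measurable_fun setT (g j).
  by apply: measurable_minr => //; exact: measurable_funM.
have gE j : (\int[mu]_omega (g j omega)%:E = \int[mu]_omega (g 0 omega)%:E)%E.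
  rewrite -(@integral_translate (ivec j) (EFin \o g 0)) => [||omega]; last 2 first.
  - exact/measurable_EFinP.
  - by rewrite lee_fin.
  apply: eq_integral => omega _ /=; congr (Num.min (_ * _ ^+ 2) _)%:E.
    rewrite !indicE; congr (nat_of_bool _)%:R.
    by rewrite -[in LHS](moderate_translate t j); apply/idP/idP; rewrite !inE.
  by rewrite num_points_cell_translate add0r.
rewrite -/(g i) gE; set e := (\int[mu]_omega _)%E.
have bg j : bounded_measurable (g j).
  by split=> //; exists m%:R => omega; rewrite ger0_norm// ge_min lexx orbT.
have eE : e = (\int[mu]_omega g 0 omega)%:E by exact: expectation_EFin.
have key (r : R) : 0 < r -> (e <= (t%:R + m%:R * r)%:E)%E.
  move=> r0.
  have [K0 hK0] := exists_small_difference mu r0 (fun k => measurable_moderate_from t k)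
     (@moderate_from_subset t).
  (* The successor makes the box nonempty. *)
  pose K := K0.+1.
  have hK : (mu (moderate t `\` moderate_from t K) <= r%:E)%E.
    apply: le_trans hK0; apply: le_measure; rewrite ?inE.
    - by apply: measurableD => //; exact: measurable_moderate_from.
    - by apply: measurableD => //; exact: measurable_moderate_from.
    - by apply: setDS; exact: moderate_from_subset.
  have K2 : 0 < ((K + K) ^ d)%:R :> R by rewrite ltr0n expn_gt0.
  have sumE : (\int[mu]_omega \sum_(j <- box d K) (g j omega)%:E = ((K + K) ^ d)%:R%:E * e)%E.
    rewrite ge0_integral_sum//; last 2 first.
    - by move=> j; apply/measurable_EFinP.
    - by move=> j omega _; rewrite lee_fin.
    under eq_bigr do rewrite gE -/e eE.
    by rewrite sumEFin big_const_seq count_predT iter_addr_0 card_box eE -EFinM mulr_natl.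
  have : (((K + K) ^ d)%:R%:E * e <= ((K + K) ^ d)%:R%:E * (t%:R + m%:R * r)%:E)%E.
    rewrite -sumE.
    pose D := moderate t `\` moderate_from t K.
    have mD : measurable D by apply: measurableD => //; exact: measurable_moderate_from.
    apply: (@le_trans _ _ (\int[mu]_omega ((t%:R * (K + K)%:R ^+ d)%:E +
       (m%:R * ((K + K) ^ d)%:R)%:E * (\1_D omega)%:E))%E).
      apply: ge0_le_integral_lower => omega.
        by apply: sume_ge0 => j _; rewrite lee_fin.
      rewrite sumEFin -EFinM -EFinD lee_fin.
      have [oI|oI] := pselect (moderate t omega); last first.
        rewrite big1 => [|j _]; last by rewrite /g indicE memNset// mul0r min_l.
        by rewrite addr_ge0 ?mulr_ge0// exprn_ge0.
      have [oK|oK] := pselect (moderate_from t K omega).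
        apply: (@le_trans _ _ (square_sum K omega)).
          apply: ler_sum => j _; rewrite /g indicE mem_set// mul1r ge_min lexx//.
        by apply: le_trans (oK K) _; rewrite lerDl !mulr_ge0.
      rewrite indicE mem_set// mulr1; apply: (@le_trans _ _ (\sum_(j <- box d K) m%:R)).
        by apply: ler_sum => j _; rewrite ge_min lexx orbT.
      rewrite big_const_seq count_predT iter_addr_0 card_box mulr_natr lerDr.
      by rewrite mulr_ge0// exprn_ge0.
    rewrite ge0_integralD//; last first.
      apply/measurable_EFinP; apply: measurable_funM => //; exact: measurable_indic.
    rewrite integral_cst// ge0_integralZ_lower//.
    rewrite integral_indic// setIT [X in (_ * X + _)%E](_ : _ = 1%E); last exact: probability_setT.
    rewrite mule1 -EFinM mulrDr EFinD leeD//.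
      by rewrite lee_fin -natrX mulrC.
    have -> : ((K + K) ^ d)%:R * (m%:R * r) = m%:R * ((K + K) ^ d)%:R * r by rewrite mulrCA mulrA.
    by rewrite [leRHS]EFinM lee_wpmul2l// lee_fin mulr_ge0.
  by rewrite lee_pmul2l// lte_fin.
rewrite eE lee_fin; apply/ler_addgt0Pr => r r0.
have m1 : 0 < m.+1%:R :> R by [].
have := key (r / m.+1%:R) (divr_gt0 r0 m1); rewrite eE lee_fin => /le_trans; apply.
rewrite lerD2l mulrCA ger_pMr// ler_pdivrMr// mul1r ler_nat//.
Qed.

(** The moderate events increase with t to a set that contains all tempered
configurations. *)
Lemma moderate_mass : (mu (@tempered_configs R d) = 1)%E ->
  forall e : R, 0 < e -> exists t0 : nat, forall t, (t0 <= t)%N ->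
    (mu (~` moderate t) <= e%:E)%E.
Proof.
move=> mt e e0.
have mU : measurable (\bigcup_t moderate t).
  by apply: bigcup_measurable => k _; exact: measurable_moderate.
have [t0 ht0] := exists_small_difference mu e0 measurable_moderate
  (fun t => moderate_le (leqnSn t)).
exists t0 => s ts; apply: (@le_trans _ _ (mu (~` (\bigcup_t moderate t)) +
    mu ((\bigcup_t moderate t) `\` moderate t0))%E).
  rewrite -measureU//; last 3 first.
  - exact: measurableC.
  - by apply: measurableD => //; exact: measurable_moderate.
  - by apply/seteqP; split=> // omega [h [/h]].
  apply: le_measure; rewrite ?inE.
  - by apply: measurableC; exact: measurable_moderate.
  - by apply: measurableU; [exact: measurableC|apply: measurableD => //; exact: measurable_moderate].
  move=> omega h; have [hU|hU] := pselect ((\bigcup_t moderate t) omega); [right|by left].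
  by split=> // /(moderate_le ts).
rewrite [X in (X + _)%E](_ : _ = 0%E) ?add0e//.
have h1 : mu (\bigcup_t moderate t) = 1%E.
  apply/eqP; rewrite eq_le probability_le1//= -[leLHS]mt.
  apply: le_measure; rewrite ?inE//; first exact: measurable_tempered_configs.
  exact: tempered_subset_moderate.
by have := @probability_setC _ _ _ mu _ mU; rewrite h1 subee.
Qed.

End invariant_law.

End temperedness.

Section summable.
Variables (R : realType) (d : nat).
Hypothesis d_gt0 : (0 < d)%N.
Variable psi : R -> R.
Hypothesis psi_ge0 : forall r : R, 0 <= r -> 0 <= psi r.
Hypothesis psi_anti : forall r s : R, 0 <= r -> r <= s -> psi s <= psi r.
Hypothesis psi_int :
  (\int[lebesgue_measure]_(r in `[0%R, +oo[) (psi r * r ^+ d.-1)%:E < +oo)%E.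
Variable mu : probability (config R d) R.
Hypothesis mu_ti : translation_invariant mu.
Hypothesis mu_tempered : tempered mu.
Implicit Types (i j : 'rV[int]_d) (omega : config R d) (n m t : nat).

Lemma measure_bigcup_le (F : nat -> set (config R d)) (C : \bar R) :
  (forall n, measurable (F n)) -> (forall n, F n `<=` F n.+1) ->
  (forall n, mu (F n) <= C)%E -> (mu (\bigcup_n F n) <= C)%E.
Proof.
move=> mF FS h.
have nF : nondecreasing_seq F by apply/nondecreasing_seqP => n; apply/subsetPset.
have mU : measurable (\bigcup_n F n) by exact: bigcup_measurable.
by apply: (cvge_le _ (nondecreasing_cvg_mu mF mU nF)); apply: nearW => n; exact: h.
Qed.

Lemma measure0_of_le (A : set (config R d)) :
  (forall e : R, 0 < e -> (mu A <= e%:E)%E) -> mu A = 0%E.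
Proof.
move=> h; apply/eqP; rewrite eq_le measure_ge0 andbT.
by apply/lee_addgt0Pr => e e0; rewrite add0e; exact: h.
Qed.

Lemma measurable_tail_sum i n : measurable_fun setT (@tail_sum R d psi i n).
Proof.
apply: measurable_sum => j; apply: measurable_funM => //.
apply: measurable_natr; apply: measurable_num_points; exact: bounded_borel_cell.
Qed.

Lemma moderate_weighted_sum (a : 'rV[int]_d -> R) (s : seq 'rV[int]_d) (S : R) t :
  (forall i, 0 <= a i) -> \sum_(i <- s) a i <= S ->
  (\int[mu]_omega (\1_(moderate t) omega *
     \sum_(i <- s) a i * (num_points (cell i) omega)%:R ^+ 2)%:E <= (S * t%:R)%:E)%E.
Proof.
move=> a0 aS.
have mI1 : measurable_fun setT (\1_(moderate t) : config R d -> R).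
  by apply: measurable_indic; exact: measurable_moderate.
pose f i omega : \bar R :=
  ((a i)%:E * (\1_(@moderate R d t) omega * (num_points (cell i) omega)%:R ^+ 2)%:E)%E.
have f0 i omega : (0 <= f i omega)%E by rewrite /f mule_ge0 ?lee_fin// mulr_ge0// sqr_ge0.
apply: (@le_trans _ _ (\sum_(i <- s) \int[mu]_omega f i omega)%E).
  rewrite -ge0_integral_sum//; last first.
    move=> i; apply: emeasurable_funM => //; apply/measurable_EFinP; apply: measurable_funM => //.
    apply: measurable_funX; apply: measurable_natr; apply: measurable_num_points.
    exact: bounded_borel_cell.
  rewrite le_eqVlt; apply/orP; left; apply/eqP.
  apply: eq_integral => omega _; rewrite mulr_sumr -sumEFin.
  by apply: eq_bigr => i _; rewrite /f -EFinM mulrCA.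
apply: (@le_trans _ _ (\sum_(i <- s) (a i * t%:R)%:E)%E).
  apply: lee_sum => i _; rewrite ge0_integralZ_lower//.
  by rewrite [leRHS]EFinM lee_wpmul2l ?lee_fin//; exact: moderate_second_moment.
by rewrite sumEFin lee_fin -mulr_suml ler_wpM2r.
Qed.

(** On a moderate event the expected tail sum around a cell is at most a constant,
uniformly in the box, since counts are at most their squares. By Markov's
inequality the tail sums around this cell are almost surely bounded, and there
are countably many cells. *)
Lemma summable_configs_full : mu (~` summable_configs psi) = 0%E.
Proof.
have [S [S0 hS]] := Psi_row_sum d_gt0 psi_ge0 psi_anti psi_int.
have P0 k : 0 <= Psi psi k by exact: Psi_ge0.
pose B i n m : set (config R d) := [set omega | m.+1%:R <= tail_sum psi i n omega].
have mB i n m : measurable (B i n m).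
  rewrite -[X in measurable X]setTI; apply: measurable_fun_le => //.
  exact: measurable_tail_sum.
have mI t : measurable (@moderate R d t) by exact: measurable_moderate.
have BI i n m t : (mu (B i n m `&` moderate t) <= (S * t%:R / m.+1%:R)%:E)%E.
  rewrite mulrC EFinM lee_pdivlMl ?ltr0n//.
  have mBI : measurable (B i n m `&` moderate t) by exact: measurableI.
  apply: le_trans (@mul_measure_le_integral _ _ _ mu _ m.+1%:R
     (fun omega => (\1_(moderate t) omega * \sum_(j <- box d n)
       Psi psi (inorm (j - i)) * (num_points (cell j) omega)%:R ^+ 2)%:E) mBI _ _ _) _ => //.
  - by move=> omega; rewrite lee_fin mulr_ge0//; apply: sumr_ge0 => j _; rewrite mulr_ge0// sqr_ge0.
  - move=> omega [Bo Io]; rewrite indicE mem_set// mul1r lee_fin; apply: le_trans Bo _.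
    apply: ler_sum => j _; rewrite ler_wpM2l// -natrX ler_nat.
    by case: (num_points _ _) => // k; rewrite -mulnn leq_pmulr.
  - by apply: moderate_weighted_sum.
have BU i m t : (mu ((\bigcup_n B i n m) `&` moderate t) <= (S * t%:R / m.+1%:R)%:E)%E.
  rewrite setI_bigcupl; apply: measure_bigcup_le => // n; first exact: measurableI.
  move=> omega [Bo Io]; split=> //; apply: le_trans Bo _.
  apply: ler_sum_fset => [|j]; first exact: box_subset.
  by rewrite mulr_ge0.
pose Z i := \bigcap_m \bigcup_n B i n m.
have mZ i : measurable (Z i).
  apply: bigcap_measurable => [|m _]; first by exists 0%N.
  exact: bigcup_measurable.
have ZI i t : mu (Z i `&` moderate t) = 0%E.
  apply: measure0_of_le => e e0.
  pose m := Num.truncn (S * t%:R / e).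
  apply: (@le_trans _ _ (mu ((\bigcup_n B i n m) `&` moderate t))).
    apply: le_measure; rewrite ?inE.
    - exact: measurableI.
    - by apply: measurableI => //; exact: bigcup_measurable.
    - by apply: setSI => omega h; exact: h.
  apply: le_trans (BU i m t) _; rewrite lee_fin ler_pdivrMr// [leRHS]mulrC -ler_pdivrMr//.
  by rewrite ltW// truncnS_gt.
have Z0 i : mu (Z i) = 0%E.
  apply: measure0_of_le => e e0.
  have [t0 ht0] := moderate_mass d_gt0 mu_tempered e0.
  apply: (@le_trans _ _ (mu (Z i `&` moderate t0) + mu (~` moderate t0))%E); last first.
    by rewrite ZI add0e; exact: (ht0 t0).
  have mZI : measurable (Z i `&` moderate t0) by exact: measurableI.
  rewrite -measureU//; last 2 first.
  - exact: measurableC.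
  - by apply/seteqP; split=> // omega [[]].
  apply: le_measure; rewrite ?inE//.
    by apply: measurableU; [exact: measurableI|exact: measurableC].
  by move=> omega h; have [hI|hI] := pselect (moderate t0 omega); [left|right].
apply/eqP; rewrite eq_le measure_ge0 andbT.
have mS : measurable (@summable_configs R d psi).
  exact: measurable_summable_configs.
have [f hf] : exists f : nat -> 'rV[int]_d, forall i, exists n, f n = i.
  exists (fun n => odflt 0 (choice.unpickle n)) => i.
  by exists (choice.pickle i); rewrite choice.pickleK.
apply: (@le_trans _ _ (\sum_(n <oo) mu (Z (f n)))%E).
  apply: (@measure_sigma_subadditive _ _ _ mu) => //; first exact: measurableC.
  move=> omega /existsNP[i /forallNP h]; have [n fn] := hf i; exists n => // m _.
  have /existsNP[k /negP] := h m.+1; rewrite -ltNge => /ltW hk.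
  by exists k => //; rewrite fn.
by rewrite eseries0.
Qed.

End summable.

(** * The Georgii-Nguyen-Zessin inequality *)

Section paste_facts.
Variables (R : realType) (d : nat).
Implicit Types (x : 'rV[R]_d) (L : set 'rV[R]_d) (eta omega : config R d).

Lemma paste_add L eta omega x : L x ->
  paste L (config_add eta x) omega = config_add (paste L eta omega) x.
Proof.
move=> Lx; apply: config_eqP => /=; apply/seteqP; split=> y.
  by move=> [[[ey|/= ->] Ly]|oy]; [left; left|right|left; right].
by move=> [[[ey Ly]|oy]|/= ->]; [left; split=> //; left|right|left; split=> //; right].
Qed.

Lemma num_points_paste_in L eta omega : num_points L (paste L eta omega) = num_points L eta.
Proof. by rewrite /num_points paste_in. Qed.

End paste_facts.

Section gnz.
Variables (R : realType) (d : nat) (phi : 'rV[R]_d -> R) (psi : R -> R) (r0 : R).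
Hypothesis d_gt0 : (0 < d)%N.
Hypothesis phi_measurable : measurable_fun [set: 'rV[R]_d] phi.
Hypothesis phi_even : forall x, phi (- x) = phi x.
Hypothesis psi_ge0 : forall r : R, 0 <= r -> 0 <= psi r.
Hypothesis psi_anti : forall r s : R, 0 <= r -> r <= s -> psi s <= psi r.
Hypothesis psi_int :
  (\int[lebesgue_measure]_(r in `[0%R, +oo[) (psi r * r ^+ d.-1)%:E < +oo)%E.
Hypothesis phi_lower : forall x, - psi (enorm x) <= phi x.
Hypothesis phi_upper : forall x, r0 <= enorm x -> phi x <= psi (enorm x).
Variable pi : probability (config R d) R.
Hypothesis pi_poisson : poisson_process pi.
Variable nu : probability (config R d) R.
Hypothesis nu_gibbs : tempered_gibbs phi pi nu.
Implicit Types (x : 'rV[R]_d) (eta omega zeta : config R d).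

Let leb := lebesgue_rV R d.
Let S := @summable_configs R d psi.

Let mS : measurable S. Proof. exact: measurable_summable_configs. Qed.

Let nuS : nu (~` S) = 0%E.
Proof. by case: nu_gibbs => nt nti _; exact: summable_configs_full. Qed.

Lemma partition_function_ge0 L omega : 0 <= partition_function phi pi L omega.
Proof.
by apply: fine_ge0; apply: integral_ge0 => eta _; rewrite lee_fin mul1r expR_ge0.
Qed.

Lemma gibbs_integral_ge0 L omega (f : config R d -> R) : (forall eta, 0 <= f eta) ->
  (0 <= gibbs_integral phi pi L omega f)%E.
Proof. by move=> f0; apply: integral_ge0 => eta _; rewrite lee_fin mulr_ge0// expR_ge0. Qed.

(** Inside the Gibbs integral the factor b(x, .) turns the density of eta into that
of eta with x added ([conditional_energy_add]), and the integral over x in L is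
then computed by the Mecke formula. The points x of the configuration itself
form a null set. *)
Lemma gibbs_integral_add_le L omega (f v : config R d -> R) (k : R)
    (g : config R d -> 'rV[R]_d -> R) : bounded_borel L -> S omega ->
  measurable_fun setT v -> (forall eta, 0 <= v eta) ->
  (forall eta x, 0 <= g eta x) ->
  (forall eta x, g eta x <= birth_rate phi x eta * \1_L x * v (config_add eta x)) ->
  (forall eta, (f eta)%:E = \int[leb]_x (g eta x)%:E)%E ->
  (gibbs_integral phi pi L omega f <=
   gibbs_integral phi pi L omega (fun eta => ((num_points L eta)%:R * v eta)%R))%E.
Proof.
move=> bL So mv v0 g0 gv fE; have [mL bdL] := bL.
pose e eta : R := expR (- conditional_energy phi L (paste L eta omega)).
have e0 eta : 0 <= e eta by exact: expR_ge0.
pose w eta : \bar R := (v (paste L eta omega) * e eta)%:E.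
have w0 eta : (0 <= w eta)%E by rewrite lee_fin mulr_ge0.
have mw : measurable_fun setT w.
  apply/measurable_EFinP; apply: measurable_funM.
    by apply: measurableT_comp => //; exact: measurable_paste.
  apply: measurableT_comp => //; apply: measurableT_comp => //.
  exact: (@measurable_conditional_energy R d phi psi r0).
have -> : gibbs_integral phi pi L omega (fun eta => ((num_points L eta)%:R * v eta)%R) =
    (\int[pi]_eta ((num_points L eta)%:R%:E * w eta))%E.
  apply: eq_integral => eta _; rewrite num_points_paste_in -EFinM.
  by rewrite /e mulrA.
rewrite -(mecke d_gt0 pi_poisson bL mw w0).
apply: ge0_le_integral_lower => eta.
  rewrite lee_fin mulr_ge0// -lee_fin fE; apply: integral_ge0 => x _.
  by rewrite lee_fin.
rewrite -/(e eta) mulrC EFinM fE -ge0_integralZ_lower//; last by move=> x; rewrite lee_fin.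
set zeta := paste L eta omega.
have Sz : S zeta by exact: summable_configs_paste.
pose N := points zeta `&` L.
have fN : finite_set N by exact: finite_points.
apply: (@ge0_le_integral_off_null _ _ _ _ N).
- rewrite (_ : N = \bigcup_(y in N) [set y]).
    by apply: fin_bigcup_measurable => // y _; exact: measurable_rV1.
  by apply/seteqP; split=> [y Ny|y [z Nz ->]]//; exists y.
- exact: lebesgue_finite_set.
- by move=> x; rewrite mule_ge0 ?lee_fin.
- by move=> x; rewrite mule_ge0 ?lee_fin//; exact: w0.
move=> x Nx; rewrite -EFinM.
apply: (@le_trans _ _ (e eta * (birth_rate phi x zeta * \1_L x * v (config_add zeta x)))%:E).
  by rewrite lee_fin ler_wpM2l.
have [Lx|Lx] := pselect (L x); last first.
  have -> : \1_L x = 0 :> R by rewrite indicE memNset.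
  clear -e0; move: (w _) (birth_rate _ _ _) (v _) (e eta) => a b c k'.
  by rewrite (mulr0 b) mul0r mulr0 mul0e.
rewrite /w paste_add// -/zeta -EFinM lee_fin /e paste_add// -/zeta.
rewrite (@conditional_energy_add R d phi psi r0)//; last by move=> zx; apply: Nx.
rewrite opprD expRD -/(birth_rate phi x zeta) !mulrA.
rewrite le_eqVlt; apply/orP; left; apply/eqP.
rewrite -/zeta; move: (expR _) (birth_rate _ _ _) (v _) (\1_L x) => a b c f'.
by ring.
Qed.

(** The inner integral over x is truncated so that it becomes a finite measurable
function, to which the DLR equation in L applies; [gibbs_integral_add_le]
compares the Gibbs expectations for every boundary condition in
[summable_configs]. *)
Lemma gnz_le L (v : config R d -> R) : bounded_borel L -> measurable_fun setT v ->
  (forall eta, 0 <= v eta) ->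
  (\int[nu]_eta \int[leb]_x (birth_rate phi x eta * \1_L x * v (config_add eta x))%:E <=
   \int[nu]_eta ((num_points L eta)%:R * v eta)%:E)%E.
Proof.
move=> bL mv v0; have [mL bdL] := bL.
pose h (z : config R d * 'rV[R]_d) : R := if z \in S `*` setT then
  birth_rate phi z.2 z.1 * \1_L z.2 * v (config_add z.1 z.2) else 0.
have b0 x eta : 0 <= birth_rate phi x eta by exact: expR_ge0.
have h0 z : 0 <= h z by rewrite /h; case: ifP => // _; rewrite !mulr_ge0.
have mSS : measurable (S `*` [set: 'rV[R]_d]) by exact: measurableX.
have mh : measurable_fun setT h.
  apply: measurable_fun_if => //.
    by apply: (measurable_fun_bool true); rewrite setTI preimage_mem_true.
  rewrite setTI preimage_mem_true.
  apply: measurable_funM; last first.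
    by apply: measurable_funTS; apply: measurableT_comp => //; exact: measurable_config_add.
  apply: measurable_funM.
    exact: (@measurable_birth_rate R d phi psi r0).
  by apply: measurable_funTS; apply: measurableT_comp => //; exact: measurable_indic.
apply: (@le_trans _ _ (\int[nu]_eta \int[leb]_x (h (eta, x))%:E)%E).
  apply: (@ge0_le_integral_off_null _ _ _ _ (~` S)) => //; first exact: measurableC.
  - by move=> eta; apply: integral_ge0 => x _; rewrite lee_fin !mulr_ge0.
  - by move=> eta; apply: integral_ge0 => x _; rewrite lee_fin.
  move=> eta /contrapT Se; apply: ge0_le_integral_lower => x.
    by rewrite lee_fin !mulr_ge0.
  by rewrite /h mem_set.
rewrite -[leLHS](@fubini_tonelli1 _ _ _ _ _ nu leb (EFin \o h)); last 2 first.
- exact/measurable_EFinP.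
- by move=> z; rewrite lee_fin.
apply: integral_le_of_truncation => // m.
pose hm z : R := Num.min (h z) m%:R.
have hm0 z : 0 <= hm z by rewrite le_min h0/=.
have mhm : measurable_fun setT hm by exact: measurable_minr.
rewrite (@fubini_tonelli1 _ _ _ _ _ nu leb (EFin \o hm)); last 2 first.
- exact/measurable_EFinP.
- by move=> z; rewrite lee_fin.
have hmL z : hm z <= m%:R * \1_L z.2.
  rewrite /hm /h; have [Lz|Lz] := pselect (L z.2).
    have -> : \1_L z.2 = 1 :> R by rewrite indicE mem_set.
    by rewrite [leRHS]mulr1 ge_min lexx orbT.
  have -> : \1_L z.2 = 0 :> R by rewrite indicE memNset.
  by rewrite !(mulr0, mul0r) if_same ge_min lexx.
have fin eta : (\int[leb]_x (hm (eta, x))%:E)%E \is a fin_num.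
  rewrite ge0_fin_numE; last by apply: integral_ge0 => x _; rewrite lee_fin.
  apply: (@le_lt_trans _ _ (m%:R%:E * leb L)%E).
    have -> : leb L = (\int[leb]_x (\1_L x)%:E)%E by rewrite integral_indic// setIT.
    rewrite -ge0_integralZ_lower//; apply: ge0_le_integral_lower => x; first by rewrite lee_fin.
    by rewrite -EFinM lee_fin; exact: (hmL (eta, x)).
  by rewrite volumeE// ltry.
pose f eta : R := fine (\int[leb]_x (hm (eta, x))%:E)%E.
have fE eta : ((f eta)%:E = \int[leb]_x (hm (eta, x))%:E)%E by rewrite /f fineK.
have f0 eta : 0 <= f eta by apply: fine_ge0; apply: integral_ge0 => x _; rewrite lee_fin.
have mf : measurable_fun setT f.
  apply/measurable_EFinP.
  rewrite (_ : EFin \o f = fubini_F leb (EFin \o hm)); last by apply/funext => eta; exact: fE.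
  apply: measurable_fun_fubini_tonelli_F; first exact/measurable_EFinP.
  by move=> z; rewrite lee_fin.
have -> : (\int[nu]_eta fubini_F leb (EFin \o hm) eta = \int[nu]_eta (f eta)%:E)%E.
  by apply: eq_integral => eta _; rewrite fE.
have [_ _ nud] := nu_gibbs.
rewrite (nud L bL f mf f0) (nud L bL (fun eta => (num_points L eta)%:R * v eta)); last 2 first.
- by apply: measurable_funM => //; apply: measurable_natr; exact: measurable_num_points.
- by move=> eta; rewrite mulr_ge0.
apply: (@ge0_le_integral_off_null _ _ _ _ (~` S)) => //; first exact: measurableC.
- move=> omega; apply: mule_ge0; last exact: gibbs_integral_ge0.
  by rewrite lee_fin invr_ge0 partition_function_ge0.
- move=> omega; apply: mule_ge0; last by apply: gibbs_integral_ge0 => eta; rewrite mulr_ge0.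
  by rewrite lee_fin invr_ge0 partition_function_ge0.
move=> omega /contrapT So; apply: lee_wpmul2l.
  by rewrite lee_fin invr_ge0 partition_function_ge0.
apply: (@gibbs_integral_add_le L omega f v m%:R (fun eta x => hm (eta, x))) => // eta x.
rewrite /hm /h ge_min; apply/orP; left; case: ifP => // _.
by rewrite !mulr_ge0.
Qed.

End gnz.

Lemma expRN_le2 (R : realType) (s : R) : `|s| <= 2^-1 -> expR (- s) <= 2.
Proof.
rewrite ler_norml => /andP[s3 s4]; have sn : - s <= 2^-1 by lra.
apply: le_trans (expR_le_quad sn) _; nra.
Qed.

(** * Exponential moments of the number of points *)

(** Young's inequality [young_xlnx] for the dual pair x ln x and exp, pointwise, with
the free additive constant k chosen optimally. *)
Section entropy_duality.
Context d (T : measurableType d) (R : realType) (P : probability T R).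

Lemma young_xlnx (a b : R) : b * expR a <= a * expR a - expR a + expR b.
Proof.
have := expR_ge1Dx (b - a); rewrite expRD expRN ler_pdivlMr ?expR_gt0//.
by move: (expR a) (expR b) => A B h; lra.
Qed.

Let expR_lnB (a b : R) : 0 < a -> 0 < b -> expR (ln b - ln a) = b / a.
Proof. by move=> a0 b0; rewrite expRD expRN !lnK ?posrE. Qed.

Lemma entropy_duality (G H : T -> R) : bounded_measurable G -> bounded_measurable H ->
  \int[P]_w (G w * expR (H w)) <= entropy P (fun w => expR (H w)) +
    (\int[P]_w expR (H w)) * ln (\int[P]_w expR (G w)).
Proof.
move=> bG bH; rewrite entropy_expR//.
have bE F : bounded_measurable F -> bounded_measurable (fun w => expR (F w)).
  exact: bounded_measurable_expR.
set B := \int[P]_w expR (H w); have B0 : 0 < B by exact: expectation_expR_gt0.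
set A := \int[P]_w expR (G w); have A0 : 0 < A by exact: expectation_expR_gt0.
(* The maximiser over constants of the pointwise bound after integration. *)
pose k : R := ln B - ln A.
have : \int[P]_w (G w * expR (H w) + k * expR (H w)) <=
   \int[P]_w (H w * expR (H w) + (-1 * expR (H w) + expR k * expR (G w))).
  apply: le_expectation.
  - apply: bounded_measurableD; first by apply: bounded_measurableM => //; exact: bE.
    by apply: bounded_measurableZ; exact: bE.
  - apply: bounded_measurableD; first by apply: bounded_measurableM => //; exact: bE.
    by apply: bounded_measurableD; apply: bounded_measurableZ; exact: bE.
  - move=> w; have := young_xlnx (H w) (G w + k); rewrite expRD.
    by clearbody k; move: (expR (H w)) (expR (G w)) (expR k) (G w) (H w) => x y z g h; lra.
rewrite !expectationD//.
- rewrite !expectationZ//; try exact: bE.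
  rewrite -/A -/B (expR_lnB A0 B0) /k -mulrA mulVf ?gt_eqF//.
  move: (\int[P]_w _) (\int[P]_w _) (ln B) (ln A) => x y b a; lra.
- by apply: bounded_measurableZ; exact: bE.
- by apply: bounded_measurableZ; exact: bE.
- by apply: bounded_measurableM => //; exact: bE.
- by apply: bounded_measurableD; apply: bounded_measurableZ; exact: bE.
- by apply: bounded_measurableM => //; exact: bE.
- by apply: bounded_measurableZ; exact: bE.
Qed.

End entropy_duality.

Section exponential_moments.
Variables (R : realType) (d : nat) (phi : 'rV[R]_d -> R) (c : R).
Variable nu : probability (config R d) R.
Hypothesis c_gt0 : 0 < c.
Hypothesis nu_ti : translation_invariant nu.
Hypothesis nu_mlsi : mlsi_birth phi nu c.
Let leb := lebesgue_rV R d.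
Hypothesis nu_gnz : forall L (v : config R d -> R), bounded_borel L ->
  measurable_fun setT v -> (forall eta, 0 <= v eta) ->
  (\int[nu]_eta \int[leb]_x (birth_rate phi x eta * \1_L x * v (config_add eta x))%:E <=
   \int[nu]_eta ((num_points L eta)%:R * v eta)%:E)%E.
Implicit Types (x : 'rV[R]_d) (eta omega zeta : config R d) (L : set 'rV[R]_d).

Lemma expR_diff_ge0 (a b : R) : 0 <= (expR a - expR b) * (a - b).
Proof.
have [ab|ba] := leP a b.
  by rewrite mulr_le0// subr_le0// ler_expR.
by rewrite mulr_ge0// subr_ge0 ?ler_expR ltW.
Qed.

(** The mean value theorem for exp, with the larger of the two values of exp
replaced by K exp(a). The value at a is the one after a point has been added,
which is the form that [gnz_le] accepts. *)
Lemma expR_diff_le (a b K : R) : 0 <= K -> (b <= a -> 1 <= K) -> (a <= b -> expR (b - a) <= K) ->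
  (expR a - expR b) * (a - b) <= K * (a - b) ^+ 2 * expR a.
Proof.
move=> K0 h1 h2; have [ab|ba] := leP a b.
  have h : expR b - expR a <= (b - a) * expR b.
    have := expR_ge1Dx (a - b); rewrite expRD expRN => h.
    have := expR_gt0 b; move: h; move: (expR b) (expR a) => B A h B0.
    have : (1 + (a - b)) * B <= A by rewrite -ler_pdivlMr.
    lra.
  have hb : expR b <= K * expR a.
    rewrite -ler_pdivrMr ?expR_gt0// -expRN -expRD; exact: h2.
  have ab0 : 0 <= b - a by rewrite subr_ge0.
  apply: (@le_trans _ _ ((b - a) * ((b - a) * expR b))).
    rewrite (_ : (expR a - expR b) * (a - b) = (b - a) * (expR b - expR a)); last by ring.
    exact: ler_wpM2l.
  rewrite (_ : K * (a - b) ^+ 2 * expR a = (b - a) * ((b - a) * (K * expR a))); last by ring.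
  by do 2 apply: ler_wpM2l => //.
have ab0 : 0 <= a - b by rewrite subr_ge0 ltW.
have h : expR a - expR b <= (a - b) * expR a.
  have := expR_ge1Dx (b - a); rewrite expRD expRN => h.
  have := expR_gt0 a; move: h; move: (expR b) (expR a) => B A h A0.
  have : (1 + (b - a)) * A <= B by rewrite -ler_pdivlMr.
  lra.
apply: (@le_trans _ _ ((a - b) * ((a - b) * expR a))).
  by rewrite mulrC ler_wpM2l.
rewrite mulrA -expr2 -mulrA ler_peMl ?mulr_ge0 ?sqr_ge0 ?expR_ge0//.
exact/h1/ltW.
Qed.

(** The modified logarithmic Sobolev inequality for exp(F), whose right-hand side
has integrand b(x, .) (exp F(. + x) - exp F) (F(. + x) - F); a bound u on the
last two factors that depends on the configuration with x only is integrated by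
[gnz_le]. *)
Lemma entropy_expR_le (F u : config R d -> R) L : bounded_borel L -> is_local F ->
  (exists M, forall eta, F eta <= M) ->
  measurable_fun setT u -> (forall eta, 0 <= u eta) ->
  (forall eta x, ~ L x -> F (config_add eta x) = F eta) ->
  (forall eta x, L x -> (expR (F (config_add eta x)) - expR (F eta)) *
     (F (config_add eta x) - F eta) <= u (config_add eta x)) ->
  ((entropy nu (fun eta => expR (F eta)))%:E <=
   c%:E * \int[nu]_eta ((num_points L eta)%:R * u eta)%:E)%E.
Proof.
move=> bL [mF [D bD FD]] [M FM] mu u0 Fout Fin.
have lF : is_local (fun eta => expR (F eta)).
  split; first exact: measurableT_comp.
  by exists D => // eta; rewrite -FD.
have bF : exists M', forall eta, expR (F eta) <= M'.
  by exists (expR M) => eta; rewrite ler_expR.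
apply: le_trans (nu_mlsi lF bF (fun eta => expR_gt0 _)) _.
apply: lee_wpmul2l; first by rewrite lee_fin ltW.
apply: le_trans (nu_gnz bL mu u0).
have g0 eta x : 0 <= birth_rate phi x eta * gradient x (fun eta => expR (F eta)) eta *
    gradient x (fun w => ln (expR (F w))) eta.
  by rewrite -mulrA mulr_ge0 ?expR_ge0// /gradient !expRK; exact: expR_diff_ge0.
apply: ge0_le_integral_lower => eta.
  by apply: integral_ge0 => x _; rewrite lee_fin.
apply: ge0_le_integral_lower => x; first by rewrite lee_fin.
rewrite lee_fin -!mulrA ler_wpM2l ?expR_ge0// /gradient !expRK.
have [Lx|Lx] := pselect (L x).
  have -> : \1_L x = 1 :> R by rewrite indicE mem_set.
  by rewrite mul1r; exact: Fin.
by rewrite Fout// !subrr mulr0 mulr_ge0.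
Qed.

(** The logarithmic Sobolev inequality is available for bounded functions only. The
truncated count is bounded, and adding a point still changes it by 0 or 1. *)
Definition capped L (m : nat) eta : R := Num.min (num_points L eta)%:R m%:R.

Section capped.
Variable L : set 'rV[R]_d.
Hypothesis bL : bounded_borel L.

Lemma capped_ge0 m eta : 0 <= capped L m eta.
Proof. by rewrite le_min !ler0n. Qed.

Lemma measurable_capped m : measurable_fun setT (capped L m).
Proof.
apply: measurable_minr => //; apply: measurable_natr; exact: measurable_num_points.
Qed.

Lemma capped_bounded m : bounded_measurable (capped L m).
Proof.
split; first exact: measurable_capped.
by exists m%:R => eta; rewrite ger0_norm ?capped_ge0// ge_min lexx orbT.
Qed.

(** Adding a point changes the truncated count only if the new count is at most m,
in which case count and truncated count coincide. This is why the capped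
number, and not the full one, appears on the right. *)
Lemma entropy_capped (m : nat) (s : R) : `|s| <= 2^-1 ->
  entropy nu (fun eta => expR (s * capped L m eta)) <=
  2 * c * s ^+ 2 * \int[nu]_eta (capped L m eta * expR (s * capped L m eta)).
Proof.
move=> s2; have [mL bdL] := bL.
have bX := capped_bounded m; have mX := measurable_capped m.
have mE : measurable_fun setT (fun eta => expR (s * capped L m eta)).
  by apply: measurableT_comp => //; exact: measurable_funM.
have mN : measurable_fun setT (fun eta : config R d => (num_points L eta)%:R : R).
  by apply: measurable_natr; exact: measurable_num_points.
pose A := [set eta : config R d | (num_points L eta)%:R <= m%:R :> R].
have mA : measurable A.
  by rewrite -[X in measurable X]setTI; apply: measurable_fun_le.
(* The bound on the integrand as a function of the configuration with the new point. *)
pose u eta : R := 2 * s ^+ 2 * (\1_A eta * expR (s * capped L m eta)).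
have cE : 0 <= 2 * s ^+ 2 by apply: mulr_ge0 => //; exact: sqr_ge0.
have u0 eta : 0 <= u eta by apply: mulr_ge0 => //; rewrite mulr_ge0 ?expR_ge0.
have mu : measurable_fun setT u.
  by apply: measurable_funM => //; apply: measurable_funM.
have bXE : bounded_measurable (fun eta => capped L m eta * expR (s * capped L m eta)).
  apply: bounded_measurableM => //; apply: bounded_measurable_expR.
  exact: bounded_measurableZ.
rewrite -lee_fin; apply: (@le_trans _ _ (c%:E * \int[nu]_eta ((num_points L eta)%:R * u eta)%:E)%E).
  apply: entropy_expR_le => //.
  - split; first exact: measurable_funM.
    exists L => // eta; rewrite /capped num_points_restrict//.
    by rewrite setIid.
  - have [_ [M hM]] := bounded_measurableZ s bX.
    by exists M => eta; apply: le_trans (hM eta); exact: ler_norm.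
  - move=> eta x Lx; rewrite /capped num_points_add// memNset//.
    by rewrite mul0n addn0.
  - move=> eta x Lx; rewrite -mulrBr.
    have [->|ne] := eqVneq (capped L m (config_add eta x)) (capped L m eta).
      by rewrite !subrr mul0r.
    have Nm : (num_points L eta < m)%N.
      rewrite ltnNge; apply: contra ne => mN'.
      rewrite /capped !min_r ?ler_nat// num_points_add//.
      exact: leq_trans (leq_addr _ _).
    have xe : x \notin points eta.
      apply: contra ne => xe; rewrite /capped num_points_add// xe muln0 addn0//.
    have N1 : num_points L (config_add eta x) = (num_points L eta).+1.
      by rewrite num_points_add// mem_set// xe addn1.
    have e1 : capped L m (config_add eta x) - capped L m eta = 1.
      rewrite /capped N1 !min_l ?ler_nat//; last exact: ltnW.
      by rewrite -natr1 addrAC subrr add0r.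
    rewrite /u (_ : \1_A _ = 1 :> R); last by rewrite indicE mem_set// /A/= N1 ler_nat.
    rewrite mulrBr.
    apply: le_trans (@expR_diff_le _ _ 2 _ _ _) _ => //.
    - by move=> _; rewrite ler1n.
    - move=> _; rewrite -mulrBr -opprB e1 mulrN1.
      exact: expRN_le2.
    by rewrite -mulrBr e1 mulr1 mul1r.
have -> : 2 * c * s ^+ 2 = c * (2 * s ^+ 2) by ring.
rewrite -mulrA EFinM; apply: lee_wpmul2l; first by rewrite lee_fin ltW.
rewrite EFinM -expectation_EFin// -ge0_integralZ_lower//; last first.
  by move=> eta; rewrite lee_fin mulr_ge0 ?capped_ge0 ?expR_ge0.
apply: ge0_le_integral_lower => eta; first by rewrite lee_fin mulr_ge0.
rewrite -EFinM lee_fin /u mulrCA ler_wpM2l//.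
have [Ae|Ae] := pselect (A eta).
  by rewrite indicE mem_set// mul1r ler_wpM2r ?expR_ge0// le_min lexx.
by rewrite indicE memNset// mul0r mulr0 mulr_ge0 ?capped_ge0 ?expR_ge0.
Qed.

(** [herbst_linear] with the negative parameter -1/2 bounds the mean of X from
above by a multiple of - ln nu[exp(- X / 2)], which is controlled by the
probability that the count is at most k0. The bound does not depend on m, so
that it passes to the count itself. *)
Lemma capped_mean_le (m k0 : nat) :
  (2^-1%:E <= nu [set eta | (num_points L eta <= k0)%N])%E ->
  \int[nu]_eta capped L m eta <= 2 * (1 + 2 * c) * (k0%:R / 2 + ln 2).
Proof.
move=> hk; have bX := capped_bounded m.
pose s : R := - 2^-1.
have s0 : s != 0 by rewrite oppr_eq0 invr_eq0 pnatr_eq0.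
have := @herbst_linear _ _ _ nu (capped L m) c s bX (ltW c_gt0) s0.
have c0 := c_gt0.
have h1 : 4 * c * s < 1 by rewrite /s; lra.
move=> /(_ h1) h; have {h}h := h _.
have ent t : 0 <= t / s <= 1 -> entropy nu (fun w => expR (t * capped L m w)) <=
    2 * c * t ^+ 2 * \int[nu]_w (capped L m w * expR (t * capped L m w)).
  move=> ts; apply: entropy_capped.
  have : `|t / s| <= 1 by rewrite ger0_norm; case/andP: ts.
  rewrite normf_div ler_pdivrMr ?normr_gt0// mul1r /s normrN (@ger0_norm _ 2^-1)//.
have := h ent.
pose K := [set eta : config R d | (num_points L eta <= k0)%N].
have mK : measurable K.
  rewrite -[X in measurable X]setTI.
  exact: (measurable_num_points bL measurableT (Y := [set n | (n <= k0)%N])).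
pose q : R := - (k0%:R / 2) - ln 2.
have lq : q <= ln (\int[nu]_w expR (s * capped L m w)).
  rewrite -[q]expRK ler_ln ?posrE ?expR_gt0//; last first.
    by apply: expectation_expR_gt0; exact: bounded_measurableZ.
  rewrite -lee_fin -expectation_EFin; last first.
    by apply: bounded_measurable_expR; exact: bounded_measurableZ.
  apply: (@le_trans _ _ ((expR (- (k0%:R / 2)))%:E * nu K)%E).
    rewrite /q expRD expRN lnK ?posrE// EFinM lee_wpmul2l// lee_fin expR_ge0//.
  apply: mul_measure_le_integral => // eta Ke.
  rewrite lee_fin ler_expR /s mulNr lerN2 mulrC ler_pM2r//.
  by rewrite ge_min ler_nat Ke.
move: lq h1; rewrite /s /q; move: (ln (\int[nu]_w _)) (\int[nu]_w capped L m w) (ln 2) (k0%:R : R).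
move=> l E l2 k; nra.
Qed.

(** [herbst_linear] with 4 c s <= 1/2. *)
Lemma capped_exp_le (m : nat) (s : R) : 0 < s <= 2^-1 -> 8 * c * s <= 1 ->
  ln (\int[nu]_eta expR (s * capped L m eta)) <= 2 * s * \int[nu]_eta capped L m eta.
Proof.
move=> /andP[s0 s2] cs; have bX := capped_bounded m.
have sn0 : s != 0 by rewrite gt_eqF.
have h1 : 4 * c * s < 1 by lra.
have := @herbst_linear _ _ _ nu (capped L m) c s bX (ltW c_gt0) sn0 h1.
have ent t : 0 <= t / s <= 1 -> entropy nu (fun w => expR (t * capped L m w)) <=
    2 * c * t ^+ 2 * \int[nu]_w (capped L m w * expR (t * capped L m w)).
  move=> ts; apply: entropy_capped.
  have : `|t / s| <= 1 by rewrite ger0_norm; case/andP: ts.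
  rewrite normf_div ler_pdivrMr ?normr_gt0// mul1r (ger0_norm (ltW s0)).
  by move=> h; exact: le_trans h s2.
move=> /(_ ent).
have E0 : 0 <= \int[nu]_w capped L m w.
  rewrite -[leLHS](expectation_cst nu 0); apply: le_expectation => //.
  - exact: bounded_measurable_cst.
  - by move=> w; exact: capped_ge0.
have l0 : 0 <= ln (\int[nu]_w expR (s * capped L m w)).
  apply: ln_ge0; rewrite -[leLHS](expectation_cst nu 1); apply: le_expectation => //.
  - exact: bounded_measurable_cst.
  - by apply: bounded_measurable_expR; exact: bounded_measurableZ.
  - move=> w; rewrite -expR0 ler_expR mulr_ge0 ?(ltW s0)//; exact: capped_ge0.
move: l0 E0; move: (ln _) (\int[nu]_w capped L m w) => l E l0 E0 h.
have : l * (4 * c * s) <= l * 2^-1 by apply: ler_wpM2l => //; lra.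
lra.
Qed.

(** [entropy_duality] with G the truncated count times s, followed by monotone
convergence in the truncation. *)
Lemma points_tilted_le (H : config R d -> R) (s C : R) : bounded_measurable H -> 0 < s ->
  (forall m, ln (\int[nu]_eta expR (s * capped L m eta)) <= C) ->
  (\int[nu]_eta ((num_points L eta)%:R * expR (H eta))%:E <=
   (s^-1 * (entropy nu (fun eta => expR (H eta)) + (\int[nu]_eta expR (H eta)) * C))%:E)%E.
Proof.
move=> bH s0 hC; have [mH [M HM]] := bH.
apply: integral_le_of_truncation.
- apply: measurable_funM; last exact: measurableT_comp.
  by apply: measurable_natr; exact: measurable_num_points.
- by move=> eta; rewrite mulr_ge0 ?expR_ge0.
(* Where the count exceeds k, already k exp(H) is at least m. *)
move=> m; pose k := (Num.truncn (m%:R * expR M)).+1.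
have bk : bounded_measurable (fun eta => capped L k eta * expR (H eta)).
  apply: bounded_measurableM; first exact: capped_bounded.
  exact: bounded_measurable_expR.
apply: (@le_trans _ _ (\int[nu]_eta (capped L k eta * expR (H eta))%:E)%E).
  apply: ge0_le_integral_lower => eta; rewrite lee_fin.
    by rewrite le_min ler0n mulr_ge0 ?expR_ge0.
  rewrite /capped; have [Nk|kN] := leP ((num_points L eta)%:R : R) k%:R.
    by rewrite ge_min lexx.
  rewrite ge_min; apply/orP; right.
  rewrite -ler_pdivrMr ?expR_gt0// -expRN.
  apply: (@le_trans _ _ (m%:R * expR M)).
    rewrite ler_wpM2l// ler_expR; have := HM eta; rewrite ler_norml => /andP[h _].
    by rewrite lerNl.
  by rewrite ltW// truncnS_gt.
rewrite expectation_EFin// lee_fin -ler_pdivrMl ?invr_gt0// invrK -expectationZ//.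
have bsk : bounded_measurable (fun eta => s * capped L k eta).
  by apply: bounded_measurableZ; exact: capped_bounded.
apply: (@le_trans _ _ (\int[nu]_eta (s * capped L k eta * expR (H eta)))).
  by rewrite le_eqVlt; apply/orP; left; apply/eqP; apply: eq_Rintegral => eta _; rewrite mulrA.
apply: le_trans (entropy_duality nu bsk bH) _; rewrite lerD2l ler_wpM2l//.
exact/ltW/expectation_expR_gt0.
Qed.

End capped.

Lemma num_points_hcube_le n eta :
  (num_points (@hcube R d n) eta)%:R <= \sum_(i <- box d n) (num_points (cell i) eta)%:R :> R.
Proof.
have fA : finite_set (points eta `&` hcube n).
  by apply: finite_points; case: (bounded_borel_hcube R d n).
have := @sum_cells R d (points eta `&` hcube n) n (fun=> 1) fA (@subIsetr _ _ _).
rewrite -card_of_sum// /num_points /card_of => ->.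
apply: ler_sum => j _; rewrite mul1r ler_nat; apply: card_fset_set_le.
  by apply: finite_points; case: (bounded_borel_cell R j).
by move=> y [[ey _] jy].
Qed.

(** [capped_mean_le] for one cell, with k0 a median, bounds the intensity;
translation invariance does the rest. *)
Lemma exists_intensity : exists2 rho : R, 0 <= rho &
  forall n m, \int[nu]_eta capped (hcube n) m eta <= rho * (n + n)%:R ^+ d.
Proof.
have bc i := bounded_borel_cell R (d := d) i.
have mN i : measurable_fun setT (fun eta : config R d => (num_points (cell i) eta)%:R : R).
  by apply: measurable_natr; exact: measurable_num_points.
have [k0 hk] : exists k0, (2^-1%:E <= nu [set eta | (num_points (@cell R d 0) eta <= k0)%N])%E.
  pose F k := [set eta | (num_points (@cell R d 0) eta <= k)%N].
  have mF k : measurable (F k).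
    rewrite -[X in measurable X]setTI.
    exact: (measurable_num_points (bc 0) measurableT (Y := [set n | (n <= k)%N])).
  have h2 : (0 : R) < 2^-1 by rewrite invr_gt0.
  have [k hk] := exists_small_difference nu h2 mF (fun k eta h => leqW h).
  exists k; have UT : \bigcup_m F m = setT.
    apply/seteqP; split=> // eta _; exists (num_points (@cell R d 0) eta) => //.
    exact: leqnn.
  move: hk; rewrite UT setTD.
  have := @probability_setC _ _ _ nu _ (mF k) => ->.
  have : nu (F k) \is a fin_num by exact: fin_num_measure.
  rewrite -/(F k); case: (nu (F k)) => // r _.
  rewrite -EFinB !lee_fin; lra.
pose rho : R := 2 * (1 + 2 * c) * (k0%:R / 2 + ln 2).
have cell0 : (\int[nu]_eta ((num_points (@cell R d 0) eta)%:R)%:E <= rho%:E)%E.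
  apply: integral_le_of_truncation => // m.
  have := capped_mean_le (bc 0) m hk; rewrite -lee_fin -expectation_EFin//.
  exact: capped_bounded.
exists rho.
  by rewrite !mulr_ge0 ?addr_ge0 ?mulr_ge0 ?ln_ge0 ?ler1n// ltW.
move=> n m; have bh := bounded_borel_hcube R d n.
rewrite -lee_fin -expectation_EFin; last exact: capped_bounded.
apply: (@le_trans _ _ (\int[nu]_eta (\sum_(i <- box d n) ((num_points (cell i) eta)%:R)%:E))%E).
  apply: ge0_le_integral_lower => eta; first by rewrite lee_fin capped_ge0.
  rewrite sumEFin lee_fin; apply: le_trans (num_points_hcube_le n eta).
  by rewrite ge_min lexx.
rewrite ge0_integral_sum//; last first.
  by move=> i; apply/measurable_EFinP.
apply: (@le_trans _ _ (\sum_(i <- box d n) rho%:E)%E).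
  apply: lee_sum => i _; apply: le_trans cell0.
  pose f eta : \bar R := ((num_points (@cell R d 0) eta)%:R)%:E.
  have mf : measurable_fun setT f by exact/measurable_EFinP.
  have f0 eta : (0 <= f eta)%E by rewrite lee_fin.
  have := integral_translate nu_ti (ivec R i) mf f0; rewrite /f => <-.
  apply: ge0_le_integral_lower => eta; first by rewrite lee_fin.
  by rewrite num_points_cell_translate add0r.
by rewrite sumEFin big_const_seq count_predT iter_addr_0 card_box lee_fin -natrX mulr_natr.
Qed.

End exponential_moments.

(** * Concentration of the frequency of a local event *)

Section local_events.
Variables (R : realType) (d : nat).
Implicit Types (x y : 'rV[R]_d) (i j : 'rV[int]_d) (eta omega : config R d).
Implicit Types (A B L D : set 'rV[R]_d).

(** True for the generating count events, and stable under complements and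
countable unions. *)
Lemma local_event_restrict L (E : set (config R d)) :
  measurable (E : set (local_config L)) ->
  forall eta, E (config_restrict eta L) <-> E eta.
Proof.
pose G := [set E : set (config R d) | forall eta, E (config_restrict eta L) <-> E eta].
suff h : <<s count_events L >> `<=` G by move=> mE; exact: (h E mE).
apply: smallest_sub.
  split=> [eta|A GA eta|F GF eta]; first by split.
    by rewrite setTD; split=> nA /GA.
  by split=> -[n _ Fn]; exists n => //; apply/GF.
move=> _ [A [bA AL [B ->]]] eta /=.
by rewrite num_points_restrict (_ : L `&` A = A)//; apply/setIidPr.
Qed.

Lemma local_event_add L (E : set (config R d)) eta x :
  measurable (E : set (local_config L)) -> ~ L x -> E (config_add eta x) <-> E eta.
Proof.
move=> mE Lx; rewrite -(local_event_restrict mE) -[X in _ <-> X](local_event_restrict mE).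
suff -> : config_restrict (config_add eta x) L = config_restrict eta L by [].
apply: config_eqP; apply/seteqP; split=> [y [[ey|/= ->]]|y [ey Ly]] //.
by split=> //; left.
Qed.

Lemma measurable_translate_local x L D :
  (forall y, D (y - x) -> L y) ->
  measurable_fun setT (translate x : local_config L -> local_config D).
Proof.
move=> DL; apply: (@measurability _ _ (local_config L) (local_config D) setT (translate x) (count_events D)) => //.
move=> _ [_ [A [bA AD [B ->]]] <-]; rewrite setTI; apply: sub_sigma_algebra.
exists ((fun y => y - x) @^-1` A); split.
- exact: bounded_borel_shift.
- by move=> y /AD /DL.
exists B; apply/seteqP; split=> eta /=; rewrite num_points_translate//; by case: bA.
Qed.

Lemma translate_add x y eta :
  translate x (config_add eta y) = config_add (translate x eta) (y - x).
Proof.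
apply: config_eqP; apply/seteqP; split=> z /=.
  by move=> [w [ew|/= ->] <-]; [left; exists w|right].
by move=> [[w ew <-]|->]; [exists w => //; left|exists y => //; right].
Qed.

Lemma cell_of_shift i x : cell_of (x - ivec R i) = cell_of x - i.
Proof.
apply/rowP => l; rewrite !mxE; apply: floor_def.
have /andP[h1 h2] := floor_itv (x ord0 l).
by move: h2; rewrite !intrD rmorphN/= => h2; rewrite lerD2r h1/= addrAC ltrD2r.
Qed.

(** The translates of a box of size r that contain a given cell are indexed by a
reflected box of size r. *)
Lemma card_box_translate (k : 'rV[int]_d) m r :
  (\sum_(i <- box d m) (k - i \in box d r)%:R : R) <= (r + r)%:R ^+ d.
Proof.
rewrite -natrX -card_box.
pose A := [fset i in box d m | k - i \in box d r]%fset.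
apply: (@le_trans _ _ (#|` A|%:R)).
  rewrite (_ : #|` A|%:R = \sum_(i <- A) (1 : R)); last first.
    by rewrite big_const_seq count_predT iter_addr_0.
  rewrite /A -(big_fset_condE _ _ (fun i => k - i \in box d r))/= [leRHS]big_mkcond/=.
  by apply: ler_sum => i _; case: (_ \in _).
rewrite ler_nat; have <- : #|` [fset k - i | i in A]%fset| = #|` A|.
  by rewrite card_imfset// => a b /addrI /oppr_inj.
apply: fsubset_leq_card; apply/fsubsetP => _ /imfsetP[i /= iA ->].
by move: iA; rewrite !inE => /andP[].
Qed.

End local_events.

Section count_average.
Variables (R : realType) (d : nat) (r : nat) (E : set (config R d)).
Hypothesis mE : measurable (E : set (local_config (@hcube R d r))).
Implicit Types (x : 'rV[R]_d) (i : 'rV[int]_d) (eta : config R d) (n : nat).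

(** The number of lattice translates of E that occur inside the cube of size n. The
translations are restricted to n - r, so that it depends on the points in this
cube only. *)
Definition box_count n eta : R := \sum_(i <- box d (n - r)) \1_E (translate (ivec R i) eta).

Let box_in n x i : i \in box d (n - r) -> hcube r (x - ivec R i) -> hcube n x.
Proof.
rewrite /hcube/= cell_of_shift => /in_boxP h /in_boxP h'; apply/in_boxP => l.
have := h' l; have := h l; rewrite [(_ - i) _ _]mxE [(- i) _ _]mxE.
by move: (cell_of x ord0 l) (i ord0 l) => a b; lia.
Qed.

Lemma measurable_box_count_local n L : @hcube R d n `<=` L ->
  measurable_fun setT (box_count n : local_config L -> R).
Proof.
move=> nL; rewrite /box_count.
rewrite (_ : (fun eta => _) =
  (fun eta : config R d => \sum_(i <- box d (n - r)) (if i \in box d (n - r) then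
    \1_E (translate (ivec R i) eta) else 0 : R))); last first.
  by apply/funext => eta; apply: eq_big_seq => i ->.
apply: measurable_sum => i; have [ib|ib] := boolP (i \in box d (n - r)); last exact: measurable_cst.
have m1 : measurable_fun setT (\1_E : local_config (@hcube R d r) -> R) by exact: measurable_indic.
apply: (measurableT_comp m1); apply: measurable_translate_local => y h.
exact/nL/(box_in ib).
Qed.

Lemma measurable_box_count n : measurable_fun setT (box_count n : config R d -> R).
Proof.
have h := measurable_box_count_local (L := setT) (@subsetT _ (@hcube R d n)).
by move=> _ B mB; have := h measurableT B mB.
Qed.

Lemma box_count_bounds n eta : 0 <= box_count n eta <= ((n - r) + (n - r))%:R ^+ d.
Proof.
apply/andP; split; first by apply: sumr_ge0.
rewrite -natrX -card_box; apply: (@le_trans _ _ (\sum_(i <- box d (n - r)) (1 : R))).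
  by apply: ler_sum => i _; rewrite indicE; case: (_ \in _).
by rewrite big_const_seq count_predT iter_addr_0.
Qed.

Lemma bounded_box_count n : bounded_measurable (box_count n : config R d -> R).
Proof.
split; first exact: measurable_box_count.
exists (((n - r) + (n - r))%:R ^+ d) => eta; have /andP[h1 h2] := box_count_bounds n eta.
by rewrite ger0_norm.
Qed.

Lemma box_count_local n : is_local (box_count n : config R d -> R).
Proof.
split; first exact: measurable_box_count.
exists (hcube n) => [|eta]; first exact: bounded_borel_hcube.
apply: eq_big_seq => i ib; rewrite !indicE; congr (nat_of_bool _)%:R.
apply: asbool_equiv_eq; rewrite -(local_event_restrict mE) -[X in _ <-> X](local_event_restrict mE).
suff -> : config_restrict (translate (ivec R i) eta) (hcube r) =
  config_restrict (translate (ivec R i) (config_restrict eta (hcube n))) (hcube r) by [].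
apply: config_eqP; apply/seteqP; split=> _ [[y /= ey <-] h]; split=> //; exists y => //.
  by split=> //; exact: box_in ib _.
by case: ey.
Qed.

Lemma box_count_add_out n eta x : ~ hcube n x -> box_count n (config_add eta x) = box_count n eta.
Proof.
move=> nx; apply: eq_big_seq => i ib; rewrite translate_add !indicE; congr (nat_of_bool _)%:R.
by apply: asbool_equiv_eq; apply: local_event_add mE _ => h; apply: nx; exact: box_in ib _.
Qed.

(** Only the translates of E whose window contains x can change. *)
Lemma box_count_lipschitz n eta x :
  `|box_count n (config_add eta x) - box_count n eta| <= (r + r)%:R ^+ d.
Proof.
rewrite /box_count -sumrB; apply: le_trans (ler_norm_sum _ _ _) _.
apply: (@le_trans _ _ (\sum_(i <- box d (n - r)) (cell_of x - i \in box d r)%:R)); last first.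
  exact: card_box_translate.
apply: ler_sum => i _; rewrite translate_add.
have [h|h] := boolP (cell_of x - i \in box d r).
  by rewrite !indicE; case: (_ \in _); case: (_ \in _); rewrite ?subrr ?subr0 ?sub0r ?normrN ?normr1 ?normr0.
suff -> : \1_E (config_add (translate (ivec R i) eta) (x - ivec R i)) =
    \1_E (translate (ivec R i) eta) :> R by rewrite subrr normr0.
rewrite !indicE; congr (nat_of_bool _)%:R; apply: asbool_equiv_eq.
apply: local_event_add mE _; rewrite /hcube/= cell_of_shift; exact/negP.
Qed.

Lemma expectation_box_count (nu : probability (config R d) R) n : translation_invariant nu ->
  \int[nu]_eta box_count n eta = ((n - r) + (n - r))%:R ^+ d * fine (nu E).
Proof.
move=> ti; have mE' : measurable E by exact: measurable_local_config mE.
apply: EFin_inj; rewrite -expectation_EFin; last exact: bounded_box_count.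
under eq_integral do rewrite /box_count -sumEFin.
have m1 i : measurable_fun setT (fun eta : config R d => (\1_E (translate (ivec R i) eta) : R)%:E).
  apply/measurable_EFinP; apply: measurableT_comp; last exact: measurable_translate.
  exact: measurable_indic.
rewrite ge0_integral_sum//.
rewrite (eq_bigr (fun=> (fine (nu E))%:E)) => [|i _].
  by rewrite sumEFin big_const_seq count_predT iter_addr_0 card_box -natrX mulr_natl.
rewrite (integral_translate ti (ivec R i) (f := fun eta => (\1_E eta : R)%:E)); last 2 first.
- by apply/measurable_EFinP; exact: measurable_indic.
- by move=> eta; rewrite lee_fin.
by rewrite integral_indic// setIT fineK//; exact: fin_num_measure.
Qed.

End count_average.

Section concentration.
Variables (R : realType) (d : nat) (phi : 'rV[R]_d -> R) (c : R).
Variable nu : probability (config R d) R.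
Hypothesis c_gt0 : 0 < c.
Hypothesis nu_ti : translation_invariant nu.
Hypothesis nu_mlsi : mlsi_birth phi nu c.
Hypothesis nu_gnz : forall L (v : config R d -> R), bounded_borel L ->
  measurable_fun setT v -> (forall eta, 0 <= v eta) ->
  (\int[nu]_eta \int[lebesgue_rV R d]_x (birth_rate phi x eta * \1_L x * v (config_add eta x))%:E <=
   \int[nu]_eta ((num_points L eta)%:R * v eta)%:E)%E.
Variables (r : nat) (E : set (config R d)).
Hypothesis mE : measurable (E : set (local_config (@hcube R d r))).

Let F n : config R d -> R := box_count r E n.

(** Adding a point changes l F_n by at most l (2r)^d <= 1, and exp(1) <= 4. *)
Let entropy_count n (l : R) : 0 < l -> l * (r + r)%:R ^+ d <= 1 ->
  ((entropy nu (fun eta => expR (l * F n eta)))%:E <=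
   (4 * c * (l * (r + r)%:R ^+ d) ^+ 2)%:E *
   \int[nu]_eta ((num_points (hcube n) eta)%:R * expR (l * F n eta))%:E)%E.
Proof.
move=> l0 lK; set K : R := (r + r)%:R ^+ d in lK *.
have K0 : 0 <= K by exact: exprn_ge0.
have bF := bounded_box_count mE n; have [mF [M FM]] := bF.
have bl : bounded_measurable (fun eta => l * F n eta) by exact: bounded_measurableZ.
have [ml [M' hM']] := bl.
pose k : R := 4 * (l * K) ^+ 2; have k0 : 0 <= k by rewrite mulr_ge0// sqr_ge0.
pose u eta := k * expR (l * F n eta).
have u0 eta : 0 <= u eta by rewrite mulr_ge0 ?expR_ge0.
have mu : measurable_fun setT u by apply: measurable_funM => //; exact: measurableT_comp.
have [_ [L bL FL]] := box_count_local mE n.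
apply: (@le_trans _ _ (c%:E * \int[nu]_eta ((num_points (hcube n) eta)%:R * u eta)%:E)%E).
  apply: (@entropy_expR_le R d phi c nu c_gt0 nu_mlsi nu_gnz _ u (hcube n)) => //.
  - exact: bounded_borel_hcube.
  - by split=> //; exists L => // eta; rewrite /F FL.
  - by exists M' => eta; apply: le_trans (hM' eta); exact: ler_norm.
  - by move=> eta x nx; rewrite /F box_count_add_out.
  - move=> eta x _; set a := l * F n (config_add eta x); set b := l * F n eta.
    have ab : `|a - b| <= l * K.
      rewrite /a /b -mulrBr normrM (ger0_norm (ltW l0)) ler_wpM2l ?(ltW l0)//.
      exact: box_count_lipschitz.
    apply: (@le_trans _ _ (4 * (a - b) ^+ 2 * expR a)).
      apply: expR_diff_le => // [_|_]; first by rewrite ler1n.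
      apply: (@le_trans _ _ (expR (2^-1 + 2^-1))).
        have -> : 2^-1 + 2^-1 = 1 :> R by lra.
        rewrite ler_expR; apply: le_trans lK; apply: le_trans ab.
        by rewrite distrC ler_norm.
      rewrite expRD; have h2 : (2^-1 : R) <= 2^-1 by [].
      have := expR_le_quad h2; have := expR_ge0 (2^-1 : R).
      move: (expR _) => e e0 he; rewrite (_ : 4 = 2 * 2); last by ring.
      apply: ler_pM => //; lra.
    rewrite /u ler_wpM2r ?expR_ge0// /k ler_wpM2l// -[leLHS]real_normK ?num_real//.
    by rewrite lerXn2r ?nnegrE// mulr_ge0 ?(ltW l0).
rewrite (_ : 4 * c * (l * K) ^+ 2 = c * k); last by rewrite /k; ring.
rewrite EFinM -muleA lee_wpmul2l//; first by rewrite lee_fin ltW.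
rewrite -ge0_integralZ_lower//.
apply: ge0_le_integral_lower => eta; first by rewrite lee_fin mulr_ge0.
by rewrite -EFinM lee_fin /u mulrCA.
Qed.

(** The entropy occurs on both sides of the bound because of [entropy_duality]; for
a <= 1/2 the one on the right is absorbed. *)
Let absorb (a e B D : R) : 0 <= a -> a <= 2^-1 -> 0 <= B * D ->
  e <= a * (e + B * D) -> e <= 2 * a * D * B.
Proof.
move=> a0 a2 BD; rewrite (_ : 2 * a * D * B = 2 * (a * (B * D))); last by ring.
have aBD : 0 <= a * (B * D) by rewrite mulr_ge0.
rewrite mulrDr; move: aBD; move: (a * (B * D)) => X X0 h.
have [e0|e0] := leP e 0; first by apply: le_trans e0 _; lra.
have : a * e <= 2^-1 * e by rewrite ler_pM2r.
lra.
Qed.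

(** Chaining [entropy_count], [points_tilted_le] and [absorb] gives an entropy
bound by K t^2 E[exp(t F_n)] with K proportional to the volume, to which
[herbst] applies. The exponent s makes the exponential moments of the number of
points available, and l0 makes the factor in [absorb] at most 1/2. *)
Lemma box_count_concentration : exists l0 C : R, [/\ 0 < l0, 0 <= C &
  forall n l, 0 < l <= l0 -> ln (\int[nu]_eta expR (l * F n eta)) <=
    l * (((n - r) + (n - r))%:R ^+ d * fine (nu E)) + C * l ^+ 2 * (n + n)%:R ^+ d].
Proof.
have [rho rho0 hrho] := exists_intensity c_gt0 nu_ti nu_mlsi nu_gnz.
have c0 := c_gt0.
pose K : R := (r + r)%:R ^+ d; have K0 : 0 <= K by exact: exprn_ge0.
(* Small enough for [capped_exp_le]. *)
pose s : R := (2 + 8 * c)^-1.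
have s0 : 0 < s by rewrite invr_gt0; lra.
have s2 : s <= 2^-1 by rewrite lef_pV2 ?posrE//; lra.
have cs : 8 * c * s <= 1 by rewrite ler_pdivrMr; lra.
(* The first bound is the one in [entropy_count], the second gives a <= 1/2 below;
   K + 1 replaces K, which may be 0. *)
pose l0 : R := Num.min (K + 1)^-1 (s / (8 * c * (K + 1))).
have K1 : 0 < K + 1 by lra.
have l00 : 0 < l0 by rewrite lt_min invr_gt0 K1/= divr_gt0// !mulr_gt0.
exists l0, (32 * c * K ^+ 2 * rho); split=> //.
  by rewrite !mulr_ge0// ?ltW// sqr_ge0.
move=> n l /andP[lgt lle].
have bF := bounded_box_count mE n.
have N0 : 0 <= (n + n)%:R ^+ d :> R by exact: exprn_ge0.
pose KH : R := 16 * c * K ^+ 2 * rho * (n + n)%:R ^+ d.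
have KH0 : 0 <= KH by rewrite /KH; do ![apply: mulr_ge0 => //]; rewrite ?ltW ?sqr_ge0.
have ent : forall t : R, 0 < t <= l0 -> entropy nu (fun w => expR (t * F n w)) <=
    KH * t ^+ 2 * \int[nu]_w expR (t * F n w).
  move=> t /andP[t0 tl].
  have tK1 : t * (K + 1) <= 1.
    by rewrite -ler_pdivlMr// mul1r; move: tl; rewrite le_min => /andP[].
  have tK : t * K <= 1 by apply: le_trans tK1; rewrite ler_wpM2l ?(ltW t0)// lerDl.
  have ts : 8 * c * (t * (K + 1)) <= s.
    have : t <= s / (8 * c * (K + 1)) by move: tl; rewrite le_min => /andP[].
    by rewrite ler_pdivlMr ?mulr_gt0// mulrCA.
  have := entropy_count n t0 tK; rewrite -/K => h.
  have bH : bounded_measurable (fun eta => t * F n eta) by exact: bounded_measurableZ.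
  have hm m : ln (\int[nu]_eta expR (s * capped (hcube n) m eta)) <=
      2 * s * (rho * (n + n)%:R ^+ d).
    have s12 : 0 < s <= 2^-1 by rewrite s0.
    have bh := bounded_borel_hcube R d n.
    apply: le_trans (@capped_exp_le R d phi c nu c_gt0 nu_mlsi nu_gnz _ bh m s s12 cs) _.
    by rewrite ler_wpM2l ?mulr_ge0 ?(ltW s0)//; exact: hrho.
  have := points_tilted_le (bounded_borel_hcube R d n) bH s0 hm.
  set e := entropy nu _ in h *; set B := \int[nu]_w _ => h2.
  have B0 : 0 < B by exact: expectation_expR_gt0.
  pose a : R := 4 * c * (t * K) ^+ 2 / s.
  have a0 : 0 <= a by rewrite /a divr_ge0 ?(ltW s0)// mulr_ge0 ?sqr_ge0//; lra.
  have a2 : a <= 2^-1.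
    rewrite /a ler_pdivrMr//.
    have : (t * K) ^+ 2 <= t * (K + 1).
      rewrite expr2; apply: (@le_trans _ _ (1 * (t * K))).
        by rewrite ler_wpM2r// mulr_ge0 ?(ltW t0).
      by rewrite mul1r ler_wpM2l ?(ltW t0)// lerDl.
    move=> /(@ler_wpM2l _ (8 * c)); rewrite mulr_ge0 ?(ltW c0)// => /(_ isT) h3.
    move: (le_trans h3 ts); lra.
  have h4 : e <= a * (e + B * (2 * s * (rho * (n + n)%:R ^+ d))).
    rewrite -lee_fin; apply: le_trans h _.
    have -> : a * (e + B * (2 * s * (rho * (n + n)%:R ^+ d))) = 4 * c * (t * K) ^+ 2 *
       (s^-1 * (e + B * (2 * s * (rho * (n + n)%:R ^+ d)))) by rewrite /a -mulrA.
    rewrite [leRHS]EFinM; apply: lee_wpmul2l => //.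
    by rewrite lee_fin mulr_ge0 ?sqr_ge0//; lra.
  have := absorb a0 a2 _ h4; move=> /(_ _)/le_trans; apply.
    by rewrite !mulr_ge0// ?(ltW B0)// ?(ltW s0).
  rewrite le_eqVlt; apply/orP; left; apply/eqP; rewrite /a /KH.
  by field; rewrite gt_eqF.
have hl : 0 < l <= l0 by rewrite lgt.
have := herbst bF KH0 ent hl; rewrite expectation_box_count//.
move=> /le_trans; apply; rewrite lerD2l /KH le_eqVlt; apply/orP; left; apply/eqP; ring.
Qed.

End concentration.

Section rate.
Variables (R : realType) (d r : nat).
Let V n : R := (n + n)%:R ^+ d.
Let W n : R := ((n - r) + (n - r))%:R ^+ d.

Lemma inner_volume_ge n : (r + r <= n)%N -> V n * 2^-1 ^+ d <= W n.
Proof.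
move=> rn; rewrite /V /W -exprMn; apply: lerXn2r; rewrite ?nnegrE ?mulr_ge0//.
have h : (n + n <= ((n - r) + (n - r)) * 2)%N by rewrite muln2 -addnn; lia.
by rewrite ler_pdivrMr// -natrM ler_nat.
Qed.

Let rate_arith (l dl v w p q C : R) : v * (l * dl) / 2 <= l * (q - p) / 2 * w ->
  v * (l * (C * l)) <= v * (l * (dl / 4)) ->
  l * (w * p) + C * l ^+ 2 * v + l * (dl / 4) * v <= l * ((p + q) / 2 * w).
Proof. lra. Qed.

(** The gain is linear in l and the loss quadratic, both at volume scale; so for
small l the gain dominates. This single choice of l serves the entropy bound and
the large deviation bound. *)
Lemma exists_rate (p q l0 C : R) : p < q -> 0 < l0 -> 0 <= C ->
  exists l k : R, [/\ 0 < l <= l0, 0 < k & forall n, (r + r <= n)%N ->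
    l * (W n * p) + C * l ^+ 2 * V n + k * V n <= l * ((p + q) / 2 * W n)].
Proof.
move=> pq l00 C0; pose dl : R := (q - p) * 2^-1 ^+ d.
have dl0 : 0 < dl by rewrite mulr_gt0 ?subr_gt0// exprn_gt0// invr_gt0.
have C1 : 0 < C + 1 by rewrite ltr_wpDl.
pose l : R := Num.min l0 (dl / (4 * (C + 1))).
have lgt : 0 < l by rewrite lt_min l00/= divr_gt0// mulr_gt0.
have lC : C * l <= dl / 4.
  have : l <= dl / (4 * (C + 1)) by rewrite ge_min lexx orbT.
  by rewrite ler_pdivlMr ?mulr_gt0// => h; move: lgt C0 h; clearbody l; nra.
exists l, (l * (dl / 4)); split; first by rewrite lgt ge_min lexx.
  by rewrite mulr_gt0// divr_gt0.
move=> n rn; have V0 : 0 <= V n by rewrite exprn_ge0.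
have h1 : l * (q - p) / 2 * (V n * 2^-1 ^+ d) <= l * (q - p) / 2 * W n.
  apply: ler_wpM2l; last exact: inner_volume_ge.
  by rewrite mulr_ge0// mulr_ge0 ?(ltW lgt)// subr_ge0 ltW.
have h2 : V n * (l * (C * l)) <= V n * (l * (dl / 4)).
  by apply: ler_wpM2l => //; apply: ler_wpM2l => //; exact: ltW.
have h3 : l * (q - p) / 2 * (V n * 2^-1 ^+ d) = V n * (l * dl) / 2 by rewrite /dl; ring.
by rewrite h3 in h1; exact: rate_arith h1 h2.
Qed.

End rate.

(** * Positivity of the specific relative entropy *)

Section donsker_varadhan.
Context d (T : measurableType d) (R : realType) (P Q : probability T R).

Lemma density_young (y g : R) : 0 <= y -> y * g + y - expR g <= xlnx y.
Proof.
rewrite le_eqVlt => /orP[/eqP<-|y0]; first by rewrite /xlnx !mul0r add0r sub0r oppr_le0 expR_ge0.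
have := young_xlnx (ln y) g; rewrite lnK ?posrE// /xlnx [ln y * y]mulrC.
rewrite [g * y]mulrC; move: (expR g) (ln y) (y * g) (y * ln y) => a b c e; lra.
Qed.

(** The Donsker-Varadhan inequality: [density_young] with g = G - ln Q[exp G], where
exp g has expectation 1, integrated against Q. *)
Lemma relative_entropy_ge (G : T -> R) : bounded_measurable G -> (forall w, 0 <= G w) ->
  ((\int[P]_w G w - ln (\int[Q]_w expR (G w)))%:E <= relative_entropy P Q)%E.
Proof.
move=> bG G0; rewrite /relative_entropy; case: pselect => [dens|_]; last by rewrite leey.
case: (cid dens) => f /= [mf f0 Pf]; have [mG [M GM]] := bG.
pose A : R := ln (\int[Q]_w expR (G w)).
have bE : bounded_measurable (fun w => expR (G w)) by exact: bounded_measurable_expR.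
have EA : \int[Q]_w expR (G w - A) = 1.
  under eq_Rintegral do rewrite expRD mulrC.
  rewrite expectationZ// expRN lnK ?posrE; last exact: expectation_expR_gt0.
  by rewrite mulVf// gt_eqF//; exact: expectation_expR_gt0.
have PE (g : T -> R) : measurable_fun setT g -> (forall w, 0 <= g w) ->
    (\int[P]_w (g w)%:E = \int[Q]_w ((f w)%:E * (g w)%:E))%E.
  move=> mg g0; rewrite -(ge0_integral_density Q mf f0)//; last exact/measurable_EFinP.
  by apply: eq_measure_integral => E mE _; exact: Pf.
have intf : (\int[Q]_w (f w)%:E = 1)%E.
  have := Pf setT measurableT; rewrite (_ : P setT = 1%E); last exact: (probability_setT P).
  by move=> <-.
have intfG : (\int[Q]_w (f w * G w)%:E = (\int[P]_w G w)%:E)%E.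
  by rewrite -expectation_EFin// PE.
have i1 : Q.-integrable setT (EFin \o f).
  apply/integrableP; split; first exact/measurable_EFinP.
  under eq_integral do rewrite /= ger0_norm//.
  by rewrite intf ltry.
have mfG : measurable_fun setT (fun w => f w * G w) by exact: measurable_funM.
have i2 : Q.-integrable setT (EFin \o (fun w => f w * G w)).
  apply/integrableP; split; first exact/measurable_EFinP.
  under eq_integral do rewrite /= ger0_norm ?mulr_ge0//.
  by rewrite intfG ltry.
have bEA : bounded_measurable (fun w => expR (G w - A)).
  apply: bounded_measurable_expR; apply: bounded_measurableD => //.
  exact: bounded_measurable_cst.
have i3 := bounded_measurable_integrable Q bEA.
pose h w : R := f w * G w + (1 - A) * f w - expR (G w - A).
have i4 : Q.-integrable setT (EFin \o (fun w => (1 - A) * f w)).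
  have := integrableZl measurableT (1 - A) i1.
  by apply: eq_integrable => // w _ /=; rewrite EFinM.
have i5 : Q.-integrable setT (EFin \o (fun w => f w * G w + (1 - A) * f w)).
  by have := integrableD measurableT i2 i4; apply: eq_integrable.
have i6 : Q.-integrable setT (EFin \o h).
  by have := integrableB measurableT i5 i3; apply: eq_integrable.
have -> : (\int[P]_w G w - A)%:E = (\int[Q]_w (h w)%:E)%E.
  transitivity ((\int[Q]_w h w)%:E); last first.
    by rewrite /Rintegral fineK//; exact: integrable_fin_num i6.
  congr EFin; rewrite /h RintegralB// RintegralD// EA RintegralZl//.
  have -> : \int[Q]_x (f x * G x) = \int[P]_w G w by rewrite {1}/Rintegral intfG.
  have -> : \int[Q]_x f x = 1 by rewrite /Rintegral intf.
  lra.
apply: le_integral_of_integrable => //.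
  apply/measurable_EFinP; apply: measurable_funM => //; apply: measurableT_comp => //.
move=> w; rewrite lee_fin; apply: le_trans (density_young (G w - A) (f0 w)).
rewrite le_eqVlt; apply/orP; left; apply/eqP; rewrite /h; ring.
Qed.

End donsker_varadhan.

Section specific_entropy.
Variables (R : realType) (d : nat).
Implicit Types (mu nu : probability (config R d) R).

(** On sets of the smaller sigma-algebra the restriction is the image of mu under
the identity. *)
Lemma expectation_restriction mu (L : set 'rV[R]_d) (G : config R d -> R) :
  measurable_fun setT (G : local_config L -> R) -> (forall w, 0 <= G w) ->
  \int[restriction L mu]_w G w = \int[mu]_w G w.
Proof.
move=> mG G0; rewrite /Rintegral; congr fine.
have mid : measurable_fun setT (id : config R d -> local_config L).
  by move=> _ B mB; rewrite setTI; exact: measurable_local_config mB.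
transitivity (\int[pushforward mu (id : config R d -> local_config L)]_w (G w)%:E)%E.
  by apply: eq_measure_integral.
rewrite ge0_integral_pushforward//; first exact/measurable_EFinP.
by move=> w _; rewrite lee_fin.
Qed.

(** Count events determine the law. If the one that separates the laws has the wrong
sign, its complement has the right one, and both are local. *)
Lemma exists_separating_event mu nu : ~ same_law mu nu ->
  exists (r : nat) (E : set (config R d)),
    [/\ (0 < r)%N, measurable (E : set (local_config (@hcube R d r))) & fine (nu E) < fine (mu E)].
Proof.
move=> ne.
have [E [[J [a [v [ba ->]]]] mne]] : exists E, count_system E /\ mu E <> nu E.
  apply: contrapT => h; apply: ne => E mE.
  apply: (@config_measure_unique R d mu nu _ _ E mE).
    by rewrite [X in (X < _)%E](_ : _ = 1%E) ?ltry//; exact: (probability_setT mu).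
  by move=> B cB; apply: contrapT => hB; apply: h; exists B.
have /choice[n hn] j : exists n, a j `<=` @cube R d n.
  by apply: bounded_subset_cube; case: (ba j).
pose r := (\max_j n j).+1.
have ar j : a j `<=` hcube r.
  move=> x /hn /cube_subset_hcube; apply: hcube_le; rewrite ltnS.
  exact: (leq_bigmax (F := n)).
have mC : measurable (count_event a v : set (local_config (@hcube R d r))).
  rewrite (_ : count_event a v = \bigcap_(j in [set: J]) (num_points (a j) @^-1` [set v j])).
    apply: fin_bigcap_measurable => // j _; apply: sub_sigma_algebra.
    by exists (a j); split=> //; exists [set v j].
  by apply/seteqP; split=> [eta h i _|eta h i]; [exact: h|exact: h i I].
have f1 : mu (count_event a v) \is a fin_num by apply: fin_num_measure; exact: measurable_count_event.
have f2 : nu (count_event a v) \is a fin_num by apply: fin_num_measure; exact: measurable_count_event.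
have [lt|lt|eq] := ltgtP (fine (nu (count_event a v))) (fine (mu (count_event a v))).
- by exists r, (count_event a v).
- exists r, (~` count_event a v); split=> //; first exact: measurableC.
  have mE' := measurable_count_event v ba.
  rewrite !probability_setC// !fineB//; lra.
- by case: mne; rewrite -(fineK f1) -(fineK f2) eq.
Qed.

Lemma limn_einf_ge (u : nat -> \bar R) (k : \bar R) N :
  (forall n, (N <= n)%N -> (k <= u n)%E) -> (k <= limn_einf u)%E.
Proof.
move=> h; rewrite limn_einf_lim; apply: lime_ge; first exact: is_cvg_einfs.
exists N => // n /= Nn; apply: le_ereal_inf_tmp => _ [p /= np <-].
by apply: h; exact: leq_trans Nn np.
Qed.

(** The test function l F_n gives a lower bound k (2n)^d for the relative
entropy in the cube, with the k of [exists_rate]. *)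
Lemma specific_relative_entropy_gt0 mu nu (r : nat) (E : set (config R d)) (l0 C : R) :
  translation_invariant mu -> (0 < r)%N ->
  measurable (E : set (local_config (@hcube R d r))) ->
  fine (nu E) < fine (mu E) -> 0 < l0 -> 0 <= C ->
  (forall n l, 0 < l <= l0 -> ln (\int[nu]_eta expR (l * box_count r E n eta)) <=
    l * (((n - r) + (n - r))%:R ^+ d * fine (nu E)) + C * l ^+ 2 * (n + n)%:R ^+ d) ->
  (0 < specific_relative_entropy mu nu)%E.
Proof.
move=> ti r0 mE lt l00 C0 conc.
have [l [k [ll0 k0 rate]]] := exists_rate d r lt l00 C0.
have lgt : 0 < l by case/andP: ll0.
apply: (@lt_le_trans _ _ k%:E); first by rewrite lte_fin.
apply: (@limn_einf_ge _ _ (r + r)) => n rn.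
have n0 : (0 < n)%N by apply: leq_trans rn; rewrite addn_gt0 r0.
have V0 : 0 < (n + n)%:R ^+ d :> R by rewrite exprn_gt0// ltr0n addn_gt0 n0.
have VE : volume (@cube R d n) = (n + n)%:R ^+ d by rewrite volume_cube mulr2n natrD.
rewrite VE lee_pdivlMl//.
have bF := bounded_box_count mE n; have [mF [M FM]] := bF.
pose G eta : R := l * box_count r E n eta.
have G0 eta : 0 <= G eta.
  by rewrite mulr_ge0 ?(ltW lgt)//; case/andP: (box_count_bounds r E n eta).
have mGl : measurable_fun setT (G : local_config (@cube R d n) -> R).
  apply: measurable_funM => //; apply: measurable_box_count_local => //.
  exact: hcube_subset.
have bGl : bounded_measurable (G : local_config (@cube R d n) -> R).
  split=> //; have [_ [M' hM']] := bounded_measurableZ l bF; by exists M'.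
apply: le_trans (relative_entropy_ge _ _ bGl G0); rewrite lee_fin.
rewrite !expectation_restriction//; last exact: (measurableT_comp (@measurable_expR R) mGl).
rewrite expectationZ// (expectation_box_count mE n ti).
have W0 : 0 <= ((n - r) + (n - r))%:R ^+ d :> R by rewrite exprn_ge0.
move: (conc n l ll0) (rate n rn); rewrite /G.
have : l * ((fine (nu E) + fine (mu E)) / 2 * ((n - r) + (n - r))%:R ^+ d) <=
    l * (((n - r) + (n - r))%:R ^+ d * fine (mu E)).
  rewrite ler_wpM2l ?(ltW lgt)// mulrC ler_wpM2l//; lra.
by move: (ln _) => z; lra.
Qed.

End specific_entropy.

(** * Energy of interaction across a shell *)

Section boundary.
Variables (R : realType) (d : nat) (psi : R -> R).
Hypothesis psi_ge0 : forall r : R, 0 <= r -> 0 <= psi r.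
Variables n m : nat.
Implicit Types (i j : 'rV[int]_d) (eta omega zeta : config R d) (M : nat).
Implicit Types (X Y : set 'rV[R]_d) (x y : 'rV[R]_d).

(** Bounds psi between a point in the cell i and a point in the cell j outside the
inner cube. *)
Definition boundary_weight i j : R :=
  if j \in box d n then 0 else Psi psi (inorm (j - i)).

(** By a b <= (a^2 + b^2) / 2, twice the interaction through psi of the points in the
larger cube with those outside the smaller one is at most this sum. Squares
of counts in place of products have bounded expectations, and their
monotonicity and additivity separate the contribution of the inside from
that of the outside. *)
Definition boundary_sum M omega : R :=
  \sum_(i <- box d (n + m)) \sum_(j <- box d M) boundary_weight i j *
    ((num_points (cell i) omega)%:R ^+ 2 + (num_points (cell j) omega)%:R ^+ 2).

(** Boxes of arbitrary size M exhaust the cells outside the smaller cube. *)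
Definition decoupled (t : R) : set (config R d) :=
  [set omega | forall M, boundary_sum M omega <= t].

Lemma boundary_weight_ge0 i j : 0 <= boundary_weight i j.
Proof. by rewrite /boundary_weight; case: ifP => // _; exact: Psi_ge0. Qed.

Let w0 := boundary_weight_ge0.

Lemma measurable_boundary_sum M : measurable_fun setT (boundary_sum M).
Proof.
have mN i : measurable_fun setT (fun omega : config R d => (num_points (cell i) omega)%:R ^+ 2 : R).
  apply: measurable_funX; apply: measurable_natr; apply: measurable_num_points.
  exact: bounded_borel_cell.
apply: measurable_sum => i; apply: measurable_sum => j; apply: measurable_funM => //.
exact: measurable_funD.
Qed.

Lemma measurable_decoupled t : measurable (decoupled t).
Proof.
rewrite (_ : decoupled t = \bigcap_M [set omega | boundary_sum M omega <= t]).
  apply: bigcap_measurable => [|M _]; first by exists 0%N.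
  rewrite -[X in measurable X]setTI; apply: measurable_fun_le => //.
  exact: measurable_boundary_sum.
by apply/seteqP; split=> [omega h M _|omega h M]; [exact: h|exact: (h M I)].
Qed.

Lemma boundary_sum_le omega zeta M :
  (forall i, (num_points (cell i) omega <= num_points (cell i) zeta)%N) ->
  boundary_sum M omega <= boundary_sum M zeta.
Proof.
move=> h; apply: ler_sum => i _; apply: ler_sum => j _; rewrite ler_wpM2l//.
by rewrite lerD// lerXn2r ?nnegrE// ler_nat.
Qed.

Lemma boundary_sum_split omega eta zeta M :
  (forall i, num_points (cell i) zeta = (num_points (cell i) eta + num_points (cell i) omega)%N /\
     (num_points (cell i) eta = 0%N \/ num_points (cell i) omega = 0%N)) ->
  boundary_sum M zeta = boundary_sum M eta + boundary_sum M omega.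
Proof.
move=> h; have sq i : (num_points (cell i) zeta)%:R ^+ 2 = (num_points (cell i) eta)%:R ^+ 2 +
    (num_points (cell i) omega)%:R ^+ 2 :> R.
  by have [-> [->|->]] := h i; rewrite ?add0n ?addn0 expr0n/= ?add0r ?addr0.
rewrite /boundary_sum -big_split/=; apply: eq_bigr => i _.
rewrite -big_split/=; apply: eq_bigr => j _; rewrite -mulrDr; congr (_ * _).
by rewrite !sq addrACA.
Qed.

Lemma boundary_sum_ge0 M omega : 0 <= boundary_sum M omega.
Proof.
by do 2 (apply: sumr_ge0 => ? _); rewrite mulr_ge0// addr_ge0 ?sqr_ge0.
Qed.

Hypothesis psi_anti : forall r s : R, 0 <= r -> r <= s -> psi s <= psi r.

(** The points are grouped by cells, and psi at the distance of two points is replaced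
by its bound for their cells. *)
Lemma cross_psi_le X Y M : finite_set X -> finite_set Y ->
  X `<=` hcube (n + m) -> Y `<=` hcube M -> Y `&` hcube n = set0 ->
  \sum_(x \in X) \sum_(y \in Y) psi (enorm (x - y)) <=
  \sum_(i <- box d (n + m)) \sum_(j <- box d M) boundary_weight i j *
    ((card_of (X `&` cell i))%:R * (card_of (Y `&` cell j))%:R).
Proof.
move=> fX fY XD YM Yn.
apply: (@le_trans _ _ (\sum_(x \in X) \sum_(j <- box d M)
    boundary_weight (cell_of x) j * (card_of (Y `&` cell j))%:R)).
  apply: ler_fsumr => // x Xx.
  rewrite -(@sum_cells R d Y M (boundary_weight (cell_of x)))//.
  apply: ler_fsumr => // y Yy; rewrite /boundary_weight ifF.
    by apply: psi_anti => //; exact: cell_dist.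
  apply/negbTE/negP => yn; suff : (Y `&` hcube n) y by rewrite Yn.
  by [].
rewrite (@sum_cells R d X (n + m) (fun i => \sum_(j <- box d M)
    boundary_weight i j * (card_of (Y `&` cell j))%:R))//.
rewrite le_eqVlt; apply/orP; left; apply/eqP; apply: eq_bigr => i _.
by rewrite mulr_suml; apply: eq_bigr => j _; rewrite -mulrA [(card_of _)%:R * _]mulrC.
Qed.

Variables (phi : 'rV[R]_d -> R) (r0 b : R).
Hypothesis phi_even : forall x, phi (- x) = phi x.
Hypothesis phi_lower : forall x, - psi (enorm x) <= phi x.
Hypothesis phi_upper : forall x, r0 <= enorm x -> phi x <= psi (enorm x).
Hypothesis phi_stable : forall X (s : {fset 'rV[int]_d}), finite_set X ->
  (forall x, X x -> cell_of x \in s) -> - b * #|` s|%:R <= energy phi X.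
Hypothesis r0_le : r0 <= m%:R.

Let L0 := @hcube R d n.
Let L1 := @hcube R d (n + m).

Let bL0 : bounded_borel L0. Proof. exact: bounded_borel_hcube. Qed.
Let bL1 : bounded_borel L1. Proof. exact: bounded_borel_hcube. Qed.
Let L01 : L0 `<=` L1. Proof. by apply: hcube_le; exact: leq_addr. Qed.

Definition shell_card : R := ((n + m) + (n + m))%:R ^+ d - (n + n)%:R ^+ d.

Let card_shell : #|` (box d (n + m) `\` box d n)%fset|%:R = shell_card.
Proof.
rewrite cardfsDS; last by apply: box_subset; exact: leq_addr.
rewrite natrB; last by apply: fsubset_leq_card; apply: box_subset; exact: leq_addr.
by rewrite !card_box !natrX.
Qed.

Let energy_before zeta k : L1 `<=` cube k ->
  energy phi (points zeta `&` cube k) - energy phi (points zeta `&` (cube k `\` L1)) =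
  energy phi (points zeta `&` L1) +
  cross phi (points zeta `&` L1) (points zeta `&` (cube k `\` L1)).
Proof. by move=> h; apply: conditional_energyE => //; case: bL1. Qed.

Let fin_in zeta X : bounded_set X -> finite_set (points zeta `&` X).
Proof. exact: finite_points. Qed.

Let fout zeta k : finite_set (points zeta `&` (cube k `\` L1)).
Proof.
by apply: finite_points; apply: bounded_set_subset (@bounded_cube R d k); exact: subDsetl.
Qed.

Let cross_ge X Y : finite_set X -> finite_set Y ->
  - (\sum_(x \in X) \sum_(y \in Y) psi (enorm (x - y))) <= cross phi X Y.
Proof.
move=> fX fY; rewrite -subr_ge0 opprK /cross -fsbig_split//=.
apply: fsumr_ge0 => x _; rewrite -fsbig_split//=.
by apply: fsumr_ge0 => y _; rewrite -lerBlDr sub0r.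
Qed.

Let card_cell_le zeta X i : X `<=` points zeta ->
  (card_of (X `&` cell i) <= num_points (cell i) zeta)%N.
Proof.
move=> Xz; apply: card_fset_set_le; last exact: setSI.
by apply: finite_points; case: (bounded_borel_cell R i).
Qed.

Let two_sums_le zeta (X X' Y Y' : set 'rV[R]_d) M :
  X `<=` points zeta -> X' `<=` points zeta -> Y `<=` points zeta -> Y' `<=` points zeta ->
  \sum_(i <- box d (n + m)) \sum_(j <- box d M) boundary_weight i j *
    ((card_of (X `&` cell i))%:R * (card_of (Y `&` cell j))%:R) +
  \sum_(i <- box d (n + m)) \sum_(j <- box d M) boundary_weight i j *
    ((card_of (X' `&` cell i))%:R * (card_of (Y' `&` cell j))%:R) <= boundary_sum M zeta.
Proof.
move=> h1 h2 h3 h4; rewrite -big_split/=; apply: ler_sum => i _.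
rewrite -big_split/=; apply: ler_sum => j _; rewrite -mulrDr ler_wpM2l//.
have := card_cell_le i h1; have := card_cell_le i h2.
have := card_cell_le j h3; have := card_cell_le j h4.
move: (card_of _) (card_of _) (card_of _) (card_of _) (num_points _ _) (num_points _ _).
move=> a b' c e p q ha hb hc he.
apply: (@le_trans _ _ (p%:R * q%:R + p%:R * q%:R)).
  by rewrite -!natrM -!natrD ler_nat leq_add// leq_mul.
by have := sqr_ge0 (p%:R - q%:R : R); rewrite sqrrB; lra.
Qed.

Let assemble (e0 ea c0 c1 p0 p1 q0 q1 v t k : R) : - p0 <= c0 -> - p1 <= c1 ->
  p0 <= q0 -> p1 <= q1 -> q0 + q1 <= v -> v <= t -> - k <= ea ->
  e0 - k - t <= e0 + ea + c0 + c1.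
Proof. lra. Qed.

(** The energy in the larger cube is that in the smaller cube, that in the shell, which
is bounded below by stability, and the interaction between them. This and
the interaction with the outside are at least minus the sums of psi, each of
which is at most half the boundary sum. *)
Lemma conditional_energy_lower t zeta : summable_configs psi zeta -> decoupled t zeta ->
  energy phi (points zeta `&` L0) - b * shell_card - t <= conditional_energy phi L1 zeta.
Proof.
move=> Sz dz; apply: limr_ge.
  by apply: (@cvg_conditional_energy R d phi psi r0) => //; case: bL1.
have [k0 Lk] := bounded_subset_cube (bL1.2).
exists k0 => // k /= kk0.
have L1k : L1 `<=` cube k by apply: subset_trans Lk _; exact: subset_cube.
rewrite energy_before//.
pose Z0 := points zeta `&` L0; pose Za := points zeta `&` (L1 `\` L0).
pose Z1 := points zeta `&` L1; pose Zo := points zeta `&` (cube k `\` L1).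
have f0 : finite_set Z0 by apply: fin_in; case: bL0.
have f1 : finite_set Z1 by apply: fin_in; case: bL1.
have fa : finite_set Za by apply: sub_finite_set f1 => y [zy []].
have fo : finite_set Zo by exact: fout.
have e1 : energy phi Z1 = energy phi Z0 + energy phi Za + cross phi Z0 Za.
  rewrite /Z1 -[L1](setDUK L01) setIUr energyU//.
  by apply/seteqP; split=> // y [[_ h] [_ []]].
have ea : - b * shell_card <= energy phi Za.
  rewrite -card_shell; apply: phi_stable => // y [_ [y1 y0]].
  by rewrite in_fsetD; apply/andP; split=> //; exact/negP.
have h1 := cross_ge f0 fa; have h2 := cross_ge f1 fo.
pose M := maxn k.+1 (n + m).
have kM : @cube R d k `<=` hcube M.
  move=> y /cube_subset_hcube; apply: hcube_le; exact: leq_maxl.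
have s1 : \sum_(x \in Z0) \sum_(y \in Za) psi (enorm (x - y)) <=
    \sum_(i <- box d (n + m)) \sum_(j <- box d M) boundary_weight i j *
      ((card_of (Z0 `&` cell i))%:R * (card_of (Za `&` cell j))%:R).
  apply: cross_psi_le => //.
  - by move=> y [_ /L01].
  - by move=> y [_ [y1 _]]; exact: (hcube_le (leq_maxr _ _) y1).
  - by apply/seteqP; split=> // y [[_ [_ h]] /h].
have s2 : \sum_(x \in Z1) \sum_(y \in Zo) psi (enorm (x - y)) <=
    \sum_(i <- box d (n + m)) \sum_(j <- box d M) boundary_weight i j *
      ((card_of (Z1 `&` cell i))%:R * (card_of (Zo `&` cell j))%:R).
  apply: cross_psi_le => //.
  - by move=> y [_].
  - by move=> y [_ [yk _]]; exact: kM.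
  - by apply/seteqP; split=> // y [[_ [_ h]] /L01 /h].
have s3 := @two_sums_le zeta Z0 Z1 Za Zo M (@subIsetl _ _ _) (@subIsetl _ _ _)
  (@subIsetl _ _ _) (@subIsetl _ _ _).
rewrite mulNr in ea; rewrite -/Z1 -/Zo -/Z0 e1.
exact: (assemble _ h1 h2 s1 s2 s3 (dz M) ea).
Qed.

Let far x y : L0 x -> ~ L1 y -> r0 <= enorm (x - y).
Proof.
move=> /hcubeP x0 y1; have [l hl] : exists l, ~ (- (n + m)%:R <= y ord0 l < (n + m)%:R).
  by apply/existsNP => h; apply: y1; apply/hcubeP.
apply: le_trans r0_le (le_trans _ (coord_le_enorm (x - y) l)).
rewrite mxE [(- y) _ _]mxE; move: hl (x0 l); rewrite natrD.
move: (x ord0 l) (y ord0 l) (n%:R : R) (m%:R : R) => a c p q hl /andP[h1 h2].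
have [h|h] := leP (- (p + q)) c; last first.
  by apply: le_trans (ler_norm _); lra.
have [h'|h'] := ltP c (p + q); first by case: hl; rewrite h h'.
by rewrite -normrN; apply: le_trans (ler_norm _); lra.
Qed.

(** Without points in the shell, only the smaller cube and the outside interact, at a
distance at least m >= r0, where phi <= psi. This is why the shell is
emptied for the upper bound: at short distances phi has no upper bound. *)
Lemma conditional_energy_upper t zeta : summable_configs psi zeta ->
  num_points (L1 `\` L0) zeta = 0%N -> decoupled t zeta ->
  conditional_energy phi L1 zeta <= energy phi (points zeta `&` L0) + t.
Proof.
move=> Sz a0 dz.
have ba : bounded_set (L1 `\` L0) by apply: bounded_set_subset bL1.2; exact: subDsetl.
have za := num_points_eq0 ba a0.
have z1 : points zeta `&` L1 = points zeta `&` L0.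
  by rewrite -[L1](setDUK L01) setIUr za setU0.
apply: limr_le.
  by apply: (@cvg_conditional_energy R d phi psi r0) => //; case: bL1.
have [k0 Lk] := bounded_subset_cube (bL1.2).
exists k0 => // k /= kk0.
have L1k : L1 `<=` cube k by apply: subset_trans Lk _; exact: subset_cube.
rewrite energy_before// z1 lerD2l.
pose Z0 := points zeta `&` L0; pose Zo := points zeta `&` (cube k `\` L1).
have f0 : finite_set Z0 by apply: fin_in; case: bL0.
have fo : finite_set Zo by exact: fout.
have h1 : cross phi Z0 Zo <= \sum_(x \in Z0) \sum_(y \in Zo) psi (enorm (x - y)).
  apply: ler_fsumr => // x [_ x0]; apply: ler_fsumr => // y [_ [_ y1]].
  exact/phi_upper/far.
have s2 : \sum_(x \in Z0) \sum_(y \in Zo) psi (enorm (x - y)) <=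
    \sum_(i <- box d (n + m)) \sum_(j <- box d k.+1) boundary_weight i j *
      ((card_of (Z0 `&` cell i))%:R * (card_of (Zo `&` cell j))%:R).
  apply: cross_psi_le => //.
  - by move=> y [_ /L01].
  - by move=> y [_ [yk _]]; exact: cube_subset_hcube.
  - by apply/seteqP; split=> // y [[_ [_ h]] /L01 /h].
have s3 := @two_sums_le zeta Z0 Z0 Zo Zo k.+1 (@subIsetl _ _ _) (@subIsetl _ _ _)
  (@subIsetl _ _ _) (@subIsetl _ _ _).
apply: (le_trans h1); apply: (le_trans s2); apply: le_trans (dz k.+1); apply: le_trans s3.
rewrite lerDl; apply: sumr_ge0 => i _; apply: sumr_ge0 => j _.
by rewrite !mulr_ge0.
Qed.

End boundary.

(** * Comparison of two Gibbs measures *)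

Section comparison.
Variables (R : realType) (d : nat) (phi : 'rV[R]_d -> R) (psi : R -> R) (r0 b : R).
Hypothesis d_gt0 : (0 < d)%N.
Hypothesis phi_measurable : measurable_fun [set: 'rV[R]_d] phi.
Hypothesis phi_even : forall x, phi (- x) = phi x.
Hypothesis psi_ge0 : forall r : R, 0 <= r -> 0 <= psi r.
Hypothesis psi_anti : forall r s : R, 0 <= r -> r <= s -> psi s <= psi r.
Hypothesis psi_int :
  (\int[lebesgue_measure]_(r in `[0%R, +oo[) (psi r * r ^+ d.-1)%:E < +oo)%E.
Hypothesis phi_lower : forall x, - psi (enorm x) <= phi x.
Hypothesis phi_upper : forall x, r0 <= enorm x -> phi x <= psi (enorm x).
Hypothesis phi_stable : forall (X : set 'rV[R]_d) (s : {fset 'rV[int]_d}), finite_set X ->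
  (forall x, X x -> cell_of x \in s) -> - b * #|` s|%:R <= energy phi X.
Variable pi : probability (config R d) R.
Hypothesis pi_poisson : poisson_process pi.
Variables n m : nat.
Hypothesis r0_le : r0 <= m%:R.
Variable t : R.
Implicit Types (eta omega zeta : config R d) (i : 'rV[int]_d).

Let L0 := @hcube R d n.
Let L1 := @hcube R d (n + m).
Let S := @summable_configs R d psi.
Let D := @decoupled R d psi n m t.
Let out omega := config_restrict omega (~` L1).
Let sh : R := @shell_card R d n m.

Let bL0 : bounded_borel L0. Proof. exact: bounded_borel_hcube. Qed.
Let bL1 : bounded_borel L1. Proof. exact: bounded_borel_hcube. Qed.
Let L01 : L0 `<=` L1. Proof. by apply: hcube_le; exact: leq_addr. Qed.
Let mD : measurable D. Proof. exact: measurable_decoupled. Qed.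
Let bcell i : bounded_set (@cell R d i). Proof. by case: (bounded_borel_cell R i). Qed.
Let bsh : bounded_borel (L1 `\` L0).
Proof. by apply: bounded_borelD => //; case: bL0. Qed.

(** On decoupled configurations the conditional density is compared with the product
of this function of the boundary condition and of [inner_density], a function of
the points in the smaller cube. *)
Definition outer_weight omega : R :=
  (partition_function phi pi L1 omega)^-1 * \1_D (out omega).

Let inner_density (A : set (config R d)) eta : R :=
  \1_A eta * \1_D (config_restrict eta L0) * expR (- energy phi (points eta `&` L0)).

Definition inner_weight (A : set (config R d)) : R := \int[pi]_eta inner_density A eta.

Let bounded_inner_density A : measurable A -> bounded_measurable (inner_density A).
Proof.
move=> mA; have mL0 : measurable L0 by case: bL0.
apply: bounded_measurableM.
  split; last first.
    by exists 1 => eta; rewrite ger0_norm ?mulr_ge0// !indicE -natrM ler_nat mulnb.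
  apply: measurable_funM; first exact: measurable_indic.
  by apply: measurableT_comp; [exact: measurable_indic|exact: measurable_restrict].
split.
  apply: measurableT_comp => //; apply: measurableT_comp => //.
  exact: (measurable_energy phi_measurable (kappa := id)).
exists (expR (b * #|` box d n|%:R)) => eta; rewrite ger0_norm ?expR_ge0// ler_expR.
rewrite lerNl -mulNr; apply: phi_stable => [|x []//].
by apply: finite_points; case: bL0.
Qed.

Let inner_density_ge0 A eta : 0 <= inner_density A eta.
Proof. by rewrite !mulr_ge0 ?expR_ge0. Qed.

Lemma inner_weight_ge0 A : measurable A -> 0 <= inner_weight A.
Proof.
move=> mA; rewrite -[leLHS](expectation_cst pi 0); apply: le_expectation => //.
- exact: bounded_measurable_cst.
- exact: bounded_inner_density.
Qed.

Let outer_weight_ge0 omega : 0 <= outer_weight omega.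
Proof. by rewrite mulr_ge0// invr_ge0; exact: partition_function_ge0. Qed.

Let restrict_paste eta omega : config_restrict (paste L1 eta omega) L0 = config_restrict eta L0.
Proof.
apply: config_eqP => /=; apply/seteqP; split=> x.
  by move=> [[[ex _]|[_ nx]] x0]; [split|case: nx; exact: L01].
by move=> [ex x0]; split=> //; left; split=> //; exact: L01.
Qed.

Let paste_L0 eta omega : points (paste L1 eta omega) `&` L0 = points eta `&` L0.
Proof. by have := congr1 (@points R d) (restrict_paste eta omega). Qed.

Let num_in eta omega i :
  num_points (cell i) (config_restrict eta L0) = num_points (L0 `&` cell i) (paste L1 eta omega).
Proof. by rewrite -(restrict_paste eta omega) num_points_restrict. Qed.

Let num_out eta omega i :
  num_points (cell i) (out omega) = num_points (~` L1 `&` cell i) (paste L1 eta omega).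
Proof.
rewrite num_points_restrict /num_points paste_out//.
by apply/seteqP; split=> // x [[]].
Qed.

Let decoupled_in eta omega : D (paste L1 eta omega) -> D (config_restrict eta L0).
Proof.
move=> h M; apply: le_trans (h M); apply: boundary_sum_le => // i.
by rewrite (num_in eta omega); apply: num_points_le => //; exact: subIsetr.
Qed.

Let decoupled_out eta omega : D (paste L1 eta omega) -> D (out omega).
Proof.
move=> h M; apply: le_trans (h M); apply: boundary_sum_le => // i.
by rewrite (num_out eta omega); apply: num_points_le => //; exact: subIsetr.
Qed.

Let num_shell eta omega :
  num_points (L1 `\` L0) (paste L1 eta omega) = num_points (L1 `\` L0) eta.
Proof.
rewrite /num_points; congr card_of; have := paste_in L1 eta omega => h.
by rewrite setDE !setIA h.
Qed.

Let decoupled_paste eta omega : num_points (L1 `\` L0) eta = 0%N ->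
  D (config_restrict eta L0) -> D (out omega) ->
  decoupled psi n m (t + t) (paste L1 eta omega).
Proof.
move=> a0 h1 h2 M; set zeta := paste L1 eta omega.
have za : points zeta `&` (L1 `\` L0) = set0.
  by apply: num_points_eq0; [case: bsh|rewrite num_shell].
rewrite (@boundary_sum_split R d psi n m (out omega) (config_restrict eta L0)) ?lerD// => i.
have e1 := num_in eta omega i; have e2 := num_out eta omega i.
split; last first.
  have [ib|ib] := boolP (i \in box d n); [right|left].
    rewrite e2 /num_points (_ : _ `&` _ = set0) ?/card_of ?fset_set0 ?cardfs0//.
    apply/seteqP; split=> // x [_ [x1 /cellP xi]]; apply: x1; apply: L01.
    by rewrite /L0/hcube/= xi.
  rewrite e1 /num_points (_ : _ `&` _ = set0) ?/card_of ?fset_set0 ?cardfs0//.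
  apply/seteqP; split=> // x [_ [x0 /cellP xi]].
  by move: x0; rewrite /L0/hcube/= xi; exact/negP.
rewrite e1 e2 -/zeta.
have -> : num_points (~` L1 `&` cell i) zeta = num_points (~` L0 `&` cell i) zeta.
  rewrite /num_points; congr card_of; apply/seteqP; split=> x [zx [x1 xi]]; split=> //; split=> //.
    by move=> /L01.
  move=> x1'; have : (points zeta `&` (L1 `\` L0)) x by [].
  by rewrite za.
rewrite -num_pointsU.
- by rewrite -setIUl setUv setTI.
- by apply: bounded_set_subset (bcell i); exact: subIsetr.
- by apply: bounded_set_subset (bcell i); exact: subIsetr.
- by apply/seteqP; split=> // x [[h _] [/(_ h)]].
Qed.

Section one_measure.
Variable mu : probability (config R d) R.
Hypothesis mu_gibbs : tempered_gibbs phi pi mu.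
Variable A : set (config R d).
Hypothesis mA : measurable (A : set (local_config L0)).

Let mA' : measurable A. Proof. exact: measurable_local_config mA. Qed.

Let A_paste eta omega : A (paste L1 eta omega) <-> A eta.
Proof.
by rewrite -(local_event_restrict mA) restrict_paste (local_event_restrict mA).
Qed.

Definition outer_mass : \bar R := (\int[mu]_omega (outer_weight omega)%:E)%E.

Let muS : mu (~` S) = 0%E.
Proof. by case: mu_gibbs => nt nti _; exact: summable_configs_full. Qed.

Let mS : measurable S. Proof. exact: measurable_summable_configs. Qed.

(** By the DLR equation in the larger cube and [conditional_energy_lower]: if the
pasted configuration is decoupled, so are its parts inside the smaller cube
and outside the larger one. *)
Lemma measure_decoupled_le :
  (mu (A `&` D) <= (expR (t + b * sh) * inner_weight A)%:E * outer_mass)%E.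
Proof.
have mAD : measurable (A `&` D) by exact: measurableI.
have [_ _ dl] := mu_gibbs.
have C0 : 0 <= expR (t + b * sh) * inner_weight A.
  by rewrite mulr_ge0 ?expR_ge0//; exact: inner_weight_ge0.
have -> : mu (A `&` D) = (\int[mu]_omega (\1_(A `&` D) omega)%:E)%E.
  by rewrite integral_indic// setIT.
rewrite (dl L1 bL1 (\1_(A `&` D)))//.
rewrite /outer_mass -ge0_integralZ_lower//.
apply: (@ge0_le_integral_off_null _ _ _ _ (~` S)) => //.
- exact: measurableC.
- move=> omega; apply: mule_ge0; last by apply: gibbs_integral_ge0 => eta.
  by rewrite lee_fin invr_ge0 partition_function_ge0.
- by move=> omega; rewrite mule_ge0 ?lee_fin.
move=> omega /contrapT So.
rewrite /gibbs_expectation /outer_weight.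
have -> : ((expR (t + b * sh) * inner_weight A)%:E *
   ((partition_function phi pi L1 omega)^-1 * \1_D (out omega))%:E =
   (partition_function phi pi L1 omega)^-1%:E *
   ((expR (t + b * sh) * \1_D (out omega))%:E * (inner_weight A)%:E))%E.
  by rewrite -!EFinM; congr EFin; ring.
apply: lee_wpmul2l; first by rewrite lee_fin invr_ge0 partition_function_ge0.
rewrite /inner_weight -expectation_EFin; last exact: bounded_inner_density.
rewrite -ge0_integralZ_lower//; last by move=> eta; rewrite lee_fin.
apply: ge0_le_integral_lower => eta; first by rewrite lee_fin mulr_ge0 ?expR_ge0.
rewrite -EFinM lee_fin.
have [[Az Dz]|nz] := pselect ((A `&` D) (paste L1 eta omega)); last first.
  by rewrite indicE memNset// mul0r !mulr_ge0 ?expR_ge0.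
rewrite /inner_density !indicE !mem_set//; last 3 first.
- exact: (decoupled_in Dz).
- by have [h _] := A_paste eta omega; exact: h.
- exact: decoupled_out Dz.
rewrite !mul1r mulr1 -expRD ler_expR.
have Sz : S (paste L1 eta omega) by apply: summable_configs_paste => //; case: bL1.
have := conditional_energy_lower psi_ge0 psi_anti phi_even phi_lower phi_upper phi_stable Sz Dz.
rewrite paste_L0 -/L1 -/sh; lra.
Qed.

(** The converse bound, by restriction to the configurations without points in the
shell. The Poisson process has no point there with probability
exp(- volume), independently of the points in the smaller cube
([poisson_void]). If the inside and the outside are both decoupled at level
t, the pasted configuration is decoupled at level 2 t. *)
Lemma measure_local_ge :
  ((expR (- (t + t) - volume (L1 `\` L0)) * inner_weight A)%:E * outer_mass <= mu A)%E.
Proof.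
have [_ _ dl] := mu_gibbs.
have C0 : 0 <= expR (- (t + t) - volume (L1 `\` L0)) * inner_weight A.
  by rewrite mulr_ge0 ?expR_ge0//; exact: inner_weight_ge0.
have -> : mu A = (\int[mu]_omega (\1_A omega)%:E)%E.
  by rewrite integral_indic// setIT.
rewrite (dl L1 bL1 (\1_A))//.
rewrite /outer_mass -ge0_integralZ_lower//.
apply: (@ge0_le_integral_off_null _ _ _ _ (~` S)) => //.
- exact: measurableC.
- by move=> omega; rewrite mule_ge0 ?lee_fin.
- move=> omega; apply: mule_ge0; last by apply: gibbs_integral_ge0 => eta.
  by rewrite lee_fin invr_ge0 partition_function_ge0.
move=> omega /contrapT So.
rewrite /gibbs_expectation /outer_weight.
have -> : ((expR (- (t + t) - volume (L1 `\` L0)) * inner_weight A)%:E *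
   ((partition_function phi pi L1 omega)^-1 * \1_D (out omega))%:E =
   (partition_function phi pi L1 omega)^-1%:E *
   ((expR (- (t + t) - volume (L1 `\` L0)) * inner_weight A) * \1_D (out omega))%:E)%E.
  by rewrite -!EFinM; congr EFin; ring.
apply: lee_wpmul2l; first by rewrite lee_fin invr_ge0 partition_function_ge0.
have [Do|nDo] := pselect (D (out omega)); last first.
  by rewrite indicE memNset// mulr0; apply: gibbs_integral_ge0 => eta.
rewrite indicE mem_set// mulr1.
pose w eta : \bar R := (expR (- (t + t)) *
  (\1_A eta * \1_D eta * expR (- energy phi (points eta `&` L0))))%:E.
have w0 eta : (0 <= w eta)%E by rewrite lee_fin !mulr_ge0 ?expR_ge0.
have mw : measurable_fun setT w.
  apply/measurable_EFinP; apply: measurable_funM => //; apply: measurable_funM.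
    by apply: measurable_funM; exact: measurable_indic.
  apply: measurableT_comp => //; apply: measurableT_comp => //.
  exact: (measurable_energy phi_measurable (kappa := id)).
have wE eta : w (config_restrict eta L0) = (expR (- (t + t)) * inner_density A eta)%:E.
  rewrite /w /inner_density /= -setIA setIid; congr (_ * (_ * _ * _))%:E.
  by rewrite !indicE; congr (nat_of_bool _)%:R; apply: asbool_equiv_eq; exact: local_event_restrict.
have dj : L0 `&` (L1 `\` L0) = set0 by apply/seteqP; split=> // x [h [_ /(_ h)]].
have := poisson_void pi_poisson bL0 bsh dj mw w0.
have -> : (\int[pi]_eta w (config_restrict eta L0) =
    (expR (- (t + t)))%:E * (inner_weight A)%:E)%E.
  under eq_integral do rewrite wE EFinM.
  rewrite ge0_integralZ_lower ?expR_ge0// => [|eta]; last by rewrite lee_fin.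
  by rewrite expectation_EFin//; exact: bounded_inner_density.
rewrite -!EFinM mulrA -expRD [(- volume _) + _]addrC => <-.
apply: ge0_le_integral_lower => eta; first by rewrite mule_ge0// lee_fin.
have [a0|a0] := eqVneq (num_points (L1 `\` L0) eta) 0%N; last first.
  by rewrite mul0e lee_fin mulr_ge0 ?expR_ge0// indicE.
rewrite mul1e wE lee_fin.
have rhs0 : 0 <= \1_A (paste L1 eta omega) *
    expR (- conditional_energy phi L1 (paste L1 eta omega)) :> R.
  by rewrite mulr_ge0 ?expR_ge0.
have [Ae|nAe] := pselect (A eta); last by rewrite /inner_density indicE memNset// !mul0r mulr0.
have [De|nDe] := pselect (D (config_restrict eta L0)); last first.
  by rewrite /inner_density [\1_D _]indicE memNset// mulr0 mul0r mulr0.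
rewrite /inner_density !indicE !mem_set//; last exact/A_paste.
rewrite !mul1r -expRD ler_expR.
have Sz : S (paste L1 eta omega) by apply: summable_configs_paste => //; case: bL1.
have az : num_points (L1 `\` L0) (paste L1 eta omega) = 0%N by rewrite num_shell.
have := conditional_energy_upper psi_ge0 psi_anti phi_even phi_lower phi_upper r0_le Sz az
  (decoupled_paste a0 De Do).
rewrite paste_L0 -/L1; lra.
Qed.

End one_measure.

(** Write x for mu(A and D), y for nu(A), qA and qT for the inner weights of A and of
the sure event, and k, k' for the outer masses of mu and nu. The masses
are eliminated by comparing A with the sure event under each law, and the
inner weights, which do not depend on the law, by comparing the two laws. *)
Let combine (qA qT k k' x y x' e1 e2 : R) : 0 < e1 -> 0 < e2 -> 0 < qT -> 0 <= qA -> 0 <= k -> 0 <= k' ->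
  x <= e1 * qA * k -> e2^-1 * qT * k <= 1 -> e2^-1 * qA * k' <= y ->
  2^-1 <= e1 * qT * k' -> x <= 2 * (e1 * e2) ^+ 2 * y.
Proof.
move=> e10 e20 qT0 qA0 k0 k'0 h1 h2 h3 h4.
have kq : k * qT <= e2.
  by move: h2; rewrite -mulrA ler_pdivrMl// mulr1 mulrC.
have h5 : x * qT <= e1 * e2 * qA.
  apply: (@le_trans _ _ (e1 * qA * k * qT)); first by rewrite ler_wpM2r// ltW.
  by rewrite -[_ * k * qT]mulrA [e1 * e2 * qA]mulrAC ler_wpM2l// mulr_ge0 ?(ltW e10).
have h6 : qA * k' <= e2 * y by move: h3; rewrite -mulrA ler_pdivrMl.
have h7 : qA * 2^-1 <= e1 * e2 * qT * y.
  apply: (@le_trans _ _ (qA * (e1 * qT * k'))); first by rewrite ler_wpM2l.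
  have -> : qA * (e1 * qT * k') = e1 * qT * (qA * k') by ring.
  have -> : e1 * e2 * qT * y = e1 * qT * (e2 * y) by ring.
  by rewrite ler_wpM2l// mulr_ge0 ?(ltW e10) ?(ltW qT0).
rewrite -(ler_pM2r qT0); apply: (le_trans h5).
have -> : 2 * (e1 * e2) ^+ 2 * y * qT = e1 * e2 * (2 * (e1 * e2 * qT * y)) by ring.
rewrite ler_wpM2l ?mulr_ge0 ?(ltW e10) ?(ltW e20)//.
by lra.
Qed.

(** Neither the partition functions nor the outer masses can be controlled, but they
enter the bounds for A and for the sure event alike ([combine]). *)
Lemma gibbs_comparison (mu nu : probability (config R d) R) (A : set (config R d)) :
  tempered_gibbs phi pi mu -> tempered_gibbs phi pi nu ->
  measurable (A : set (local_config L0)) -> 2^-1 <= fine (nu D) ->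
  fine (mu (A `&` D)) <= 2 * expR (3 * t + b * sh + volume (L1 `\` L0)) ^+ 2 * fine (nu A).
Proof.
move=> gmu gnu mA hD.
have mT : measurable (setT : set (local_config L0)) by exact: measurableT.
have mA' : measurable A by exact: measurable_local_config mA.
have fin (P : probability (config R d) R) B : measurable B -> P B = (fine (P B))%:E.
  by move=> mB; rewrite fineK//; exact: fin_num_measure.
have K0 (P : probability (config R d) R) : (0 <= outer_mass P)%E.
  by apply: integral_ge0 => omega _; rewrite lee_fin.
have U := measure_decoupled_le gmu mA; have LT := measure_local_ge gmu mT.
have UT := measure_decoupled_le gnu mT; have L := measure_local_ge gnu mA.
have LT' := measure_local_ge gnu mT.
rewrite setTI fin// in UT; rewrite fin// in L; rewrite fin in U; last exact: measurableI.
have e1 (P : probability (config R d) R) : P setT = 1%E by exact: (probability_setT P).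
rewrite e1 in LT; rewrite e1 in LT'.
have q0 : 0 <= inner_weight setT by exact: inner_weight_ge0.
have qT : 0 < inner_weight setT.
  rewrite lt_neqAle q0 andbT; apply/eqP => q; move: UT; rewrite -q mulr0 mul0e lee_fin.
  lra.
have finK (P : probability (config R d) R) :
    ((expR (- (t + t) - volume (L1 `\` L0)) * inner_weight setT)%:E * outer_mass P <= 1)%E ->
    exists2 k : R, 0 <= k & outer_mass P = k%:E.
  move=> h; have := K0 P; move: h; case: (outer_mass P) => [k _|h _|//].
    by rewrite lee_fin => k0; exists k.
  move: h; rewrite gt0_muley ?lte_fin ?mulr_gt0 ?expR_gt0//.
have [k k0 ke] := finK _ LT; have [k' k'0 ke'] := finK _ LT'.
rewrite ke -EFinM lee_fin in U; rewrite ke -EFinM lee_fin in LT.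
rewrite ke' -EFinM lee_fin in UT; rewrite ke' -EFinM lee_fin in L.
have E2 : expR (- (t + t) - volume (L1 `\` L0)) = (expR (t + t + volume (L1 `\` L0)))^-1.
  by rewrite -expRN; congr expR; ring.
rewrite E2 in LT; rewrite E2 in L.
have := @combine (inner_weight A) (inner_weight setT) k k' _ _ 0 _ _ (expR_gt0 _) (expR_gt0 _) qT
  (inner_weight_ge0 mA') k0 k'0 U LT L (le_trans hD UT).
rewrite -expRD; congr (_ <= 2 * expR _ ^+ 2 * _); ring.
Qed.

End comparison.

(** * The interaction across a shell is small compared with the volume *)

Section shells.
Variable R : realType.

(** The shell has the fixed thickness 2 m. *)
Lemma shell_small (d m : nat) (k : R) : (0 < d)%N -> 0 < k -> exists N, forall n, (N <= n)%N ->
  (m <= n)%N /\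
  ((n + m) + (n + m))%:R ^+ d - ((n - m) + (n - m))%:R ^+ d <= k * (n + n)%:R ^+ d.
Proof.
case: d => // d _ k0.
pose c := (d.+1 * (4 * m) * 2 ^ d)%N.
exists (maxn m (Num.truncn (c%:R / k)).+1) => n; rewrite geq_max => /andP[mn Nn]; split=> //.
have h1 : (((n + m) + (n + m)) ^ d.+1 - ((n - m) + (n - m)) ^ d.+1 <= c * (n + n) ^ d)%N.
  apply: leq_trans (expn_diff_le _ _) _; first by lia.
  rewrite /c -!mulnA !mulnA; apply: (@leq_trans (d.+1 * (4 * m) * (2 * (n + n)) ^ d)).
    have mono (a b' e : nat) : (a <= b')%N -> (a ^ e <= b' ^ e)%N.
      by case: e => // e; rewrite leq_exp2r.
    by apply: leq_mul; [apply: leq_mul => //; lia|apply: mono; lia].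
  by rewrite expnMn !mulnA.
have h2 : ((n - m) + (n - m) <= (n + m) + (n + m))%N by lia.
rewrite -!natrX -natrB; last by rewrite leq_exp2r.
apply: (@le_trans _ _ (c * (n + n) ^ d)%:R); first by rewrite ler_nat.
rewrite expnS [in leLHS]natrM [in leRHS]natrM mulrA ler_wpM2r//.
have : c%:R / k <= n%:R.
  by apply: le_trans (ltW (truncnS_gt _)) _; rewrite ler_nat.
rewrite ler_pdivrMr// => h; apply: (le_trans h).
by rewrite mulrC ler_wpM2l ?(ltW k0)// ler_nat leq_addr.
Qed.

Lemma volume_shell (d n m : nat) : (0 < m)%N -> (m <= n)%N ->
  volume (@hcube R d (n + m) `\` hcube n) <=
  ((n + m) + (n + m))%:R ^+ d - ((n - m) + (n - m))%:R ^+ d.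
Proof.
move=> m0 mn.
have bs : bounded_borel (@hcube R d (n + m) `\` hcube n).
  by apply: bounded_borelD; [exact: bounded_borel_hcube|case: (bounded_borel_hcube R d n)].
rewrite -lee_fin -volumeE//.
(* The half-open cube is compared with closed ones, whose volumes are known. *)
have sub : @cube R d n.-1 `<=` @cube R d (n + m) by apply: subset_cube; lia.
apply: (@le_trans _ _ (lebesgue_rV R d (@cube R d (n + m) `\` cube n.-1))).
  apply: le_measure; rewrite ?inE; first by case: bs.
    by apply: measurableD; exact: measurable_cube.
  move=> x [x1 x0]; split; first exact: hcube_subset.
  by move=> /cube_subset_hcube; rewrite prednK//; lia.
rewrite measureD; last 3 first.
- exact: measurable_cube.
- exact: measurable_cube.
- exact/lebesgue_bounded/bounded_borel_cube.
rewrite setIidr//.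
rewrite [X in (X - _)%E](_ : _ = (((n + m)%:R *+ 2) ^+ d)%:E); last exact: lebesgue_cube.
rewrite [X in (_ - X)%E](_ : _ = ((n.-1%:R *+ 2) ^+ d)%:E); last exact: lebesgue_cube.
rewrite -EFinB lee_fin; apply: lerB.
- by rewrite mulr2n -natrD.
- rewrite lerXn2r ?nnegrE ?mulrn_wge0// mulr2n -natrD ler_nat; lia.
Qed.

End shells.

Section decoupling.
Variables (R : realType) (d : nat) (psi : R -> R).
Hypothesis d_gt0 : (0 < d)%N.
Hypothesis psi_ge0 : forall r : R, 0 <= r -> 0 <= psi r.
Hypothesis psi_anti : forall r s : R, 0 <= r -> r <= s -> psi s <= psi r.
Hypothesis psi_int :
  (\int[lebesgue_measure]_(r in `[0%R, +oo[) (psi r * r ^+ d.-1)%:E < +oo)%E.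
Implicit Types (n m M : nat) (omega : config R d).

(** Rows with i in the box n - m are tails of the row sum of Psi, hence at most e; the
other rows are at most S, and their number is of the order of the surface. *)
Lemma sum_boundary_weight n m M (e S : R) : 0 <= e -> 0 <= S -> (m <= n)%N ->
  (forall i n, \sum_(j <- box d n) Psi psi (inorm (j - i)) <= S) ->
  (forall i n, \sum_(j <- box d n) (if j - i \in box d m then 0 else Psi psi (inorm (j - i))) <= e) ->
  \sum_(i <- box d (n + m)) \sum_(j <- box d M) boundary_weight psi n i j <=
  e * ((n + m) + (n + m))%:R ^+ d +
  S * (((n + m) + (n + m))%:R ^+ d - ((n - m) + (n - m))%:R ^+ d).
Proof.
move=> e0 S0 mn hS he.
have P0 k : 0 <= Psi psi k by exact: Psi_ge0.
apply: (@le_trans _ _ (\sum_(i <- box d (n + m)) (e + S * (1 - (i \in box d (n - m))%:R)))).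
  apply: ler_sum => i _; have [im|im] := boolP (i \in box d (n - m)).
    rewrite subrr mulr0 addr0; apply: le_trans (he i M); apply: ler_sum => j _.
    rewrite /boundary_weight; have [jn|jn] := boolP (j \in box d n); first by case: ifP.
    rewrite ifF//; apply/negbTE; apply: contra jn => /in_boxP h; move/in_boxP: im => im.
    apply/in_boxP => l; have := h l; have := im l; rewrite [(j - i) _ _]mxE [(- i) _ _]mxE.
    by move: (i ord0 l) (j ord0 l) => a b; lia.
  apply: (@le_trans _ _ S); last by rewrite subr0 mulr1 lerDr.
  apply: le_trans (hS i M); apply: ler_sum => j _.
  by rewrite /boundary_weight; case: ifP.
rewrite big_split/= -mulr_sumr sumrB.
have c1 k : \sum_(i <- box d k) (1 : R) = (k + k)%:R ^+ d.
  by rewrite big_const_seq count_predT iter_addr_0 card_box natrX.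
have -> : \sum_(i <- box d (n + m)) (i \in box d (n - m))%:R = ((n - m) + (n - m))%:R ^+ d :> R.
  rewrite -c1 (eq_bigr (fun i => if i \in box d (n - m) then 1 else 0)); last first.
    by move=> i _; case: (_ \in _).
  rewrite -big_mkcond big_fset_condE/=; congr (\sum_(i <- enum_fset _) _).
  apply/fsetP => i; rewrite !inE/= andb_idl//.
  by apply/fsubsetP/box_subset; lia.
have -> : \sum_(i <- box d (n + m)) e = e * ((n + m) + (n + m))%:R ^+ d.
  by rewrite -c1 mulr_sumr; apply: eq_bigr => i _; rewrite mulr1.
by rewrite c1.
Qed.

Section one_law.
Variable mu : probability (config R d) R.
Hypothesis mu_ti : translation_invariant mu.
Hypothesis mu_tempered : tempered mu.

(** Each of the two squares is summed against the marginal weights, with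
[moderate_weighted_sum]. *)
Lemma moderate_boundary_sum n m M (W : R) t :
  \sum_(i <- box d (n + m)) \sum_(j <- box d M) boundary_weight psi n i j <= W ->
  (\int[mu]_omega (\1_(moderate t) omega * boundary_sum psi n m M omega)%:E <=
   (2 * W * t%:R)%:E)%E.
Proof.
move=> hW; have w0 i j : 0 <= boundary_weight psi n i j by exact: boundary_weight_ge0.
pose f omega : R := \1_(@moderate R d t) omega * \sum_(i <- box d (n + m))
  (\sum_(j <- box d M) boundary_weight psi n i j) * (num_points (cell i) omega)%:R ^+ 2.
pose g omega : R := \1_(@moderate R d t) omega * \sum_(j <- box d M)
  (\sum_(i <- box d (n + m)) boundary_weight psi n i j) * (num_points (cell j) omega)%:R ^+ 2.
have f0 omega : 0 <= f omega.
  by rewrite mulr_ge0//; apply: sumr_ge0 => i _; rewrite mulr_ge0 ?sqr_ge0//; exact: sumr_ge0.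
have g0 omega : 0 <= g omega.
  by rewrite mulr_ge0//; apply: sumr_ge0 => i _; rewrite mulr_ge0 ?sqr_ge0//; exact: sumr_ge0.
have mN i : measurable_fun setT (fun omega : config R d => (num_points (cell i) omega)%:R ^+ 2 : R).
  apply: measurable_funX; apply: measurable_natr; apply: measurable_num_points.
  exact: bounded_borel_cell.
have mI1 : measurable_fun setT (\1_(moderate t) : config R d -> R).
  by apply: measurable_indic; exact: measurable_moderate.
have mg : measurable_fun setT g.
  apply: measurable_funM => //; apply: measurable_sum => i; exact: measurable_funM.
have mf : measurable_fun setT f.
  apply: measurable_funM => //; apply: measurable_sum => i; exact: measurable_funM.
have -> : (\int[mu]_omega (\1_(moderate t) omega * boundary_sum psi n m M omega)%:E =
    \int[mu]_omega ((f omega)%:E + (g omega)%:E))%E.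
  apply: eq_integral => omega _; rewrite -EFinD /f /g -mulrDr; congr (_ * _)%:E.
  rewrite /boundary_sum; under eq_bigr do under eq_bigr do rewrite mulrDr.
  under eq_bigr do rewrite big_split/=.
  rewrite big_split/=; congr (_ + _); first by apply: eq_bigr => i _; rewrite mulr_suml.
  by rewrite exchange_big; apply: eq_bigr => j _; rewrite mulr_suml.
rewrite ge0_integralD//; last 4 first.
- by move=> omega _; rewrite lee_fin.
- exact/measurable_EFinP.
- by move=> omega _; rewrite lee_fin.
- exact/measurable_EFinP.
have -> : 2 * W * t%:R = W * t%:R + W * t%:R by ring.
rewrite EFinD; apply: leeD; apply: moderate_weighted_sum => //.
- by move=> i; exact: sumr_ge0.
- by move=> i; exact: sumr_ge0.
- by rewrite exchange_big.
Qed.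

(** First t is chosen such that non-moderate configurations have probability at most
e / 2, then m such that the tails of the row sums of Psi are small compared with
1 / t, then n such that the shell is small compared with the volume. On the
moderate event Markov's inequality applies to the boundary sum. *)
Lemma decoupled_mass (e eps : R) : 0 < e -> 0 < eps -> exists m0, forall m, (m0 <= m)%N ->
  exists N, forall n, (N <= n)%N ->
    (mu (~` decoupled psi n m (eps * (n + n)%:R ^+ d)) <= e%:E)%E.
Proof.
move=> e0 eps0.
have P0 k : 0 <= Psi psi k by exact: Psi_ge0.
have [S [S0 hS]] := Psi_row_sum d_gt0 psi_ge0 psi_anti psi_int.
have e2 : 0 < e / 2 by rewrite divr_gt0.
have [t ht] := moderate_mass d_gt0 mu_tempered e2.
have {}ht := ht t (leqnn t).
pose T : R := t%:R + 1; have T0 : 0 < T by rewrite ltr_wpDl.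
have X0 : (0 : R) < 2 ^+ d by rewrite exprn_gt0.
(* With m <= n the larger cube has at most 2^d times the volume of the smaller one. *)
pose e' : R := eps * e / (8 * T * 2 ^+ d).
have e'0 : 0 < e' by rewrite divr_gt0 ?mulr_gt0.
have [m0 hm0] := Psi_row_tail d_gt0 psi_ge0 psi_anti psi_int e'0.
exists m0 => m m0m.
have tail i n : \sum_(j <- box d n)
    (if j - i \in box d m then 0 else Psi psi (inorm (j - i))) <= e'.
  apply: le_trans (hm0 i n); apply: ler_sum => j _.
  have [h|h] := boolP (j - i \in box d m0); last by case: ifP.
  by rewrite ((fsubsetP (box_subset d m0m)) _ h).
pose k : R := eps * e / (8 * T * (S + 1)).
have S1 : 0 < S + 1 by rewrite ltr_wpDl.
have k0 : 0 < k by rewrite divr_gt0 ?mulr_gt0.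
have [N hN] := @shell_small R d m k d_gt0 k0.
exists N.+1 => n nN; have [mn sh] := hN n (ltnW nN).
pose V : R := (n + n)%:R ^+ d.
have V0 : 0 < V by rewrite exprn_gt0// ltr0n addn_gt0 (leq_trans _ nN).
pose th : R := eps * V; have th0 : 0 < th by rewrite mulr_gt0.
pose W : R := e' * ((n + m) + (n + m))%:R ^+ d +
  S * (((n + m) + (n + m))%:R ^+ d - ((n - m) + (n - m))%:R ^+ d).
have Wle : 2 * W * t%:R <= th * (e / 2).
  have h1 : ((n + m) + (n + m))%:R ^+ d <= 2 ^+ d * V.
    rewrite -exprMn; apply: lerXn2r; rewrite ?nnegrE ?mulr_ge0//.
    by rewrite -natrM ler_nat mul2n -addnn leq_add// leq_add2l.
  have h2 : e' * ((n + m) + (n + m))%:R ^+ d <= eps * e / (8 * T) * V.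
    apply: (@le_trans _ _ (e' * (2 ^+ d * V))); first by rewrite ler_wpM2l// ltW.
    rewrite le_eqVlt; apply/orP; left; apply/eqP; rewrite /e'; field.
    by rewrite !gt_eqF.
  have h3 : S * (((n + m) + (n + m))%:R ^+ d - ((n - m) + (n - m))%:R ^+ d) <=
      eps * e / (8 * T) * V.
    apply: (@le_trans _ _ ((S + 1) * (k * V))).
      apply: (@le_trans _ _ (S * (k * V))); first by rewrite ler_wpM2l.
      apply: ler_wpM2r; first by rewrite mulr_ge0 ?(ltW k0) ?(ltW V0).
      by rewrite lerDl.
    rewrite le_eqVlt; apply/orP; left; apply/eqP; rewrite /k; field.
    by rewrite !gt_eqF.
  apply: (@le_trans _ _ (2 * (eps * e / (8 * T) * V + eps * e / (8 * T) * V) * T)).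
    apply: ler_pM => //.
    - rewrite mulr_ge0// /W addr_ge0// mulr_ge0 ?(ltW e'0) ?exprn_ge0// subr_ge0.
      apply: lerXn2r; rewrite ?nnegrE// ler_nat.
      by rewrite leq_add// (leq_trans (leq_subr _ _)) ?leq_addr.
    - by rewrite ler_wpM2l// lerD.
    - by rewrite /T lerDl.
  rewrite le_eqVlt; apply/orP; left; apply/eqP; rewrite /th; field.
  by rewrite !gt_eqF.
have hW M : \sum_(i <- box d (n + m)) \sum_(j <- box d M) boundary_weight psi n i j <= W.
  apply: sum_boundary_weight => //; exact: ltW.
pose B M : set (config R d) := [set omega | th <= boundary_sum psi n m M omega].
have mB M : measurable (B M).
  rewrite -[X in measurable X]setTI; apply: measurable_fun_le => //.
  exact: measurable_boundary_sum.
have mI : measurable (@moderate R d t) by exact: measurable_moderate.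
have BI M : (mu (B M `&` moderate t) <= (e / 2)%:E)%E.
  have mBI : measurable (B M `&` moderate t) by exact: measurableI.
  have : (th%:E * mu (B M `&` moderate t) <= (2 * W * t%:R)%:E)%E.
    apply: le_trans (@mul_measure_le_integral _ _ _ mu _ th
      (fun omega => (\1_(moderate t) omega * boundary_sum psi n m M omega)%:E) mBI _ _ _) _ => //.
    - exact: ltW.
    - by move=> omega; rewrite lee_fin mulr_ge0// boundary_sum_ge0.
    - by move=> omega [Bo Io]; rewrite indicE mem_set// mul1r lee_fin.
    - exact: moderate_boundary_sum.
  move=> h; rewrite -(@lee_pmul2l _ th%:E)// ?lte_fin//.
  by apply: (le_trans h); rewrite -EFinM lee_fin.
have BU : (mu ((\bigcup_M B M) `&` moderate t) <= (e / 2)%:E)%E.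
  rewrite setI_bigcupl; apply: measure_bigcup_le => // M; first exact: measurableI.
  move=> omega [Bo Io]; split=> //; apply: le_trans Bo _.
  apply: ler_sum => i _; apply: ler_sum_fset => [|j]; first exact: box_subset.
  by rewrite mulr_ge0 ?boundary_weight_ge0// addr_ge0 ?sqr_ge0.
have mU : measurable ((\bigcup_M B M) `&` moderate t).
  by apply: measurableI => //; exact: bigcup_measurable.
apply: (@le_trans _ _ (mu ((\bigcup_M B M) `&` moderate t) + mu (~` moderate t))%E); last first.
  by rewrite [e]splitr EFinD leeD.
rewrite -measureU//; last 2 first.
- exact: measurableC.
- by apply/seteqP; split=> // omega [[]].
apply: le_measure; rewrite ?inE.
- by apply: measurableC; exact: measurable_decoupled.
- by apply: measurableU => //; exact: measurableC.
move=> omega /existsNP[M /negP]; rewrite -ltNge => /ltW h.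
by have [Io|Io] := pselect (moderate t omega); [left; split=> //; exists M|right].
Qed.

End one_law.
End decoupling.

(** * Uniqueness of the Gibbs measure *)

Section large_deviation.
Variables (R : realType) (d : nat) (r : nat) (E : set (config R d)).
Hypothesis mE : measurable (E : set (local_config (@hcube R d r))).
Variable P : probability (config R d) R.
Implicit Types (n : nat) (l C t : R).

Definition high_count n t : set (config R d) := [set eta | t <= box_count r E n eta].

Lemma measurable_high_count n t (L : set 'rV[R]_d) : @hcube R d n `<=` L ->
  measurable (high_count n t : set (local_config L)).
Proof.
move=> nL; have m1 := measurable_box_count_local mE nL.
rewrite (_ : high_count n t = setT `&` (box_count r E n) @^-1` `[t, +oo[%classic).
  exact: (m1 measurableT _ (measurable_itv _)).
by rewrite setTI; apply/seteqP; split=> eta /=; rewrite in_itv/= andbT.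
Qed.

Let mhc n t : measurable (high_count n t).
Proof. exact: measurable_local_config (@measurable_high_count n t setT (@subsetT _ _)). Qed.

(** The exponential Markov inequality. *)
Lemma high_count_le n l t : 0 < l ->
  fine (P (high_count n t)) <= expR (ln (\int[P]_eta expR (l * box_count r E n eta)) - l * t).
Proof.
move=> l0; have bF := bounded_box_count mE n.
have bl : bounded_measurable (fun eta => l * box_count r E n eta) by exact: bounded_measurableZ.
rewrite expRD expRN lnK ?posrE; last exact: expectation_expR_gt0.
rewrite ler_pdivlMr ?expR_gt0// mulrC -lee_fin EFinM fineK; last exact: fin_num_measure.
rewrite -expectation_EFin; last exact: bounded_measurable_expR.
apply: mul_measure_le_integral => // eta h.
by rewrite lee_fin ler_expR ler_wpM2l ?(ltW l0).
Qed.

(** F_n is at most t off the event and at most the number of translates on it. *)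
Lemma high_count_ge n t : translation_invariant P -> 0 <= t ->
  ((n - r) + (n - r))%:R ^+ d * fine (P E) - t <=
  ((n - r) + (n - r))%:R ^+ d * fine (P (high_count n t)).
Proof.
move=> ti t0; set W : R := _ ^+ d.
have bF := bounded_box_count mE n.
have b1 : bounded_measurable (\1_(high_count n t) : config R d -> R).
  split; first exact: measurable_indic.
  by exists 1 => w; rewrite ger0_norm// indicE; case: (_ \in _).
rewrite -(expectation_box_count mE n ti) lerBlDr.
have -> : fine (P (high_count n t)) = \int[P]_eta \1_(high_count n t) eta.
  by rewrite /Rintegral integral_indic// setIT.
rewrite -expectationZ// -[X in _ <= _ + X](expectation_cst P t) -expectationD//; last 2 first.
- exact: bounded_measurableZ.
- exact: bounded_measurable_cst.
apply: le_expectation => //.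
  by apply: bounded_measurableD; [exact: bounded_measurableZ|exact: bounded_measurable_cst].
move=> eta; have /andP[F0 FW] := box_count_bounds r E n eta.
have [h|h] := leP t (box_count r E n eta).
  by rewrite indicE mem_set// mulr1 (le_trans FW)// lerDl.
by rewrite indicE memNset ?mulr0 ?add0r ?(ltW h)//; apply/negP; rewrite -ltNge.
Qed.

End large_deviation.

Section no_separation.
Variables (R : realType) (d : nat) (phi : 'rV[R]_d -> R) (psi : R -> R) (r0 b : R).
Hypothesis d_gt0 : (0 < d)%N.
Hypothesis phi_measurable : measurable_fun [set: 'rV[R]_d] phi.
Hypothesis phi_even : forall x, phi (- x) = phi x.
Hypothesis psi_ge0 : forall r : R, 0 <= r -> 0 <= psi r.
Hypothesis psi_anti : forall r s : R, 0 <= r -> r <= s -> psi s <= psi r.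
Hypothesis psi_int :
  (\int[lebesgue_measure]_(r in `[0%R, +oo[) (psi r * r ^+ d.-1)%:E < +oo)%E.
Hypothesis phi_lower : forall x, - psi (enorm x) <= phi x.
Hypothesis phi_upper : forall x, r0 <= enorm x -> phi x <= psi (enorm x).
Hypothesis b_ge0 : 0 <= b.
Hypothesis phi_stable : forall (X : set 'rV[R]_d) (s : {fset 'rV[int]_d}), finite_set X ->
  (forall x, X x -> cell_of x \in s) -> - b * #|` s|%:R <= energy phi X.
Variables pi mu nu : probability (config R d) R.
Hypothesis pi_poisson : poisson_process pi.
Hypothesis mu_gibbs : tempered_gibbs phi pi mu.
Hypothesis nu_gibbs : tempered_gibbs phi pi nu.
Variables (r : nat) (E : set (config R d)).
Hypothesis mE : measurable (E : set (local_config (@hcube R d r))).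
Variables l0 C : R.
Hypotheses (l00 : 0 < l0) (C0 : 0 <= C).
Hypothesis conc : forall n l, 0 < l <= l0 ->
  ln (\int[nu]_eta expR (l * box_count r E n eta)) <=
    l * (((n - r) + (n - r))%:R ^+ d * fine (nu E)) + C * l ^+ 2 * (n + n)%:R ^+ d.

Let q := fine (mu E).
Let p := fine (nu E).
Let V n : R := (n + n)%:R ^+ d.
Let W n : R := ((n - r) + (n - r))%:R ^+ d.

Let n_le_V n : n%:R <= V n.
Proof.
rewrite /V -natrX ler_nat; apply: (@leq_trans (n + n)); first exact: leq_addr.
by case: d d_gt0 => // k _; case: n => // n; rewrite -{1}[(_ + _)%N]expn1 leq_pexp2l.
Qed.

(** [high_count_le] at the parameter of [exists_rate]. *)
Let deviation : p < q -> exists2 k : R, 0 < k & forall n, (r + r <= n)%N ->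
  fine (nu (high_count r E n ((p + q) / 2 * W n))) <= expR (- (k * V n)).
Proof.
move=> pq; have [l [k [ll0 k0 rate]]] := exists_rate d r pq l00 C0.
have lgt : 0 < l by case/andP: ll0.
exists k => // n rn; apply: le_trans (high_count_le mE nu n _ lgt) _.
rewrite ler_expR lerBlDr; apply: le_trans (conc n ll0) _.
by rewrite [leRHS]addrC lerBrDr; exact: rate.
Qed.

(** Let A be the event that F_n exceeds the middle of its two means. Then nu(A) is at
most exp(- k (2n)^d), and mu(A) is at least (q - p) / 2, half of which survives the
restriction to decoupled configurations. The thresholds are chosen such that
the loss in [gibbs_comparison] is at most 2 exp(k (2n)^d / 4), which is a
contradiction for large n. *)
Lemma gibbs_not_separated : ~ (p < q).
Proof.
move=> pq; have [k k0 dev] := deviation pq.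
have [mut muti _] := mu_gibbs; have [nut nuti _] := nu_gibbs.
(* mu(A) >= 2 g, and half of it is left to non-decoupled configurations. *)
pose g : R := (q - p) / 4; have g0 : 0 < g by rewrite divr_gt0// subr_gt0.
have e4 : (0 : R) < 4^-1 by rewrite invr_gt0.
(* 3 eps from the interaction and k / 32 from the shell add up to k / 8. *)
pose eps : R := k / 32; have eps0 : 0 < eps by rewrite divr_gt0.
have [m1 hm1] := decoupled_mass d_gt0 psi_ge0 psi_anti psi_int muti mut g0 eps0.
have [m2 hm2] := decoupled_mass d_gt0 psi_ge0 psi_anti psi_int nuti nut e4 eps0.
pose m := maxn (maxn m1 m2) (maxn 1 (Num.truncn r0).+1).
have m1m : (m1 <= m)%N by rewrite /m !leq_max leqnn.
have m2m : (m2 <= m)%N by rewrite /m !leq_max leqnn orbT.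
have m0 : (0 < m)%N by rewrite /m !leq_max leqnn !orbT.
have r0m : r0 <= m%:R.
  apply: le_trans (ltW (truncnS_gt r0)) _; rewrite ler_nat /m !leq_max leqnn !orbT//.
have [N1 hN1] := hm1 m m1m; have [N2 hN2] := hm2 m m2m.
pose kp : R := k / (32 * (b + 1)).
have b1 : 0 < b + 1 by rewrite ltr_wpDl.
have kp0 : 0 < kp by rewrite divr_gt0// mulr_gt0.
have [N3 hN3] := @shell_small R d m kp d_gt0 kp0.
pose N4 := (Num.truncn (4 / (k * g))).+1.
pose n := maxn (maxn N1 N2) (maxn N3 (maxn N4 (maxn (r + r) r.+1))).
have nN1 : (N1 <= n)%N by rewrite /n !leq_max leqnn.
have nN2 : (N2 <= n)%N by rewrite /n !leq_max leqnn !orbT.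
have nN3 : (N3 <= n)%N by rewrite /n !leq_max leqnn !orbT.
have nN4 : (N4 <= n)%N by rewrite /n !leq_max leqnn !orbT.
have nr : (r + r <= n)%N by rewrite /n !leq_max leqnn !orbT.
have nr1 : (r < n)%N by rewrite /n !leq_max leqnn !orbT.
clearbody m n.
have {}hN1 := hN1 n nN1; have {}hN2 := hN2 n nN2; have [mn sh] := hN3 n nN3.
rewrite -/(V n) in sh.
pose th : R := eps * V n.
pose D := @decoupled R d psi n m th.
have mD : measurable D by exact: measurable_decoupled.
have V0 : 0 < V n by rewrite exprn_gt0// ltr0n addn_gt0 (leq_trans _ nr1).
have W0 : 0 < W n by rewrite exprn_gt0// ltr0n addn_gt0 subn_gt0 nr1.
pose A := high_count r E n ((p + q) / 2 * W n).
have mA : measurable (A : set (local_config (@hcube R d n))).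
  by apply: measurable_high_count.
have mA' : measurable A by exact: measurable_local_config mA.
have p0 : 0 <= p by exact: fine_ge0.
have q0 : 0 <= q by exact: fine_ge0.
have muA : 2 * g <= fine (mu A).
  have t0 : 0 <= (p + q) / 2 * W n by rewrite mulr_ge0 ?(ltW W0)// divr_ge0// addr_ge0.
  have := high_count_ge mE n muti t0; rewrite -/(W n) -/q -/A => h.
  rewrite -(ler_pM2l W0); apply: le_trans h; rewrite le_eqVlt; apply/orP; left; apply/eqP.
  by rewrite /g; field.
have fin (Q : probability (config R d) R) B : measurable B -> Q B = (fine (Q B))%:E.
  by move=> mB; rewrite fineK//; exact: fin_num_measure.
have nuD : 2^-1 <= fine (nu D).
  have hC : nu (~` D) = (1 - fine (nu D))%:E.
    by rewrite (@probability_setC _ _ _ nu _ mD) {1}(fin nu D mD) -EFinB.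
  have := hN2; rewrite -/(V n) -/th -/D hC lee_fin.
  by move: (fine _) => x; lra.
have muAD : g <= fine (mu (A `&` D)).
  have := hN1; rewrite -/(V n) -/th -/D (fin mu _ (measurableC mD)) lee_fin => h1.
  have mAD : measurable (A `&` D) by exact: measurableI.
  have mAC : measurable (A `&` ~` D) by apply: measurableI => //; exact: measurableC.
  have h2 : fine (mu A) = fine (mu (A `&` D)) + fine (mu (A `&` ~` D)).
    apply: EFin_inj; rewrite EFinD -!fin// -measureU//; last first.
      by apply/seteqP; split=> // w [[_ h] [_ /(_ h)]].
    by congr (mu _); rewrite -setIUr setUv setIT.
  have h3 : fine (mu (A `&` ~` D)) <= fine (mu (~` D)).
    apply: fine_le; [exact: fin_num_measure|apply: fin_num_measure; exact: measurableC|].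
    apply: le_measure; rewrite ?inE//; exact: measurableC.
  move: muA h1 h3; rewrite h2; move: (fine _) (fine _) (fine _) => x y z; lra.
have cmp := gibbs_comparison d_gt0 phi_measurable phi_even psi_ge0 psi_anti psi_int phi_lower
  phi_upper phi_stable pi_poisson r0m (t := th) mu_gibbs nu_gibbs mA nuD.
have vol := @volume_shell R d n m m0 mn.
pose X : R := 3 * th + b * shell_card R d n m + volume (@hcube R d (n + m) `\` hcube n).
have X_le : X <= k / 8 * V n.
  have sc : shell_card R d n m <= kp * V n.
    apply: le_trans sh; rewrite lerD2l lerN2; apply: lerXn2r; rewrite ?nnegrE// ler_nat.
    by rewrite leq_add// leq_subr.
  have : b * shell_card R d n m <= b * (kp * V n) by apply: ler_wpM2l.
  have : (b + 1) * kp = k / 32 by rewrite /kp; field; rewrite gt_eqF.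
  move=> h1 h2; have h3 := le_trans vol sh.
  have h4 : X <= 3 * th + (b + 1) * kp * V n.
    rewrite /X; move: h2 h3; move: (shell_card _ _ _ _) (volume _) (V n) => s v w; lra.
  apply: (le_trans h4); rewrite h1 /th /eps; lra.
have nuA : fine (nu A) <= expR (- (k * V n)) by exact: dev.
have e1 : fine (mu (A `&` D)) <= 2 * expR (- (k * V n / 2)).
  apply: (le_trans cmp); rewrite -/X -mulrA ler_wpM2l//.
  apply: (@le_trans _ _ (expR (k / 8 * V n) ^+ 2 * expR (- (k * V n)))).
    apply: ler_pM => //; rewrite ?exprn_ge0 ?expR_ge0//.
    - exact: fine_ge0.
    - by apply: lerXn2r; rewrite ?nnegrE ?expR_ge0// ler_expR.
  rewrite expr2 -!expRD ler_expR.
  have : 0 <= k * V n by rewrite mulr_ge0 ?ltW.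
  by move: (V n) => v; lra.
have kV0 : 0 < k * V n by rewrite mulr_gt0.
have e2 : expR (- (k * V n / 2)) < g / 2.
  have g2 : 0 < g / 2 by rewrite divr_gt0.
  rewrite expRN -[ltRHS]invrK ltf_pV2 ?posrE ?invr_gt0 ?expR_gt0//.
  apply: lt_le_trans (expR_ge1Dx _).
  have : 4 / (k * g) <= V n.
    apply: le_trans (n_le_V n); apply: le_trans (ltW (truncnS_gt _)) _.
    by rewrite ler_nat.
  have kg : 0 < k * g by exact: mulr_gt0.
  rewrite (ler_pdivrMr _ _ kg) invf_div (ltr_pdivrMr _ _ g0) => h.
  have -> : (1 + k * V n / 2) * g = g + V n * (k * g) / 2 by field.
  by apply: (@lt_le_trans _ _ (g + 2)); [rewrite ltrDr|rewrite lerD2l ler_pdivlMr// -natrM].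
have := le_trans muAD e1; move: e2; move: (expR _) => x; lra.
Qed.

End no_separation.

Theorem theorem1p7 (R : realType) (d : nat) (d_gt0 : (0 < d)%N)
    (phi : 'rV[R]_d -> R)
    (phi_measurable : measurable_fun [set: 'rV[R]_d] phi)
    (phi_even : forall x : 'rV[R]_d, phi (- x) = phi x)
    (phi_superstable : superstable phi) (phi_regular : regular phi)
    (pi : probability (config R d) R) (pi_poisson : poisson_process pi)
    (nu : probability (config R d) R) (nu_gibbs : tempered_gibbs phi pi nu)
    (c : R) (c_gt0 : 0 < c) (nu_mlsi : mlsi_birth phi nu c) :
  (forall mu : probability (config R d) R,
     translation_invariant mu -> ~ same_law mu nu ->
     (0 < specific_relative_entropy mu nu)%E) /\
  (forall mu : probability (config R d) R,
     tempered_gibbs phi pi mu -> same_law mu nu).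
Proof.
have [psi [psi_ge0 psi_anti psi_int phi_lower [r0 phi_upper]]] := phi_regular.
have [b b_ge0 phi_stable] := energy_stable phi_superstable.
have [_ nu_ti _] := nu_gibbs.
have gnz := gnz_le d_gt0 phi_measurable phi_even psi_ge0 psi_anti psi_int
  phi_lower phi_upper pi_poisson nu_gibbs.
have concentration r (E : set (config R d)) (mE : measurable (E : set (local_config (hcube r)))) :=
  box_count_concentration c_gt0 nu_ti nu_mlsi gnz mE.
split=> [mu mu_ti|mu mu_gibbs].
  move=> /exists_separating_event[r [E [r_gt0 mE lt]]].
  have [l0 [C [l00 C0 conc]]] := concentration r E mE.
  exact: (specific_relative_entropy_gt0 mu_ti r_gt0 mE lt l00 C0 conc).
apply: contrapT => /exists_separating_event[r [E [r_gt0 mE lt]]].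
have [l0 [C [l00 C0 conc]]] := concentration r E mE.
exact: (gibbs_not_separated d_gt0 phi_measurable phi_even psi_ge0 psi_anti psi_int
  phi_lower phi_upper b_ge0 phi_stable pi_poisson mu_gibbs nu_gibbs mE l00 C0 conc lt).
Qed.
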